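(* For every $T\geq \frac{4}{\pi^2}$, the kernel $K_T$ is completely monotone on $(0,\infty)$. Further, for every $0<T<\frac{4}{\pi^2}$, the kernel $K_T$ is not monotone on $(0,\infty)$.
   Context: For $T>0$ let $l_T:\mathbb{R}\to(0,\infty)$ be the even function $l_T(\xi)=\left(\frac{\xi}{(1+T\xi^2)\tanh(\xi)}\right)^{1/2}$ for $\xi\neq 0$, $l_T(0)=1$. The Fourier transform is $\hat f(\xi)=\int_{\mathbb{R}} f(x)e^{-ix\xi}\,dx$, and $K_T=\mathcal{F}^{-1}(l_T)$ is the inverse Fourier transform of $l_T$ (in the sense of tempered distributions; it is an even function, smooth away from $x=0$). A function $g:(0,\infty)\to[0,\infty)$ is called completely monotone if it is infinitely differentiable and $(-1)^n g^{(n)}(\lambda)\geq 0$ for all $n=0,1,2,\ldots$ and all $\lambda>0$. *)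

(* Defs.v *)
From HB Require Import structures.
From mathcomp Require Import all_boot all_order all_algebra.
From mathcomp Require Import complex.
From mathcomp Require Import all_classical all_reals all_analysis.
Set Implicit Arguments.
Unset Strict Implicit.
Unset Printing Implicit Defensive.
Import Order.TTheory GRing.Theory Num.Theory.
Import numFieldNormedType.Exports.
Local Open Scope classical_set_scope.
Local Open Scope ring_scope.
Local Open Scope complex_scope.

Section functions_on_the_line.
Variable R : realType.
Implicit Types (f : R -> R) (A : set R).

Definition smooth_on A f :=
  forall (n : nat) (x : R), A x -> derivable (derive1n n f) x 1.

(* On the open set ]0, +oo[ the two-sided derivatives depend only on the
   restriction of f, so f may be any extension to the line of the function of
   interest; the case n = 0 of the inequality says that f is nonnegative. *)
Definition completely_monotone f :=
  smooth_on `]0, +oo[ f /\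
  forall (n : nat) (x : R), 0 < x -> 0 <= (-1) ^+ n * derive1n n f x.

Definition monotone_on A f :=
  {in A &, {homo f : x y / x <= y}} \/ {in A &, {homo f : x y /~ x <= y}}.

Definition tanh (x : R) : R :=
  (expR x - expR (- x)) / (expR x + expR (- x)).

Definition rapidly_decreasing f :=
  forall k : nat, exists M : R, forall x, `|x| ^+ k * `|f x| <= M.

Definition real_schwartz f :=
  smooth_on setT f /\ forall n : nat, rapidly_decreasing (derive1n n f).

End functions_on_the_line.

Section tempered_distributions.
Variable R : realType.
Implicit Types (g phi : R -> R[i]) (u : (R -> R[i]) -> R[i]).

Let mu := @lebesgue_measure R.

Definition cintegrable g :=
  mu.-integrable setT (EFin \o (fun x => complex.Re (g x))) /\
  mu.-integrable setT (EFin \o (fun x => complex.Im (g x))).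

Definition cintegral g : R[i] :=
  (\int[mu]_x complex.Re (g x)) +i* (\int[mu]_x complex.Im (g x)).

Definition schwartz phi :=
  real_schwartz (fun x => complex.Re (phi x)) /\
  real_schwartz (fun x => complex.Im (phi x)).

Definition cis (t : R) : R[i] := cos t +i* sin t.

(* The inverse, on Schwartz functions, of the transform
   f |-> (xi |-> \int f(x) exp(- i x xi) dx), whence the factor 1 / (2 pi). *)
Definition inv_fourier phi : R -> R[i] :=
  fun x => ((2 * pi)^-1)%:C * cintegral (fun xi => phi xi * cis (x * xi)).

(* Distributions are represented by their action on test functions; only the
   values at Schwartz functions are meaningful. *)
Definition inv_fourier_distribution u : (R -> R[i]) -> R[i] :=
  fun phi => u (inv_fourier phi).

Definition regular_distribution g : (R -> R[i]) -> R[i] :=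
  fun phi => cintegral (fun x => g x * phi x).

(* Without this condition the integrals in regular_distribution g could take
   the default value given to non-integrable functions. *)
Definition tempered_function g :=
  forall phi, schwartz phi -> cintegrable (fun x => g x * phi x).

Definition eq_distribution u v := forall phi, schwartz phi -> u phi = v phi.

End tempered_distributions.

Section kernel.
Variable R : realType.

Definition symbol (T : R) (xi : R) : R :=
  if xi == 0 then 1
  else Num.sqrt (xi / ((1 + T * xi ^+ 2) * tanh xi)).

(* The distribution determines K only almost everywhere; continuity away from 0
   selects the usual representative, unique up to its irrelevant value at 0. *)
Definition is_kernel (T : R) (K : R -> R) :=
  [/\ forall x, x != 0 -> {for x, continuous K},
      tempered_function (fun x => (K x)%:C) &
      eq_distribution
        (regular_distribution (fun x => (K x)%:C))
        (inv_fourier_distribution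
           (regular_distribution (fun xi => (symbol T xi)%:C)))].

End kernel.

(* Main.v *)
(* Let l be the symbol and \hat psi the cosine transform of a test function psi,
   so that \int K psi = (2 pi)^-1 \int l \hat psi.

   T >= 4 / pi^2. In the variable lambda = xi^2, the even and odd parts of
   (1 + xi / n)^n, which approximate cosh xi and sinh xi, have negative roots
   - p_k and - q_k given by tangents, with p_1 < q_1 < p_2 < q_2 < ... and
   p_1 > pi^2 / 4 >= 1 / T. So l is a limit of square roots of finite products of
   factors (1 + lambda / a) / (1 + lambda / b) with b <= a, where the intervals
   [b, a] are successively [1 / T, p_1], [q_1, p_2], ... Each square root is a
   limit of products of factors of the same kind, along every other cell of a
   fine grid of [b, a]; these products are rational Stieltjes functions
   c + \sum c_i / (lambda + b_i) with nonnegative coefficients. Since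
   1 / (xi^2 + s^2) is the transform of a multiple of exp (- s |x|), K pairs
   nonnegatively with every psi supported in ]0, +oo[ whose Laplace transform is
   nonnegative. This class contains the bumps and is stable under the transpose
   of f |-> f - f(. + h), so that all iterated differences of K are nonnegative,
   which forces K to be smooth and completely monotone.

   T < 4 / pi^2. If K is monotone then, since l is continuous at 0, wide cutoffs
   show that K has constant sign; K being even, l is up to sign a limit of
   transforms of nonnegative integrable functions, and l^2 is positive definite.
   Hence the Taylor coefficients d_n of l^2 as a power series in - xi^2 are
   nonnegative. They satisfy
     (\sum d_n z^n) (sin sqrt z / sqrt z) = cos sqrt z / (1 - T z),
   whose right-hand side vanishes at z = pi^2 / 4 < 1 / T, although the partial
   sums of the left-hand side there are at least those of sin sqrt z / sqrt z,
   because d_0 = 1. *)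

Require Import Defs.
From mathcomp Require Import all_boot all_order all_algebra.
From mathcomp Require Import ring lra complex.
From mathcomp Require Import all_classical all_reals all_analysis.
From mathcomp Require Import measurable_realfun.
Import Order.TTheory GRing.Theory Num.Theory.
Import numFieldNormedType.Exports.
Local Open Scope classical_set_scope.
Local Open Scope ring_scope.
Set Implicit Arguments.
Unset Strict Implicit.
Unset Printing Implicit Defensive.

(** * Lebesgue integration on the line *)

Section lebesgue_line.
Context {R : realType}.
Notation mu := (@lebesgue_measure R).
Implicit Types (f g h : R -> R).

Definition L1 f := mu.-integrable setT (EFin \o f).
Definition integ f : R := \int[mu]_x f x.

Lemma L1_meas f : L1 f -> measurable_fun setT f.
Proof. by move=> /measurable_int/measurable_EFinP. Qed.

Lemma eq_L1 f g : f =1 g -> L1 f -> L1 g.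
Proof. by move=> /funext ->. Qed.

Lemma eq_integ f g : f =1 g -> integ f = integ g.
Proof. by move=> /funext ->. Qed.

Lemma le_L1 f g : measurable_fun setT f -> (forall x, `|f x| <= g x) -> L1 g -> L1 f.
Proof.
move=> mf fg ig; apply: (le_integrable measurableT _ _ ig).
  exact/measurable_EFinP.
by move=> x _; rewrite /= lee_fin (le_trans (fg x))// ler_norm.
Qed.

Lemma L1D f g : L1 f -> L1 g -> L1 (fun x => f x + g x).
Proof. by move=> If Ig; exact: (integrableD measurableT If Ig). Qed.

Lemma L1Zl c f : L1 f -> L1 (fun x => c * f x).
Proof. by move=> If; exact: (integrableZl measurableT c If). Qed.

Lemma L1N f : L1 f -> L1 (fun x => - f x).
Proof. by move=> /(L1Zl (-1)); apply: eq_L1 => x; rewrite mulN1r. Qed.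

Lemma L1B f g : L1 f -> L1 g -> L1 (fun x => f x - g x).
Proof. by move=> If Ig; apply: L1D => //; apply: L1N. Qed.

Lemma L10 : L1 (fun=> 0).
Proof. exact: integrable0. Qed.

Lemma L1_norm f : L1 f -> L1 (fun x => `|f x|).
Proof. by move=> If; exact: (integrable_abse If). Qed.

Lemma L1_bounded_mul f g (M : R) : L1 f -> measurable_fun setT g ->
  (forall x, `|g x| <= M) -> L1 (fun x => f x * g x).
Proof.
move=> If mg gM; apply: (le_L1 (g := fun x => M * `|f x|)).
- by apply: measurable_funM => //; exact: L1_meas.
- by move=> x; rewrite normrM mulrC ler_wpM2r.
- by apply: L1Zl; exact: L1_norm.
Qed.

Lemma integD f g : L1 f -> L1 g -> integ (fun x => f x + g x) = integ f + integ g.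
Proof. by move=> If Ig; exact: (RintegralD measurableT If Ig). Qed.

Lemma integB f g : L1 f -> L1 g -> integ (fun x => f x - g x) = integ f - integ g.
Proof. by move=> If Ig; exact: (RintegralB measurableT If Ig). Qed.

Lemma integZl c f : L1 f -> integ (fun x => c * f x) = c * integ f.
Proof. by move=> If; exact: (RintegralZl c measurableT If). Qed.

Lemma integ0 : integ (fun=> 0) = 0.
Proof. by rewrite /integ /Rintegral integral0. Qed.

Lemma integ_ge0 f : (forall x, 0 <= f x) -> 0 <= integ f.
Proof. by move=> f0; apply: Rintegral_ge0. Qed.

Lemma le_integ f g : L1 f -> L1 g -> (forall x, f x <= g x) -> integ f <= integ g.
Proof. by move=> If Ig fg; apply: le_Rintegral => //. Qed.

Lemma le_norm_integ f : L1 f -> `|integ f| <= integ (fun x => `|f x|).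
Proof. by move=> If; apply: le_normr_Rintegral. Qed.

Lemma integ_dom (f_ : nat -> R -> R) f g :
  (forall n, measurable_fun setT (f_ n)) -> L1 g ->
  (forall n x, `|f_ n x| <= g x) ->
  (forall x, f_ n x @[n --> \oo] --> f x) ->
  L1 f /\ integ (f_ n) @[n --> \oo] --> integ f.
Proof.
move=> mf Lg fg ff.
have mff : measurable_fun setT f.
  by apply: (measurable_fun_cvg (h := f_)) => // x _; exact: ff.
have [] := @dominated_convergence _ _ R mu setT measurableT (fun n => EFin \o f_ n) (EFin \o f) (EFin \o g).
- by move=> n; apply/measurable_EFinP; exact: mf.
- by apply/measurable_EFinP.
- by apply: aeW => x _; apply: cvg_EFin; [exact: nearW|exact: ff].
- exact: Lg.
- by apply: aeW => x n _; rewrite /= lee_fin.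
move=> If _ C; split => //.
have Fin : (\int[mu]_x (EFin \o f) x)%E \is a fin_num by exact: integrable_fin_num.
by apply: fine_cvg; rewrite fineK.
Qed.

Lemma cont_meas f : continuous f -> measurable_fun setT f.
Proof. exact: continuous_measurable_fun. Qed.

(** Serves to ignore the value of a kernel at 0, which [is_kernel] leaves arbitrary. Measurability
    of [g] comes from writing it as [f] modified at the single point [a]. *)
Lemma eq_integ_ae f g (a : R) : L1 f -> (forall x, x != a -> f x = g x) ->
  L1 g /\ integ f = integ g.
Proof.
move=> Lf fg.
have mg : measurable_fun setT g.
  have -> : g = (fun x => if x == a then g a else f x).
    by apply/funext => x; case: eqP => [->//|/eqP/fg ->].
  apply: measurable_fun_ifT => //; last exact: L1_meas.
  exact: measurable_fun_eqr.
have ae : ae_eq mu setT (EFin \o f) (EFin \o g).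
  exists [set a]; split; [exact: measurable_set1|exact: lebesgue_measure_set1|].
  move=> x /= H; apply: contrapT => xa; apply: H => _; rewrite /= fg//.
  by apply/eqP.
have mef : measurable_fun setT (EFin \o f) by apply/measurable_EFinP; exact: L1_meas.
have meg : measurable_fun setT (EFin \o g) by apply/measurable_EFinP.
split; last by congr fine; exact: ae_eq_integral.
move/integrableP : Lf => [_ fi]; apply/integrableP; split => //.
rewrite (le_lt_trans _ fi)// le_eqVlt; apply/orP; left; apply/eqP.
apply: ae_eq_integral => //; do ?exact: measurableT_comp.
move: ae; apply: filterS => x H Tx.
by have [fgx] : (f x)%:E = (g x)%:E := H Tx; rewrite /= fgx.
Qed.

(** By uniqueness of Lebesgue measure it suffices to treat half-open intervals, and the preimage of
    []c, d]] has length [(d - c) / a]. *)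
Lemma lebesgue_measure_affine (a b : R) (A : set R) : 0 < a -> measurable A ->
  (a%:E * pushforward mu ((fun x => a * x + b)%R : measurableTypeR R -> measurableTypeR R) A)%E = mu A.
Proof.
move=> a0 mA.
have mphi : measurable_fun setT ((fun x => a * x + b) : measurableTypeR R -> measurableTypeR R).
  apply: cont_meas => x; apply: cvgD; [apply: cvgM; [exact: cvg_cst|exact: cvg_id]|exact: cvg_cst].
have H := @lebesgue_measure_unique R (mscale (NngNum (ltW a0)) (pushforward mu (fun x : measurableTypeR R => (a * x + b)%R : measurableTypeR R))).
rewrite [RHS](H mphi)//= => _ [[c d]] _ <-.
rewrite /mscale /= /pushforward /=.
have -> : (fun x : R => a * x + b) @^-1` `]c, d] = `](c - b) / a, (d - b) / a]%classic.
  apply/seteqP; split => x /=; rewrite !in_itv/= ltr_pdivrMr// ler_pdivlMr// ltrBlDr lerBrDr (mulrC x) //.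
rewrite !lebesgue_measure_itv/= !lte_fin ltr_pM2r ?invr_gt0// ltrD2r.
case: ifP => _; last by rewrite mule0.
by rewrite -!EFinB -EFinM; congr EFin; field; apply: lt0r_neq0.
Qed.

(** The pushforward formula for nonnegative functions is applied to the positive and negative parts
    separately. *)
Lemma L1_integ_affine_pos (a b : R) f : 0 < a -> L1 f ->
  L1 (fun x => f (a * x + b)) /\ integ f = a * integ (fun x => f (a * x + b)).
Proof.
move=> a0 Lf.
have mphi : measurable_fun setT ((fun x => a * x + b) : measurableTypeR R -> measurableTypeR R).
  apply: cont_meas => x; apply: cvgD; [apply: cvgM; [exact: cvg_cst|exact: cvg_id]|exact: cvg_cst].
have muE := lebesgue_measure_affine b a0.
have E (F : R -> \bar R) : measurable_fun setT F -> (forall x, 0 <= F x)%E ->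
    (\int[mu]_x F x = a%:E * \int[mu]_x F (a * x + b)%R)%E.
  move=> mF F0; have := ge0_integral_pushforward mphi mu measurableT mF (fun y _ => F0 y).
  rewrite preimage_setT /comp => <-.
  rewrite -(ge0_integral_mscale _ measurableT (NngNum (ltW a0)))//.
  by apply: eq_measure_integral => A mA _; first [exact: muE | exact: (esym (muE A mA))].
have mf := L1_meas Lf.
have mef : measurable_fun setT (EFin \o f) by apply/measurable_EFinP.
have Lg : L1 (fun x => f (a * x + b)).
  apply/integrableP; split.
    by apply/measurable_EFinP; exact: (measurableT_comp mf mphi).
  move/integrableP : Lf => [_]; rewrite E//; last by apply: measurableT_comp.
  rewrite /comp; case: (\int[mu]_x _)%E => //= [r _|]; first by rewrite ltry.
  by rewrite gt0_muley ?lte_fin.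
split => //.
rewrite /integ /Rintegral integralE (E _ (measurable_funepos mef))//.
rewrite (E _ (measurable_funeneg mef))//.
have H : (\int[mu]_x (f (a * x + b)%R)%:E)%E = (\int[mu]_x (EFin \o f)^\+ (a * x + b)%R - \int[mu]_x (EFin \o f)^\- (a * x + b)%R)%E.
  by rewrite integralE funepos.unlock funeneg.unlock.
rewrite -[X in X * _]/(fine a%:E) -fineM//; last exact: (integrable_fin_num measurableT Lg).
congr fine; rewrite H.
(* Distributing [a] over this difference of extended reals requires it to be well defined, which
   integrability ensures. *)
have : (\int[mu]_x (EFin \o f)^\+ (a * x + b)%R +? - \int[mu]_x (EFin \o f)^\- (a * x + b)%R)%E.
  have := integrable_add_def measurableT Lg.
  by rewrite funepos.unlock funeneg.unlock.
move: (\int[mu]_x _)%E (\int[mu]_x _)%E => X Y XY.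
by rewrite muleBr.
Qed.

Lemma L1_integ_opp f : L1 f -> L1 (fun x => f (- x)) /\ integ f = integ (fun x => f (- x)).
Proof.
move=> Lf.
have mphi : measurable_fun setT ((fun x => - x) : measurableTypeR R -> measurableTypeR R).
  apply: cont_meas => x; apply: cvgN; exact: cvg_id.
have muE := @lebesgue_measureN R.
have E (F : R -> \bar R) : measurable_fun setT F -> (forall x, 0 <= F x)%E ->
    (\int[mu]_x F x = \int[mu]_x F (- x)%R)%E.
  move=> mF F0; have := ge0_integral_pushforward mphi mu measurableT mF (fun y _ => F0 y).
  rewrite preimage_setT /comp => <-.
  by apply: eq_measure_integral => A mA _; first [exact: muE | exact: (esym (muE A mA))].
have mf := L1_meas Lf.
have mef : measurable_fun setT (EFin \o f) by apply/measurable_EFinP.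
have Lg : L1 (fun x => f (- x)).
  apply/integrableP; split.
    by apply/measurable_EFinP; exact: (measurableT_comp mf mphi).
  by move/integrableP : Lf => [_]; rewrite E//; apply: measurableT_comp.
split => //.
rewrite /integ /Rintegral integralE (E _ (measurable_funepos mef))//.
rewrite (E _ (measurable_funeneg mef))//; congr fine; apply: esym.
by rewrite integralE funepos.unlock funeneg.unlock.
Qed.

Lemma L1_integ_shift (b : R) f : L1 f ->
  L1 (fun x => f (x + b)) /\ integ f = integ (fun x => f (x + b)).
Proof.
move=> Lf; have [L E] := L1_integ_affine_pos b ltr01 Lf.
have H : (fun x => f (1 * x + b)) = (fun x => f (x + b)).
  by apply/funext => x; rewrite mul1r.
by rewrite H mul1r in L E.
Qed.

End lebesgue_line.

(** * Cosine transforms *)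

Section cosine_transform.
Context {R : realType}.
Notation mu := (@lebesgue_measure R).
Implicit Types (f g h psi : R -> R).

Lemma cvg_cont (u : nat -> R) h (a : R) : {for a, continuous h} ->
  u n @[n --> \oo] --> a -> h (u n) @[n --> \oo] --> h a.
Proof. by move=> ch ua; apply: continuous_cvg. Qed.

(** For real [f] this is the real part of its Fourier transform, which is all that pairing with a
    real even symbol sees. *)
Definition ct f (xi : R) : R := integ (fun x => f x * cos (x * xi)).

Lemma continuous_cosM (xi : R) : continuous (fun x : R => cos (x * xi)).
Proof.
move=> x; apply: (@continuous_comp _ _ _ (fun x : R => x * xi) cos).
  by apply: cvgM; [exact: cvg_id|exact: cvg_cst].
exact: continuous_cos.
Qed.

Lemma L1_cos f (xi : R) : L1 f -> L1 (fun x => f x * cos (x * xi)).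
Proof.
move=> Lf; apply: (L1_bounded_mul (M := 1)) => //.
  by apply: cont_meas; exact: continuous_cosM.
by move=> x; exact: cos_max.
Qed.

Lemma ct_bound f (xi : R) : L1 f -> `|ct f xi| <= integ (fun x => `|f x|).
Proof.
move=> Lf; rewrite (le_trans (le_norm_integ (L1_cos xi Lf)))//.
apply: le_integ; [exact: L1_norm (L1_cos _ _)|exact: L1_norm|] => x.
by rewrite normrM ler_piMr// cos_max.
Qed.

Lemma ct_continuous f : L1 f -> continuous (ct f).
Proof.
move=> Lf xi.
apply: (@continuity_under_integral R _ _ mu (fun xi x => f x * cos (x * xi)) setT measurableT (xi - 1) (xi + 1) _ _ (fun x => `|f x|)).
- by move=> y _; exact: L1_cos.
- apply: aeW => x _ y _; apply: cvgM; first exact: cvg_cst.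
  apply: (@continuous_comp _ _ _ (fun y : R => x * y) cos).
    by apply: cvgM; [exact: cvg_cst|exact: cvg_id].
  exact: continuous_cos.
- exact: L1_norm.
- by move=> y _; apply: aeW => x _; rewrite normrM ler_piMr// cos_max.
- by rewrite inE /= in_itv/=; apply/andP; split; rewrite ?ltrDl// ltrBlDr ltrDl.
Qed.

Lemma ct_meas f : L1 f -> measurable_fun setT (ct f).
Proof. by move=> Lf; apply: cont_meas; exact: ct_continuous. Qed.

(** The multiplication formula: Fubini for [f x * cos (x * y) * g y], dominated by the product of
    [|f x|] and [|g y|]. *)
Lemma ct_swap f g : L1 f -> L1 g ->
  integ (fun y => ct f y * g y) = integ (fun x => f x * ct g x).
Proof.
move=> Lf Lg.
pose h (z : measurableTypeR R * measurableTypeR R) : \bar R := (f z.1 * cos (z.1 * z.2) * g z.2)%:E.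
have mh : measurable_fun setT h.
  apply/measurable_EFinP; apply: measurable_funM; first apply: measurable_funM.
  - by apply: (measurableT_comp (L1_meas Lf)); exact: measurable_fst.
  - apply: (measurableT_comp (cont_meas (@continuous_cos R))).
    by apply: measurable_funM; [exact: measurable_fst|exact: measurable_snd].
  - by apply: (measurableT_comp (L1_meas Lg)); exact: measurable_snd.
have L1x x : L1 (fun y => f x * cos (x * y) * g y).
  have := L1Zl (f x) (L1_cos x Lg); apply: eq_L1 => y.
  by rewrite (mulrC y) mulrA mulrAC.
have L1y y : L1 (fun x => f x * cos (x * y) * g y).
  by have := L1Zl (g y) (L1_cos y Lf); apply: eq_L1 => x; rewrite mulrC.
have ih : (mu \x mu)%E.-integrable setT h.
  apply/integrable12ltyP; first exact: mh.
  apply: (@le_lt_trans _ _ (\int[mu]_x (`|f x| * integ (fun y => `|g y|))%:E)%E).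
    apply: ge0_le_integral => //.
    - by move=> x _; apply: integral_ge0.
    - apply: (measurable_fun_fubini_tonelli_F (abse \o h)); last by move=> z; exact: abse_ge0.
      exact: measurableT_comp.
    - apply/measurable_EFinP.
      by apply: measurable_funM => //; exact: L1_meas (L1_norm Lf).
    - move=> x _.
      have I1 : L1 (fun y => `|f x * cos (x * y) * g y|) by exact: L1_norm.
      have I2 : L1 (fun y => `|f x| * `|g y|) by apply: L1Zl; exact: L1_norm.
      rewrite -(integZl _ (L1_norm Lg)) /integ /Rintegral fineK; last first.
        exact: (integrable_fin_num measurableT I2).
      apply: ge0_le_integral => //.
      + by apply/measurable_EFinP; exact: L1_meas I1.
      + by apply/measurable_EFinP; exact: L1_meas I2.
      + move=> y _; rewrite /h /= lee_fin !normrM ler_wpM2r//.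
        by rewrite ler_piMr// cos_max.
  have := L1Zl (integ (fun y => `|g y|)) (L1_norm Lf).
  move=> /(@integrable_fin_num _ _ _ _ _ measurableT _); rewrite ge0_fin_numE.
    by under [X in (X < _)%E -> _]eq_integral do rewrite /= mulrC.
  by apply: integral_ge0 => x _; rewrite lee_fin mulr_ge0// integ_ge0.
have := Fubini ih.
have E1 x : (\int[mu]_y h (x, y) = (f x * ct g x)%:E)%E.
  rewrite -[LHS]fineK; last exact: (integrable_fin_num measurableT (L1x x)).
  congr EFin; rewrite /ct -(integZl _ (L1_cos x Lg)); apply: eq_integ => y /=.
  by rewrite (mulrC y) mulrA mulrAC.
have E2 y : (\int[mu]_x h (x, y) = (ct f y * g y)%:E)%E.
  rewrite -[LHS]fineK; last exact: (integrable_fin_num measurableT (L1y y)).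
  congr EFin; rewrite /ct mulrC -(integZl _ (L1_cos y Lf)); apply: eq_integ => x /=.
  by rewrite mulrC.
under eq_integral do rewrite E1.
under [X in _ = X -> _]eq_integral do rewrite E2.
by rewrite /integ /Rintegral => ->.
Qed.

(** Nonnegativity lets the limit of an antiderivative at infinity give integrability together with
    the value; evenness reduces the line to a half-line. *)
Lemma integ_even_FTC f F (l : R) : (forall x, 0 <= f x) -> continuous f ->
  (forall x, f (- x) = f x) -> F x @[x --> +oo] --> l ->
  (forall x, derivable F x 1) -> (forall x, 0 < x -> derive1 F x = f x) ->
  L1 f /\ integ f = 2 * (l - F 0).
Proof.
move=> f0 cf ef Fl dF dFE.
have S : [set x : R | 0 <= x] = `[0, +oo[%classic.
  by apply/seteqP; split => x /=; rewrite in_itv/= andbT.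
have E : (\int[mu]_x (f x)%:E = (2 * (l - F 0))%:E)%E.
  rewrite ge0_symfun_integralT//; last by move=> x /=; rewrite ef.
  rewrite S (ge0_continuous_FTC2y _ _ Fl)//.
  - exact: continuous_subspaceT.
  - apply: cvg_at_right_filter; apply: differentiable_continuous.
    by apply/derivable1_diffP; exact: dF.
  - by move=> x; rewrite in_itv/= andbT => /dFE.
split; last by rewrite /integ /Rintegral E.
apply/integrableP; split; first by apply/measurable_EFinP; exact: cont_meas.
under eq_integral do rewrite /= ger0_norm//.
by rewrite E ltry.
Qed.

Lemma integ_cauchy :
  L1 (fun x : R => (1 + x ^+ 2)^-1) /\ integ (fun x : R => (1 + x ^+ 2)^-1) = pi.
Proof.
have [] := @integ_even_FTC (fun x : R => (1 + x ^+ 2)^-1) atan (pi / 2).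
- by move=> x; rewrite invr_ge0 addr_ge0// sqr_ge0.
- exact: continuous_oneDsqrV.
- by move=> x; rewrite sqrrN.
- exact: cvgy_atan.
- exact: derivable_atan.
- by move=> x _; rewrite derive1_atan.
by move=> ? ->; split => //; rewrite atan0 subr0; field.
Qed.

(** * The two-sided exponential and its cosine transform *)

Section exponential.
Variable s : R.
Hypothesis s0 : 0 < s.

Definition expabs (x : R) := expR (- s * `|x|).

Lemma expabs_continuous : continuous expabs.
Proof.
move=> x; apply: (@continuous_comp _ _ _ (fun x : R => - s * `|x|) expR).
  by apply: cvgM; [exact: cvg_cst|exact: norm_continuous].
exact: continuous_expR.
Qed.

Lemma cvg_expRMN : expR (- s * x) @[x --> +oo] --> (0 : R).
Proof.
have H := @cvgr_expR R.
have := @cvg_comp _ _ _ (fun x : R => s * x) (fun x => expR (- x)) _ _ _ _ H.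
have -> : (fun x : R => expR (- x)) \o (fun x => s * x) = (fun x => expR (- s * x)).
  by apply/funext => x /=; rewrite mulNr.
by apply; exact: gt0_cvgMry.
Qed.

Lemma ct_expabs (xi : R) :
  L1 expabs /\ ct expabs xi = 2 * s / (s ^+ 2 + xi ^+ 2).
Proof.
have d0 : s ^+ 2 + xi ^+ 2 != 0.
  by rewrite gt_eqF// ltr_wpDr ?sqr_ge0// exprn_gt0.
pose F1 (x : R) := - expR (- s * x) / s.
pose F2 (x : R) := expR (- s * x) * (xi * sin (x * xi) - s * cos (x * xi)) / (s ^+ 2 + xi ^+ 2).
have dF1 (x : R) : is_derive x 1 F1 (expR (- s * x)).
  apply: is_derive_eq; rewrite /GRing.scale /=; field.
  exact: lt0r_neq0.
have dF2 (x : R) : is_derive x 1 F2 (expR (- s * x) * cos (x * xi)).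
  apply: is_derive_eq; rewrite /GRing.scale /=; field.
  by [].
have F1l : F1 x @[x --> +oo] --> 0.
  rewrite -(mul0r s^-1) -oppr0; apply: cvgM; last exact: cvg_cst.
  by apply: cvgN; exact: cvg_expRMN.
have F2l : F2 x @[x --> +oo] --> 0.
  rewrite -(mul0r (s ^+ 2 + xi ^+ 2)^-1); apply: cvgM; last exact: cvg_cst.
  apply/cvgr0Pnorm_le => e e0.
  have M0 : 0 < `|xi| + s by rewrite ltr_wpDl.
  have := cvg_expRMN => /cvgr0Pnorm_le /(_ _ (divr_gt0 e0 M0)).
  apply: filterS => x; rewrite ler_pdivlMr// normrM => /(le_trans _); apply.
  rewrite ler_wpM2l// (le_trans (ler_normB _ _))// lerD// normrM ?(gtr0_norm s0).
    by rewrite ler_piMr// sin_max.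
  by rewrite ler_piMr ?(ltW s0)// cos_max.
have [L1e E1] : L1 expabs /\ integ expabs = 2 * (0 - F1 0).
  apply: integ_even_FTC => //.
  - by move=> x; exact: expR_ge0.
  - exact: expabs_continuous.
  - by move=> x; rewrite /expabs normrN.
  - by move=> x xp; rewrite derive1E (@derive_val _ _ _ _ _ _ _ (dF1 x)) /expabs gtr0_norm.
(* The integrand [expabs x * cos (x * xi)] may change sign, so [expabs x] is added to make it
   nonnegative, and its known integral is subtracted afterwards. *)
have [L2 E2] : L1 (fun x => expabs x + expabs x * cos (x * xi)) /\
    integ (fun x => expabs x + expabs x * cos (x * xi)) = 2 * (0 + 0 - (F1 0 + F2 0)).
  apply: (@integ_even_FTC _ (F1 \+ F2)) => //.
  - move=> x; have -> : expabs x + expabs x * cos (x * xi) = expabs x * (1 + cos (x * xi)) by ring.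
    by rewrite mulr_ge0 ?expR_ge0// -lerBlDl sub0r cos_geN1.
  - move=> x; apply: cvgD; first exact: expabs_continuous.
    by apply: cvgM; [exact: expabs_continuous|exact: continuous_cosM].
  - by move=> x; rewrite /expabs normrN (mulNr x) cosN.
  - exact: cvgD.
  - move=> x xp; rewrite derive1E deriveD// !derive_val /expabs gtr0_norm//.
split => //.
rewrite integD// in E2; last exact: L1_cos.
rewrite E1 in E2; rewrite /ct.
move: E2 => /(canRL (addKr _)) ->.
rewrite /F1 /F2 !mulr0 expR0 mul0r sin0 cos0; field.
by rewrite d0 lt0r_neq0.
Qed.

End exponential.

(** The substitution [x = n.+1%:R^-1 * u] turns the Poisson kernel into the fixed weight
    [2 / (1 + u ^+ 2)], of mass [2 * pi], against a dilate of [psi]; dominated convergence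
    concludes. *)
Lemma approx_identity psi (M : R) : continuous psi -> (forall x, `|psi x| <= M) ->
  integ (fun x => psi x * (2 * n.+1%:R^-1 / (n.+1%:R^-1 ^+ 2 + x ^+ 2))) @[n --> \oo]
    --> 2 * pi * psi 0.
Proof.
move=> cpsi bpsi.
have [LC EC] := integ_cauchy.
have E n : integ (fun x => psi x * (2 * n.+1%:R^-1 / (n.+1%:R^-1 ^+ 2 + x ^+ 2)))
    = integ (fun u => 2 * (1 + u ^+ 2)^-1 * psi (n.+1%:R^-1 * u)).
  have n0 : 0 < n.+1%:R^-1 :> R by rewrite invr_gt0.
  pose G (u : R) := 2 * (1 + u ^+ 2)^-1 * psi (n.+1%:R^-1 * u).
  have cG : measurable_fun setT (fun u : R => psi (n.+1%:R^-1 * u)).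
    apply: cont_meas => u.
    apply: (@continuous_comp _ _ _ (fun u : R => n.+1%:R^-1 * u) psi); last exact: cpsi.
    by apply: cvgM; [exact: cvg_cst|exact: cvg_id].
  have LG : L1 G by apply: (L1_bounded_mul (M := M)) => //; exact: L1Zl.
  have [_ ->] := L1_integ_affine_pos 0 (ltr0Sn R n) LG.
  rewrite -integZl; last first.
    by have [] := L1_integ_affine_pos 0 (ltr0Sn R n) LG.
  apply: eq_integ => x; rewrite /G addr0 (mulrA n.+1%:R^-1) mulVf ?mul1r ?pnatr_eq0//.
  have h1 : 1 + (n.+1%:R * x) ^+ 2 != 0 by rewrite gt_eqF// ltr_wpDr// sqr_ge0.
  rewrite mulrC; field.
  by rewrite nat1r h1 pnatr_eq0.
rewrite (_ : (fun n => _) = (fun n => integ (fun u => 2 * (1 + u ^+ 2)^-1 * psi (n.+1%:R^-1 * u)))); last first.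
  by apply/funext => n; exact: E.
have -> : 2 * pi * psi 0 = integ (fun u => 2 * (1 + u ^+ 2)^-1 * psi 0).
  under eq_integ do rewrite mulrC mulrA.
  by rewrite integZl// EC; ring.
have [||||_ C] := @integ_dom R (fun n u => 2 * (1 + u ^+ 2)^-1 * psi (n.+1%:R^-1 * u))
    (fun u => 2 * (1 + u ^+ 2)^-1 * psi 0) (fun u => 2 * M * (1 + u ^+ 2)^-1).
- move=> n; apply: measurable_funM; first exact: L1_meas (L1Zl 2 LC).
  apply: cont_meas => u.
  apply: (@continuous_comp _ _ _ (fun u : R => n.+1%:R^-1 * u) psi); last exact: cpsi.
  by apply: cvgM; [exact: cvg_cst|exact: cvg_id].
- exact: L1Zl.
- move=> n u; rewrite normrM mulrAC ler_pM//.
  by rewrite ger0_norm// mulr_ge0// invr_ge0 addr_ge0// sqr_ge0.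
- move=> u; apply: cvgM; first exact: cvg_cst.
  apply: cvg_cont; first exact: cpsi.
  rewrite -[X in _ --> X](mul0r u); apply: cvgM; last exact: cvg_cst.
  exact: cvg_harmonic.
exact: C.
Qed.

(** Abel summation: damping the integrand by [expabs n.+1%:R^-1] and moving the transform onto the
    damping factor by [ct_swap] produces the approximate identity. Domination by the absolute value
    of [ct psi] removes the damping. *)
Lemma ct_inversion0 psi (M : R) : continuous psi -> (forall x, `|psi x| <= M) ->
  L1 psi -> L1 (ct psi) -> integ (ct psi) = 2 * pi * psi 0.
Proof.
move=> cpsi bpsi Lpsi Lct.
have C1 := approx_identity cpsi bpsi.
have E n : integ (fun x => psi x * (2 * n.+1%:R^-1 / (n.+1%:R^-1 ^+ 2 + x ^+ 2))) =
   integ (fun xi => ct psi xi * expabs n.+1%:R^-1 xi).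
  have n0 : 0 < n.+1%:R^-1 :> R by rewrite invr_gt0.
  rewrite ct_swap//; last by have [] := ct_expabs n0 0.
  by apply: eq_integ => x; have [_ ->] := ct_expabs n0 x.
rewrite (eq_cvg _ _ E) in C1.
have [||||_ C2] := @integ_dom R (fun n xi => ct psi xi * expabs n.+1%:R^-1 xi) (ct psi) (fun xi => `|ct psi xi|).
- move=> n; apply: measurable_funM; first exact: L1_meas.
  by apply: cont_meas; exact: expabs_continuous.
- exact: L1_norm.
- move=> n xi; rewrite normrM ler_piMr// ger0_norm ?expR_ge0//.
  by rewrite expR_le1 mulNr oppr_le0 mulr_ge0.
- move=> xi; rewrite -[X in _ --> X]mulr1; apply: cvgM; first exact: cvg_cst.
  rewrite -[X in _ --> X]expR0; apply: cvg_cont; first exact: continuous_expR.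
  rewrite -(mul0r `|xi|) -oppr0; apply: cvgM; last exact: cvg_cst.
  by apply: cvgN; exact: cvg_harmonic.
by apply: cvg_unique C2 C1.
Qed.

(** Transfers inversion from the origin to [y]: symmetrizing the translates keeps the factor a pure
    cosine. *)
Lemma ct_shift psi (y xi : R) : L1 psi ->
  ct (fun x => (psi (x + y) + psi (x - y)) / 2) xi = ct psi xi * cos (xi * y).
Proof.
move=> Lpsi.
have [L1a _] := L1_integ_shift y Lpsi.
have [L1b _] := L1_integ_shift (- y) Lpsi.
have La := L1_integ_shift y (L1_cos xi L1b).
have Lb := L1_integ_shift (- y) (L1_cos xi L1a).
rewrite /ct.
have -> : integ (fun x => (psi (x + y) + psi (x - y)) / 2 * cos (x * xi)) =
   integ (fun x => 2^-1 * (psi (x + y) * cos (x * xi) + psi (x - y) * cos (x * xi))).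
  by apply: eq_integ => x; ring.
rewrite integZl; last by apply: L1D; exact: L1_cos.
rewrite integD; [|exact: L1_cos|exact: L1_cos].
rewrite La.2 Lb.2.
rewrite -integD; [|exact: Lb.1|exact: La.1].
rewrite -integZl; last by apply: L1D; [exact: Lb.1|exact: La.1].
rewrite mulrC -integZl; last exact: L1_cos.
apply: eq_integ => x; rewrite !addrK !subrK !mulrDl cosD mulNr cosN sinN cosD.
by rewrite (mulrC y xi); field.
Qed.

Definition fourier_nice psi := [/\ continuous psi, exists M, forall x, `|psi x| <= M,
  L1 psi & L1 (ct psi)].

(** Inversion at 0 of the symmetrized translate; a cosine transform retains only the even part of
    [psi], hence both [psi y] and [psi (- y)]. *)
Lemma ct_inversion psi (y : R) : fourier_nice psi ->
  integ (fun xi => ct psi xi * cos (xi * y)) = pi * (psi y + psi (- y)).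
Proof.
move=> [cpsi [M bpsi] Lpsi Lct].
have [L1a _] := L1_integ_shift y Lpsi.
have [L1b _] := L1_integ_shift (- y) Lpsi.
rewrite -(eq_integ (fun xi => ct_shift y xi Lpsi)) (@ct_inversion0 _ M).
- by rewrite add0r sub0r; field.
- move=> x; apply: cvgM; last exact: cvg_cst.
  apply: cvgD; apply: (@continuous_comp _ _ _ (fun x : R => _) psi); do ?exact: cpsi.
    by apply: cvgD; [exact: cvg_id|exact: cvg_cst].
  by apply: cvgD; [exact: cvg_id|exact: cvg_cst].
- move=> x; rewrite normrM (ger0_norm (_ : 0 <= 2^-1 :> R))//.
  rewrite ler_pdivrMr// (le_trans (ler_normD _ _))// mulr_natr mulr2n.
  by rewrite lerD.
- have := L1Zl 2^-1 (L1D L1a L1b); apply: eq_L1 => x; exact: mulrC.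
- apply: eq_L1 (L1_cos y Lct) => xi; by rewrite ct_shift.
Qed.

(** The fraction is, up to a constant, the transform of [expabs s]; [ct_swap] puts both transforms
    on [psi], inversion undoes them, and the evenness of [expabs s] merges [psi y] and
    [psi (- y)]. *)
Lemma ct_resolvent psi (s : R) : fourier_nice psi -> 0 < s ->
  integ (fun xi => ct psi xi * (s ^+ 2 + xi ^+ 2)^-1) =
  pi / s * integ (fun x => expabs s x * psi x).
Proof.
move=> npsi s0; have [cpsi [M bpsi] Lpsi Lct] := npsi.
have [Le _] := ct_expabs s0 0.
have Lep : L1 (fun x => expabs s x * psi x).
  by apply: (L1_bounded_mul (M := M)) => //; exact: cont_meas.
have := ct_swap Lct Le.
under [X in _ = X -> _]eq_integ => x do have [_ ->] := ct_expabs s0 x.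
under [X in X = _ -> _]eq_integ => y do rewrite [ct (ct psi) y]ct_inversion// mulrC mulrCA mulrDr.
have [Lr Er] := L1_integ_opp Lep.
have E2 : (fun x => expabs s (- x) * psi (- x)) = (fun x => expabs s x * psi (- x)).
  by apply/funext => x; rewrite /expabs normrN.
rewrite E2 in Lr Er.
rewrite integZl; last exact: L1D.
rewrite integD// -Er => E.
have E3 : integ (fun x => ct psi x * (2 * s / (s ^+ 2 + x ^+ 2))) =
    2 * s * integ (fun xi => ct psi xi * (s ^+ 2 + xi ^+ 2)^-1).
  rewrite -integZl; first by apply: eq_integ => x; ring.
  apply: (L1_bounded_mul (M := (s ^+ 2)^-1)) => //.
    apply: cont_meas => x; apply: cvgV.
      by rewrite gt_eqF// ltr_wpDr ?sqr_ge0// exprn_gt0.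
    by apply: cvgD; [exact: cvg_cst|exact: exprn_continuous].
  move=> x; rewrite ger0_norm ?invr_ge0 ?addr_ge0 ?sqr_ge0//.
  by rewrite lef_pV2 ?posrE ?exprn_gt0// ?lerDl ?sqr_ge0// ltr_wpDr ?sqr_ge0// exprn_gt0.
rewrite E3 in E.
apply: (@mulfI _ (2 * s)); first by rewrite mulf_neq0// lt0r_neq0.
by rewrite -E; field; rewrite lt0r_neq0.
Qed.

End cosine_transform.

(** * Complete monotonicity from iterated differences *)

Section difference_monotone.
Context {R : realType}.
Implicit Types (f g : R -> R) (hs : seq R).

Lemma cvgn_ge0 (u : nat -> R) (l : R) : u n @[n --> \oo] --> l ->
  (forall n, 0 <= u n) -> 0 <= l.
Proof.
move=> ul u0; rewrite -(cvg_lim (@Rhausdorff R) ul).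
by apply: limr_ge; [apply/cvg_ex; exists l|exact: nearW].
Qed.

Definition fdiff (h : R) f (x : R) := f x - f (x + h).

(** Bernstein's difference form of complete monotonicity, which presupposes no regularity. The sign
    is built into [fdiff], and the steps may differ. *)
Definition diff_monotone f := forall hs, all (fun h => 0 < h) hs ->
  forall x, 0 < x -> 0 <= foldr fdiff f hs x.

Lemma diff_monotone_ge0 f x : diff_monotone f -> 0 < x -> 0 <= f x.
Proof. by move=> /(_ [::] isT) H /H. Qed.

Lemma diff_monotone_fdiff f h : diff_monotone f -> 0 < h ->
  diff_monotone (fdiff h f).
Proof.
move=> df h0 hs hs0 x x0; have := df (rcons hs h).
by rewrite all_rcons h0 foldr_rcons => /(_ hs0 x x0).
Qed.

Lemma diff_monotone_le f x h : diff_monotone f -> 0 < x -> 0 <= h -> f (x + h) <= f x.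
Proof.
move=> df x0; rewrite le_eqVlt => /predU1P[<-|h0]; first by rewrite addr0.
by have := diff_monotone_ge0 (diff_monotone_fdiff df h0) x0; rewrite subr_ge0.
Qed.

Lemma foldr_fdiffZ (c : R) f hs x :
  foldr fdiff (fun x => c * f x) hs x = c * foldr fdiff f hs x.
Proof. by elim: hs x => //= h hs IH x; rewrite /fdiff !IH mulrBr. Qed.

Lemma diff_monotoneZ (c : R) f : 0 <= c -> diff_monotone f ->
  diff_monotone (fun x => c * f x).
Proof.
by move=> c0 df hs hs0 x x0; rewrite foldr_fdiffZ mulr_ge0// df.
Qed.

Lemma diff_monotone_lim (f_ : nat -> R -> R) g : (forall n, diff_monotone (f_ n)) ->
  (forall x, 0 < x -> f_ n x @[n --> \oo] --> g x) -> diff_monotone g.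
Proof.
move=> df fg hs hs0 x x0.
suff H : foldr fdiff (f_ n) hs x @[n --> \oo] --> foldr fdiff g hs x.
  by apply: (cvgn_ge0 H) => n; exact: df.
elim: hs hs0 x x0 => [_ x x0|h hs IH /= /andP[h0 hs0] x x0]; first exact: fg.
by apply: cvgB; apply: IH => //; rewrite addr_gt0.
Qed.

(** A difference of step [n%:R * k] telescopes into [n] differences of step [k], which decrease to
    the right because [fdiff k f] is itself decreasing. Comparison with the leftmost gives this
    bound, comparison with a point further right the reverse one below. *)
Lemma fdiff_natmul_le f (x k : R) n : diff_monotone f -> 0 < x -> 0 < k ->
  fdiff (n%:R * k) f x <= n%:R * fdiff k f x.
Proof.
move=> df x0 k0; elim: n => [|n IH]; first by rewrite !mul0r /fdiff addr0 subrr.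
have -> : fdiff (n.+1%:R * k) f x = fdiff (n%:R * k) f x + fdiff k f (x + n%:R * k).
  by rewrite /fdiff addrA subrK -addrA -natr1 mulrDl mul1r.
rewrite -natr1 mulrDl mul1r lerD//.
by apply: diff_monotone_le; [exact: diff_monotone_fdiff|by []|rewrite mulr_ge0// ltW].
Qed.

Lemma fdiff_natmul_ge f (x k : R) n : diff_monotone f -> 0 < x -> 0 < k ->
  n%:R * fdiff k f (x + n%:R * k) <= fdiff (n%:R * k) f x.
Proof.
move=> df x0 k0; elim: n => [|n IH]; first by rewrite !mul0r /fdiff addr0 subrr.
have -> : fdiff (n.+1%:R * k) f x = fdiff (n%:R * k) f x + fdiff k f (x + n%:R * k).
  by rewrite /fdiff addrA subrK -addrA -natr1 mulrDl mul1r.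
have H : fdiff k f (x + n.+1%:R * k) <= fdiff k f (x + n%:R * k).
  rewrite -natr1 mulrDl mul1r addrA.
  apply: diff_monotone_le; [exact: diff_monotone_fdiff| |exact: ltW].
  by rewrite ltr_wpDr// mulr_ge0// ltW.
rewrite -[X in X * _]natr1 mulrDl mul1r lerD// (le_trans _ IH)//.
by rewrite ler_wpM2l.
Qed.

(** A large step is controlled by [f x] alone. For a small one, about [x / (2 * k)] steps fit
    between [x / 2] and [x]; the slopes there are at least the slope at [x], and together they
    descend by at most [f (x / 2)]. *)
Lemma slope_bound f (x k : R) : diff_monotone f -> 0 < x -> 0 < k ->
  fdiff k f x / k <= 4 * f (x / 2) / x.
Proof.
move=> df x0 k0.
have x20 : 0 < x / 2 by rewrite divr_gt0.
have f20 : 0 <= f (x / 2) by exact: diff_monotone_ge0.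
have fx : f x <= f (x / 2).
  by rewrite {1}(splitr x); apply: diff_monotone_le => //; exact: ltW.
rewrite ler_pdivrMr//.
have [kx|xk] := leP (x / 2) k.
  have h : 2 * f (x / 2) <= 4 * f (x / 2) / x * k.
    have -> : 2 * f (x / 2) = 4 * f (x / 2) / x * (x / 2) by field; rewrite lt0r_neq0.
    by rewrite ler_wpM2l// divr_ge0 ?mulr_ge0// ltW.
  apply: le_trans h; rewrite /fdiff.
  have := diff_monotone_ge0 df (addr_gt0 x0 k0); lra.
pose n := Num.truncn (x / 2 / k).
have q0 : 0 <= x / 2 / k by rewrite divr_ge0// ltW.
have /andP[nq qn] := truncn_itv q0; rewrite -/n in nq qn.
have n0 : (0 < n)%N by rewrite /n truncn_ge_nat// ler_pdivlMr// mul1r ltW.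
clearbody n.
have n1 : 1 <= n%:R :> R by rewrite ler1n.
have nk : n%:R * k <= x / 2 by rewrite -ler_pdivlMr.
(* Since [n] is at least 1, truncation loses at most half of [x / 2], whence the constant 4 in the
   statement. *)
have nk2 : x < 4 * (n%:R * k).
  move: qn; rewrite ltr_pdivrMr// -(natr1 n) mulrDl mul1r => qn.
  have : k <= n%:R * k by rewrite ler_peMl// ltW.
  lra.
have nk0 : 0 < n%:R * k by rewrite mulr_gt0// ltr0n.
have xnk : 0 < x - n%:R * k by lra.
have := fdiff_natmul_ge n df xnk k0; rewrite subrK => H.
have H2 : fdiff (n%:R * k) f (x - n%:R * k) <= f (x / 2).
  rewrite /fdiff subrK.
  have h1 : f (x - n%:R * k) <= f (x / 2).
    have -> : x - n%:R * k = x / 2 + (x / 2 - n%:R * k) by lra.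
    by apply: diff_monotone_le => //; lra.
  have := diff_monotone_ge0 df x0; lra.
have n0R : 0 < n%:R :> R by rewrite ltr0n.
rewrite -(ler_pM2l n0R) (le_trans H)// (le_trans H2)//.
have -> : n%:R * (4 * f (x / 2) / x * k) = f (x / 2) * (4 * (n%:R * k) / x) by field; rewrite lt0r_neq0.
by rewrite ler_peMr// ler_pdivlMr// mul1r ltW.
Qed.

(** For a convex function the quotients increase as the step shrinks, so their supremum is minus the
    right derivative. *)
Definition slopes f (x : R) : set R := [set fdiff k f x / k | k in [set k | 0 < k]].

Lemma has_sup_slopes f x : diff_monotone f -> 0 < x -> has_sup (slopes f x).
Proof.
move=> df x0; split; first by exists (fdiff 1 f x / 1); exists 1 => //=; exact: ltr01.
by exists (4 * f (x / 2) / x) => _ [k /= k0 <-]; exact: slope_bound.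
Qed.

Lemma slope_le_sup f (x k : R) : diff_monotone f -> 0 < x -> 0 < k ->
  fdiff k f x / k <= sup (slopes f x).
Proof.
move=> df x0 k0; apply: (sup_upper_bound (has_sup_slopes df x0)).
by exists k.
Qed.

Lemma sup_slopes_ge0 f x : diff_monotone f -> 0 < x -> 0 <= sup (slopes f x).
Proof.
move=> df x0; apply: le_trans (slope_le_sup df x0 ltr01).
by rewrite divr1; apply: (diff_monotone_ge0 _ x0); exact: diff_monotone_fdiff.
Qed.

(** Choose a step [h] with nearly maximal quotient and cover it by [N] steps [k], overshooting by at
    most [k]; the quotient at [k] then loses at most the factor [h / (h + k)]. *)
Lemma slope_near_sup f (x e : R) : diff_monotone f -> 0 < x -> 0 < e ->
  exists2 d : R, 0 < d & forall k, 0 < k -> k < d ->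
    sup (slopes f x) - e <= fdiff k f x / k.
Proof.
move=> df x0 e0.
have e20 : 0 < e / 2 by rewrite divr_gt0.
have [_ [h /= h0 <-] He] := sup_adherent e20 (has_sup_slopes df x0).
set G := sup (slopes f x) in He *.
have G0 : 0 <= G by exact: sup_slopes_ge0.
(* Makes [k * G <= e / 2 * h], the cost of the overshoot; [G + 1] avoids a division by 0. *)
exists (e / 2 * h / (G + 1)) => [|k k0 kd].
  by rewrite divr_gt0 ?mulr_gt0// ltr_wpDl.
pose N := (Num.truncn (h / k)).+1.
have q0 : 0 <= h / k by rewrite divr_ge0// ltW.
have /andP[nq qn] := truncn_itv q0; rewrite -/N in qn.
have hN : h <= N%:R * k by rewrite -ler_pdivrMr// ltW.
have Nh : N%:R * k <= h + k.
  by rewrite /N -natr1 mulrDl mul1r lerD2r -ler_pdivlMr.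
have dk0 : 0 <= fdiff k f x.
  by apply: (diff_monotone_ge0 _ x0); exact: diff_monotone_fdiff.
have H1 : fdiff h f x <= N%:R * fdiff k f x.
  apply: le_trans (fdiff_natmul_le N df x0 k0).
  rewrite /fdiff lerB// -(subrK h (N%:R * k)) addrCA addrC -addrA (addrC h) addrA.
  have -> : x + (N%:R * k - h) + h = (x + h) + (N%:R * k - h) by ring.
  by apply: diff_monotone_le => //; [exact: addr_gt0|rewrite subr_ge0].
have H2 : fdiff h f x * k <= (h + k) * fdiff k f x.
  apply: (@le_trans _ _ (N%:R * fdiff k f x * k)); first by rewrite ler_wpM2r// ltW.
  by rewrite mulrAC ler_wpM2r.
have sG : fdiff k f x / k <= G by exact: slope_le_sup.
set s := fdiff k f x / k in sG *.
have sk : fdiff k f x = s * k by rewrite /s divfK// lt0r_neq0.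
rewrite sk mulrA ler_pM2r// in H2.
have H3 : G - e / 2 < (h + k) * s / h.
  by rewrite (lt_le_trans He)// ler_pM2r ?invr_gt0.
rewrite ltr_pdivlMr// in H3.
have H4 : k * s <= k * G by rewrite ler_wpM2l// ltW.
have H5 : k * G <= e / 2 * h.
  move: kd; rewrite ltr_pdivlMr ?ltr_wpDl// => /ltW; apply: le_trans.
  by rewrite ler_wpM2l ?ltW// ltrDl.
rewrite -(ler_pM2r h0); lra.
Qed.

Lemma cvg_slope f x : diff_monotone f -> 0 < x ->
  n.+1%:R * fdiff n.+1%:R^-1 f x @[n --> \oo] --> sup (slopes f x).
Proof.
move=> df x0; apply/cvgrPdist_le => e e0.
have [d d0 H] := slope_near_sup df x0 e0.
near=> n.
have n0 : 0 < n.+1%:R^-1 :> R by rewrite invr_gt0.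
have -> : n.+1%:R * fdiff n.+1%:R^-1 f x = fdiff n.+1%:R^-1 f x / n.+1%:R^-1.
  by rewrite invrK mulrC.
have h1 := slope_le_sup df x0 n0.
have nd : n.+1%:R^-1 < d by near: n; exact: near_infty_natSinv_lt (PosNum d0).
have h2 := H _ n0 nd.
by rewrite ger0_norm ?subr_ge0//; lra.
Unshelve. all: by end_near. Qed.

(** A limit of [n.+1%:R * fdiff n.+1%:R^-1 f], so minus the derivative is again in the class; this
    drives the induction on the order of differentiation. *)
Lemma diff_monotone_slope f : diff_monotone f -> diff_monotone (fun x => sup (slopes f x)).
Proof.
move=> df; apply: (@diff_monotone_lim (fun n x => n.+1%:R * fdiff n.+1%:R^-1 f x)).
  by move=> n; apply: diff_monotoneZ => //; apply: diff_monotone_fdiff => //; rewrite invr_gt0.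
by move=> x x0; exact: cvg_slope.
Qed.

(** [slope_bound] at the points [x - k], which stay above [x / 2], gives a Lipschitz bound with
    constant [C]. It is applied to the suprema of slopes of a function, to handle its left
    derivative. *)
Lemma diff_monotone_left_cont g (x e : R) : diff_monotone g -> 0 < x -> 0 < e ->
  exists2 d : R, 0 < d <= x / 2 & forall k, 0 < k -> k < d -> g (x - k) <= g x + e.
Proof.
move=> dg x0 e0.
pose C := 4 * g (x / 4) / (x / 2).
have x4 : 0 < x / 4 by rewrite divr_gt0.
have x2 : 0 < x / 2 by rewrite divr_gt0.
have C0 : 0 <= C by rewrite /C divr_ge0 ?(ltW x2)// mulr_ge0// diff_monotone_ge0.
exists (Num.min (x / 2) (e / (C + 1))) => [|k k0].
  by rewrite lt_min x2 divr_gt0 ?ltr_wpDl//= ge_min lexx.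
rewrite lt_min => /andP[kx]; rewrite ltr_pdivlMr ?ltr_wpDl// => ke.
have xk : 0 < x - k by lra.
have := slope_bound dg xk k0; rewrite ler_pdivrMr// /fdiff subrK => H.
have gle : g ((x - k) / 2) <= g (x / 4).
  have -> : (x - k) / 2 = x / 4 + (x / 2 - k) / 2 by field.
  by apply: diff_monotone_le => //; rewrite divr_ge0//; lra.
have H2 : 4 * g ((x - k) / 2) / (x - k) <= C.
  rewrite /C ler_pM//.
  - by rewrite mulr_ge0// diff_monotone_ge0// divr_gt0.
  - by rewrite invr_ge0 ltW.
  - by rewrite ler_wpM2l.
  - by rewrite lef_pV2 ?posrE//; lra.
have : 4 * g ((x - k) / 2) / (x - k) * k <= C * k by rewrite ler_wpM2r// ltW.
clear H2 gle; clearbody C; move: (4 * _ / _ * k) H => A; lra.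
Qed.

Lemma diff_monotone_derive f (x : R) : diff_monotone f -> 0 < x ->
  is_derive x 1 f (- sup (slopes f x)).
Proof.
move=> df x0; set G := fun x => sup (slopes f x); rewrite -/(G x).
have dG : diff_monotone G by exact: diff_monotone_slope.
suff H : h^-1 *: (f (h *: 1 + x) - f x) @[h --> 0^'] --> - G x.
  by apply: DeriveDef; [apply/cvg_ex; exists (- G x)|exact: cvg_lim].
apply/cvgrPdist_le => e e0.
have [d1 d10 H1] := slope_near_sup df x0 e0.
have [d2 /andP[d20 d2x] H2] := diff_monotone_left_cont dG x0 e0.
exists (Num.min d1 d2); first by rewrite /= lt_min d10 d20.
move=> h /=; rewrite sub0r normrN lt_min => /andP[hd1 hd2] h0.
rewrite /GRing.scale /= mulr1.
have [hp|hn] := ltP 0 h.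
  rewrite gtr0_norm// in hd1 hd2.
  have -> : h^-1 * (f (h + x) - f x) = - (fdiff h f x / h).
    by rewrite /fdiff (addrC x); ring.
  have h1 := slope_le_sup df x0 hp; have h2 := H1 _ hp hd1.
  rewrite -/(G x) in h1 h2.
  rewrite -opprB opprK addrC normrN ger0_norm; lra.
have {}hn : h < 0 by rewrite lt_neqAle h0.
rewrite ltr0_norm// in hd1 hd2.
(* For a step to the left the quotient is a slope at [x - k]: it is at least the slope of the same
   step at [x], and at most the supremum at [x - k], which left continuity compares with the one at
   [x]. *)
have [k [hk k0]] : exists k, h = - k /\ 0 < k by exists (- h); rewrite opprK oppr_gt0.
rewrite hk opprK in hd1 hd2; rewrite {}hk.
have -> : (- k)^-1 * (f (- k + x) - f x) = - (fdiff k f (x - k) / k).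
  by rewrite /fdiff subrK (addrC x) invrN; ring.
have xk : 0 < x - k by lra.
have h1 := slope_le_sup df xk k0; rewrite -/(G (x - k)) in h1.
have h2 := H2 _ k0 hd2.
have h3 := H1 _ k0 hd1; rewrite -/(G x) in h3.
have h4 : fdiff k f x / k <= fdiff k f (x - k) / k.
  rewrite ler_pM2r ?invr_gt0//.
  have {1}-> : x = (x - k) + k by rewrite subrK.
  by apply: diff_monotone_le => //; [exact: diff_monotone_fdiff|exact: ltW].
rewrite -opprB opprK addrC normrN ler_norml; lra.
Qed.

Lemma diff_monotone_completely_monotone f : diff_monotone f -> completely_monotone f.
Proof.
move=> df.
have H n : exists2 g, diff_monotone g & forall x, 0 < x -> derive1n n f x = (-1) ^+ n * g x.
  elim: n => [|n [g dg IH]]; first by exists f => // x _; rewrite expr0 mul1r.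
  exists (fun x => sup (slopes g x)); first exact: diff_monotone_slope.
  move=> x x0; rewrite derive1nS derive1E.
  rewrite (@near_eq_derive _ _ _ _ (fun x => (-1) ^+ n * g x)); last first.
    near=> y; apply: IH; near: y; exact: lt_nbhsr.
  have gx := diff_monotone_derive dg x0.
  rewrite deriveZ//= (@derive_val _ _ _ _ _ _ _ gx) /GRing.scale /= exprS.
  by ring.
split=> [n x|n x x0].
  rewrite /= in_itv/= andbT => x0; have [g dg E] := H n.
  have gx := diff_monotone_derive dg x0.
  apply: (@near_eq_derivable _ _ _ (fun x => (-1) ^+ n * g x)).
    near=> y; apply: esym; apply: E; near: y; exact: lt_nbhsr.
  exact: derivableZ.
have [g dg ->] := H n; last by [].
by rewrite mulrA -exprMn mulrNN mulr1 expr1n mul1r diff_monotone_ge0.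
Unshelve. all: by end_near. Qed.

End difference_monotone.

(** * Rational Stieltjes functions *)

Section stieltjes.
Context {R : realType}.
Implicit Types (f g : R -> R).

(** The pole is [- b] and the zero [- a]; the value at 0 is 1. *)
Definition gfac (b a x : R) : R := (1 + x / a) / (1 + x / b).

(* A rational Stieltjes function whose poles lie in ]-beta, 0[; since 0^-1 = 0,
   the equation is only required where the denominators cannot vanish. *)
Definition stieltjes (beta : R) f :=
  (exists c (s : seq (R * R)), [/\ 0 <= c,
    all (fun p => [&& 0 <= p.1, 0 < p.2 & p.2 < beta]) s &
    forall x, 0 <= x \/ x <= - beta ->
      f x = c + \sum_(p <- s) p.1 / (x + p.2)]) /\
  forall x, x <= - beta -> 0 <= f x.

Lemma stieltjes1 : stieltjes 0 (fun=> 1).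
Proof.
split=> //; exists 1, [::]; split=> // x _.
by rewrite big_nil addr0.
Qed.

Lemma stieltjesW (beta beta' : R) f : beta <= beta' -> stieltjes beta f ->
  stieltjes beta' f.
Proof.
move=> bb [[c [s [c0 ps E]]] pf]; split.
  exists c, s; split=> //.
    apply: sub_all ps => p /and3P[-> ->/= pb]; exact: lt_le_trans bb.
  by move=> x [x0|xb]; apply: E; [left|right; rewrite (le_trans xb)// lerN2].
by move=> x xb; apply: pf; rewrite (le_trans xb)// lerN2.
Qed.

(** Partial fractions. The new pole [- b] gets a positive multiple of [f (- b)], nonnegative by the
    sign condition on [f]; each old coefficient is multiplied by a positive multiple of
    [(a - p.2) / (b - p.2)], where [p.2 < b < a]. Left of [- a] neither [x + a] nor [x + b] is
    positive, so the sign condition survives. *)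
Lemma stieltjes_mul (beta a b : R) f : stieltjes beta f -> 0 < b ->
  beta <= b -> b < a -> stieltjes a (fun x => f x * gfac b a x).
Proof.
move=> [[c [s [c0 ps E]]] pf] b0 bb ba.
have a0 : 0 < a by exact: lt_trans ba.
have gE x : x + b != 0 -> gfac b a x = b / a * (1 + (a - b) / (x + b)).
  move=> xb; rewrite /gfac; field.
  by rewrite xb !gt_eqF//= addrC.
have fb : 0 <= f (- b) by apply: pf; rewrite lerN2.
have fbE : f (- b) = c + \sum_(p <- s) p.1 / (- b + p.2).
  by apply: E; right; rewrite lerN2.
have ba0 : 0 <= b / a by rewrite divr_ge0 ?ltW.
split; last first.
  move=> x xa; apply: mulr_ge0; first by apply: pf; rewrite (le_trans xa)// lerN2 (le_trans bb)// ltW.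
  have xb : x < - b by rewrite (le_lt_trans xa)// ltrN2.
  have xb0 : x + b < 0 by rewrite -ltrBrDr sub0r.
  rewrite gE ?lt_eqF// mulr_ge0//.
  have -> : 1 + (a - b) / (x + b) = (x + a) / (x + b) by field; rewrite lt_eqF.
  by rewrite mulr_le0// ?invr_le0 ?(ltW xb0)// -lerBrDr sub0r.
pose s1 := [seq (b / a * (p.1 * ((a - p.2) / (b - p.2))), p.2) | p <- s].
exists (b / a * c), ((b / a * ((a - b) * f (- b)), b) :: s1); split.
- by rewrite mulr_ge0.
- have s1P : all (fun p => [&& 0 <= p.1, 0 < p.2 & p.2 < a]) s1.
    rewrite /s1 all_map; apply: sub_all ps => p /and3P[p1 p2 pb] /=.
    have pb' : p.2 < b by exact: lt_le_trans bb.
    have pa : p.2 < a by exact: lt_trans ba.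
    rewrite p2 pa !andbT; apply: mulr_ge0 => //; apply: mulr_ge0 => //.
    by rewrite divr_ge0// subr_ge0 ltW.
  apply/andP; split; last exact: s1P.
  rewrite /= b0 ba !andbT; apply: mulr_ge0 => //; apply: mulr_ge0 => //.
  by rewrite subr_ge0 ltW.
- move=> x xD.
  have xb : x + b != 0.
    by case: xD => xD; [rewrite gt_eqF// ltr_wpDl|rewrite lt_eqF// -ltrBrDr sub0r (le_lt_trans xD)// ltrN2].
  rewrite (gE _ xb) E; last first.
    by case: xD => xD; [left|right; rewrite (le_trans xD)// lerN2 (le_trans bb)// ltW].
  rewrite big_cons /= /s1 big_map /= fbE.
  have {}ps : all (fun p => (x + p.2 != 0) && (b - p.2 != 0)) s.
    apply: sub_all ps => p /and3P[p1 p2 pb].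
    have pb' : p.2 < b by exact: lt_le_trans bb.
    have -> : b - p.2 != 0 by rewrite gt_eqF// subr_gt0.
    rewrite andbT.
    case: xD => xD; first by rewrite gt_eqF// ltr_wpDl.
    rewrite lt_eqF// -ltrBrDr sub0r (le_lt_trans xD)// ltrN2.
    exact: lt_trans ba.
  suff H : (\sum_(p <- s) p.1 / (x + p.2)) * (1 + (a - b) / (x + b)) =
      (a - b) * (\sum_(p <- s) p.1 / (- b + p.2)) / (x + b) +
      \sum_(p <- s) p.1 * ((a - p.2) / (b - p.2)) / (x + p.2).
    have -> : \sum_(p <- s) b / a * (p.1 * ((a - p.2) / (b - p.2))) / (x + p.2) =
       b / a * \sum_(p <- s) p.1 * ((a - p.2) / (b - p.2)) / (x + p.2).
      by rewrite mulr_sumr; apply: eq_bigr => p _; rewrite !mulrA.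
    transitivity (b / a * (c * (1 + (a - b) / (x + b)) + (\sum_(p <- s) p.1 / (x + p.2)) * (1 + (a - b) / (x + b)))).
      by field; rewrite xb gt_eqF.
    rewrite H; field; by rewrite xb gt_eqF.
  elim: s ps {fbE E s1} => [_|p s IH /= /andP[/andP[p1 p2] ps]].
    by rewrite !big_nil; ring.
  rewrite !big_cons mulrDl IH// mulrDr mulrDl.
  have -> : - b + p.2 = - (b - p.2) by ring.
  rewrite invrN; field.
  by rewrite p1 p2 xb.
Qed.

(** * Square roots of elementary factors as limits of products over a grid *)

Section grid.
Variables (p q : R).
Hypotheses (q0 : 0 < q) (qp : q < p).

Definition step n : R := (p - q) / (2 * n%:R).

Definition node n j : R := q + j%:R * step n.

Lemma step_gt0 n : 0 < step n.+1.
Proof. by rewrite divr_gt0 ?subr_gt0// mulr_gt0. Qed.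

Lemma node_gt0 n j : 0 < node n.+1 j.
Proof. by rewrite ltr_wpDr// mulr_ge0// ltW// step_gt0. Qed.

Lemma node_lt n j : node n.+1 j < node n.+1 j.+1.
Proof. by rewrite ltrD2l ltr_pM2r ?step_gt0// ltr_nat. Qed.

Definition grid_prod n (x : R) : R :=
  \prod_(i < n) gfac (node n i.*2) (node n i.*2.+1) x.

Lemma stieltjes_grid (beta : R) f n : stieltjes beta f -> beta <= q ->
  stieltjes p (fun x => f x * grid_prod n.+1 x).
Proof.
move=> sf bq.
have H k : stieltjes (node n.+1 k.*2) (fun x => f x * \prod_(i < k) gfac (node n.+1 i.*2) (node n.+1 i.*2.+1) x).
  elim: k => [|k IH].
    rewrite /node mul0r addr0; rewrite [X in stieltjes _ X](_ : _ = f); last first.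
      by apply/funext => x; rewrite big_ord0 mulr1.
    exact: stieltjesW sf.
  rewrite [X in stieltjes _ X](_ : _ = (fun x => f x * \prod_(i < k) gfac (node n.+1 i.*2) (node n.+1 i.*2.+1) x * gfac (node n.+1 k.*2) (node n.+1 k.*2.+1) x)); last first.
    by apply/funext => x; rewrite big_ord_recr /= mulrA.
  rewrite doubleS; apply: stieltjesW (ltW (node_lt _ _)) _.
  by apply: stieltjes_mul IH _ _ _; [exact: node_gt0|exact: lexx|exact: node_lt].
have := H n.+1; rewrite /node /step -muln2 natrM.
by have -> : q + n.+1%:R * 2 * ((p - q) / (2 * n.+1%:R)) = p by field; rewrite nat1r pnatr_eq0.
Qed.

Lemma gfac_bounds (b a x : R) : 0 < b -> b <= a -> 0 <= x -> 0 < gfac b a x <= 1.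
Proof.
move=> b0 ba x0; have a0 : 0 < a by exact: lt_le_trans ba.
have h1 : 0 < 1 + x / a by rewrite ltr_wpDr// divr_ge0// ltW.
have h2 : 0 < 1 + x / b by rewrite ltr_wpDr// divr_ge0// ltW.
rewrite /gfac divr_gt0//= ler_pdivrMr// mul1r lerD2l ler_wpM2l//.
by rewrite lef_pV2.
Qed.

Lemma grid_prod_bounds n (x : R) : 0 <= x -> 0 < grid_prod n.+1 x <= 1.
Proof.
move=> x0; rewrite /grid_prod.
have H (i : nat) : 0 < gfac (node n.+1 i.*2) (node n.+1 i.*2.+1) x <= 1.
  by apply: gfac_bounds => //; [exact: node_gt0|exact: ltW (node_lt _ _)].
rewrite prodr_gt0 => [/=|i _]; last by have /andP[] := H i.
by apply: prodr_ile1 => i _; have /andP[/ltW -> ->] := H i.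
Qed.

(** On a cell of width [h] starting at [y], the factor is [1 - h * x / ((y + h) * (y + x))], which
    increases with [y]. *)
Lemma gfac_node_le n i (x : R) : 0 <= x ->
  gfac (node n.+1 i) (node n.+1 i.+1) x <= gfac (node n.+1 i.+1) (node n.+1 i.+2) x.
Proof.
move=> x0.
have [h0 y0] := (step_gt0 n, node_gt0 n i).
have -> : node n.+1 i.+2 = node n.+1 i + 2 * step n.+1 by rewrite /node -2!natr1; ring.
have -> : node n.+1 i.+1 = node n.+1 i + step n.+1 by rewrite /node -natr1; ring.
move: (node n.+1 i) (step n.+1) h0 y0 => y h h0 y0.
have g1 : gfac y (y + h) x = 1 - h * x / ((y + h) * (y + x)).
  by rewrite /gfac; field; apply/and3P; split; rewrite gt_eqF// ltr_wpDr// ltW.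
have g2 : gfac (y + h) (y + 2 * h) x = 1 - h * x / ((y + 2 * h) * (y + h + x)).
  by rewrite /gfac; field; rewrite !gt_eqF//; lra.
rewrite g1 g2 lerB// ler_wpM2l ?mulr_ge0 ?(ltW h0)//.
have k1 : 0 < (y + h) * (y + x) by rewrite mulr_gt0//; lra.
have k2 : 0 < (y + 2 * h) * (y + h + x) by rewrite mulr_gt0//; lra.
by rewrite lef_pV2 ?posrE//; nra.
Qed.

(* The product over all cells telescopes to [gfac q p]; since the factors
   increase from one cell to the next, the cells kept by [grid_prod] and those it
   skips have almost the same product. *)
Lemma grid_prod_sqr n (x : R) : 0 <= x ->
  gfac (node n.+1 0) (node n.+1 1) x * gfac q p x <= grid_prod n.+1 x ^+ 2 <= gfac q p x.
Proof.
move=> x0.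
pose r i := gfac (node n.+1 i) (node n.+1 i.+1) x.
have r01 i : 0 < r i <= 1 by apply: gfac_bounds => //; [exact: node_gt0|exact: ltW (node_lt _ _)].
have r0 i : 0 <= r i by have /andP[/ltW] := r01 i.
pose Q := \prod_(i < n.+1) r i.*2.+1.
have tele k : \prod_(i < k) (r i.*2 * r i.*2.+1) = gfac q (node n.+1 k.*2) x.
  have nz j : 1 + x / node n.+1 j != 0.
    by rewrite gt_eqF// ltr_wpDr// divr_ge0// ltW// node_gt0.
  elim: k => [|k IH].
    by rewrite big_ord0 /gfac /node mul0r addr0 divff//; have := nz 0%N; rewrite /node mul0r addr0.
  rewrite big_ord_recr /= IH doubleS /r.
  have -> : gfac q = gfac (node n.+1 0) by rewrite /node mul0r addr0.
  rewrite /gfac; have := nz k.*2; have := nz k.*2.+1; have := nz 0%N.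
  move: (1 + x / node _ 0) (1 + x / node _ k.*2) (1 + x / node _ k.*2.+1).
  move: (1 + x / node _ k.*2.+2) => D A B C A0 C0 B0.
  by field; rewrite A0 B0 C0.
have PQ : grid_prod n.+1 x * Q = gfac q p x.
  rewrite -big_split /= tele /node /step -muln2 natrM.
  by have -> : q + n.+1%:R * 2 * ((p - q) / (2 * n.+1%:R)) = p by field; rewrite nat1r pnatr_eq0.
have P0 : 0 <= grid_prod n.+1 x by have /andP[/ltW] := grid_prod_bounds n x0.
have PleQ : grid_prod n.+1 x <= Q.
  by apply: ler_prod => i _; rewrite r0 /=; exact: gfac_node_le.
(* Each skipped cell is compared with the kept cell to its right; [r 0] then supplies the first kept
   cell, and the surplus last factor is at most 1. *)
have QleP : r 0%N * Q <= grid_prod n.+1 x.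
  apply: (@le_trans _ _ (r 0%N * \prod_(i < n.+1) r i.*2.+2)).
    rewrite ler_wpM2l//; apply: ler_prod => i _; rewrite r0 /=; exact: gfac_node_le.
  have -> : r 0%N * \prod_(i < n.+1) r i.*2.+2 = \prod_(i < n.+2) r i.*2.
    by rewrite [RHS]big_ord_recl /=; congr (_ * _); apply: eq_bigr => i _; rewrite /bump /= add1n doubleS.
  rewrite big_ord_recr /= ler_piMr//.
  by have /andP[] := r01 n.+1.*2.
rewrite expr2 -PQ; apply/andP; split; last by rewrite ler_wpM2l.
by rewrite mulrCA ler_wpM2l.
Qed.

(** The bounds of [grid_prod_sqr] differ only by the factor of the first cell, which tends to 1 with
    the mesh. *)
Lemma grid_prod_cvg (x : R) : 0 <= x ->
  grid_prod n.+1 x @[n --> \oo] --> Num.sqrt (gfac q p x).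
Proof.
move=> x0.
have -> : (fun n => grid_prod n.+1 x) = (fun n => Num.sqrt (grid_prod n.+1 x ^+ 2)).
  by apply/funext => n; rewrite sqrtr_sqr ger0_norm//; have /andP[/ltW] := grid_prod_bounds n x0.
apply: cvg_cont; first exact: sqrt_continuous.
apply: (@squeeze_cvgr _ _ _ _ (fun n => gfac (node n.+1 0) (node n.+1 1) x * gfac q p x) (fun=> gfac q p x)).
- by apply: nearW => n; exact: grid_prod_sqr.
- rewrite -[X in _ --> X]mul1r; apply: cvgM; last exact: cvg_cst.
  have q1 : 1 + x / q != 0 by rewrite gt_eqF// ltr_wpDr// divr_ge0// ltW.
  have <- : (1 + x / q) / (1 + x / q) = 1 by rewrite divff.
  have nodeq : (fun n => gfac (node n.+1 0) (node n.+1 1) x) = (fun n => (1 + x / node n.+1 1) / (1 + x / q)).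
    by apply/funext => n; rewrite /gfac {2}/node mul0r addr0.
  rewrite nodeq; apply: cvgM; last exact: cvg_cst.
  apply: cvgD; first exact: cvg_cst.
  apply: cvgM; first exact: cvg_cst.
  apply: cvgV; first by rewrite gt_eqF.
  rewrite /node /step -[X in _ --> X]addr0; apply: cvgD; first exact: cvg_cst.
  have -> : (fun n : nat => 1%:R * ((p - q) / (2 * n.+1%:R))) = (fun n => (p - q) / 2 * n.+1%:R^-1).
    by apply/funext => n; rewrite mul1r invfM mulrA.
  rewrite -(mulr0 ((p - q) / 2)); apply: cvgM; first exact: cvg_cst.
  exact: cvg_harmonic.
- exact: cvg_cst.
Qed.

End grid.

End stieltjes.

(** * Rational approximation of the hyperbolic cotangent *)

Section coth_product.
Context {R : realType}.

(* (1 + z) ^+ n = E.[z ^+ 2] + z * O.[z ^+ 2] for (E, O) = even_odd n *)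
Fixpoint even_odd n : {poly R} * {poly R} :=
  if n is m.+1 then
    ((even_odd m).1 + 'X * (even_odd m).2, (even_odd m).1 + (even_odd m).2)
  else (1, 0).

Lemma even_oddE n (z : R) :
  (1 + z) ^+ n = (even_odd n).1.[z ^+ 2] + z * (even_odd n).2.[z ^+ 2].
Proof.
elim: n => [|n IH] /=; first by rewrite hornerE horner0 mulr0 addr0 expr0.
by rewrite exprS IH !hornerE; ring.
Qed.

(** De Moivre's formula: take [z] to be i times [tan x] in the decomposition of [(1 + z) ^+ n], so
    that its square is [- tan x ^+ 2]. *)
Lemma even_odd_tan n (x : R) : cos x != 0 ->
  cos (n%:R * x) = cos x ^+ n * (even_odd n).1.[- tan x ^+ 2] /\
  sin (n%:R * x) = cos x ^+ n * (tan x * (even_odd n).2.[- tan x ^+ 2]).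
Proof.
move=> cx; elim: n => [|n [IHc IHs]] /=.
  by rewrite /= mul0r cos0 sin0 !hornerE; split; ring.
have s : sin x = tan x * cos x by rewrite /tan divfK.
rewrite -natr1 mulrDl mul1r cosD sinD IHc IHs s; move: (tan x) (cos x) => t c.
by rewrite hornerD hornerM hornerX hornerD !(exprS c); split; ring.
Qed.

Lemma even_odd_at0 n : (even_odd n).1.[0] = 1 /\ (even_odd n).2.[0] = n%:R.
Proof.
elim: n => [|n [IH1 IH2]] /=; first by rewrite !hornerE.
by rewrite !hornerE IH1 IH2 ?mul0r ?addr0 nat1r.
Qed.

Lemma size_even_odd N :
  (size (even_odd N.*2).1 <= N.+1)%N /\ (size (even_odd N.*2).2 <= N)%N.
Proof.
elim: N => [|N [IH1 IH2]] /=; first by rewrite size_poly1 size_poly0.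
set E := (even_odd N.*2).1 in IH1 *; set O := (even_odd N.*2).2 in IH2 *.
have sX (p : {poly R}) n : (size p <= n)%N -> (size ('X * p)%R <= n.+1)%N.
  by move=> pn; rewrite (leq_trans (size_polyMleq _ _))// size_polyX.
have sD (p q : {poly R}) n : (size p <= n)%N -> (size q <= n)%N -> (size (p + q)%R <= n)%N.
  by move=> pn qn; rewrite (leq_trans (size_polyD _ _))// geq_max pn.
have w m n (p : {poly R}) : (size p <= m)%N -> (m <= n)%N -> (size p <= n)%N by exact: leq_trans.
split; apply: (sD) => //.
- by apply: sD; [exact: w IH1 _|apply: w (sX _ _ IH2) _].
- by apply: sX; apply: sD => //; exact: w IH2 _.
- by apply: sD => //; exact: sX.
- by apply: sD => //; exact: w IH2 _.
Qed.

Lemma horner_roots (p : {poly R}) (rs : seq R) : (size p <= (size rs).+1)%N ->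
  p.[0] != 0 -> all (root p) rs -> uniq rs ->
  forall x, p.[x] = p.[0] * \prod_(r <- rs) (1 - x / r).
Proof.
move=> sp p0 rp urs x.
have pn0 : p != 0 by apply: contraNneq p0 => ->; rewrite horner0.
have sE : size p = (size rs).+1.
  by apply/eqP; rewrite eqn_leq sp /= max_poly_roots.
have r0 : all (fun r => r != 0) rs.
  by apply: sub_all rp => r; apply: contraTneq => ->; rewrite /root.
rewrite (all_roots_prod_XsubC sE rp) ?uniq_rootsE// !hornerZ !horner_prod -mulrA; congr (_ * _).
elim: rs r0 {sp rp urs sE} => [_|r rs IH /= /andP[r0 rs0]]; first by rewrite !big_nil mulr1.
rewrite !big_cons mulrACA -IH// !hornerXsubC; field; exact: r0.
Qed.

Lemma sin_natpi n : sin (n%:R * pi : R) = 0.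
Proof.
elim: n => [|n IH]; first by rewrite mul0r sin0.
by rewrite -natr1 mulrDl mul1r sinDpi IH oppr0.
Qed.

Lemma cos_natpi_half n : cos (n%:R * pi + pi / 2 : R) = 0.
Proof. by rewrite cosDpihalf sin_natpi oppr0. Qed.

Variable M : nat.
Let N := M.+1.

(** [2 * N%:R * angle j] is [j * pi / 2], a zero of the cosine for odd [j] and of the sine for even
    [j]. Thus, for [0 < j < N.*2], the [- tau j] are the roots in [x ^+ 2] of the even or the odd
    part of [(1 + x / (2 * N%:R)) ^+ N.*2], and [tau j] tends to [(j * pi / 2) ^+ 2] as [N]
    grows. *)
Definition angle j : R := j%:R * pi / (4 * N%:R).

Definition tau j : R := (2 * N%:R * tan (angle j)) ^+ 2.

Let N0 : (0 : R) < N%:R. Proof. by rewrite ltr0n. Qed.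

Lemma angle_bounds j : (0 < j < N.*2)%N -> 0 < angle j < pi / 2.
Proof.
move=> /andP[j0 jN]; rewrite /angle divr_gt0 ?mulr_gt0 ?ltr0n ?pi_gt0//=.
rewrite ltr_pdivrMr ?mulr_gt0//.
have -> : pi / 2 * (4 * N%:R) = (N.*2)%:R * pi :> R by rewrite -muln2 natrM; field.
by rewrite ltr_pM2r ?pi_gt0// ltr_nat.
Qed.

Lemma tan_angle_gt0 j : (0 < j < N.*2)%N -> 0 < tan (angle j) /\ 0 < cos (angle j).
Proof.
move=> /angle_bounds /andP[a0 a1].
have c0 : 0 < cos (angle j) by apply: cos_gt0_pihalf; rewrite a1 andbT (lt_trans _ a0)// oppr_lt0 divr_gt0// pi_gt0.
by split => //; rewrite /tan divr_gt0// sin_gt0_pihalf// a0.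
Qed.

Lemma tau_gt0 j : (0 < j < N.*2)%N -> 0 < tau j.
Proof. by move=> /tan_angle_gt0[t0 _]; rewrite exprn_gt0// mulr_gt0// mulr_gt0. Qed.

Lemma tau_lt i j : (0 < i)%N -> (i < j < N.*2)%N -> tau i < tau j.
Proof.
move=> i0 /andP[ij jN].
have jb : (0 < j < N.*2)%N by rewrite jN (leq_ltn_trans _ ij).
have ib : (0 < i < N.*2)%N by rewrite i0 (ltn_trans ij).
have [ti _] := tan_angle_gt0 ib; have [tj _] := tan_angle_gt0 jb.
have /andP[ai ai'] := angle_bounds ib; have /andP[aj aj'] := angle_bounds jb.
have pg : - (pi / 2) < 0 :> R by rewrite oppr_lt0 divr_gt0// pi_gt0.
have aij : angle i < angle j.
  by rewrite /angle ltr_pM2r ?invr_gt0 ?mulr_gt0// ltr_pM2r ?pi_gt0// ltr_nat.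
have n0 (t : R) : 0 < t -> 0 <= 2 * N%:R * t by move=> t0; rewrite ltW// mulr_gt0// mulr_gt0.
rewrite /tau ltr_pXn2r ?nnegrE ?n0// ltr_pM2l ?mulr_gt0// ltr_tan// in_itv/=.
  by rewrite ai' (lt_trans pg).
by rewrite aj' (lt_trans pg).
Qed.

Lemma tau_inj i j : (0 < i < N.*2)%N -> (0 < j < N.*2)%N -> tau i = tau j -> i = j.
Proof.
move=> /andP[i0 iN] /andP[j0 jN] E; have [ij|ji|//] := ltngtP i j.
- by have := @tau_lt i j i0; rewrite ij jN E ltxx => /(_ isT).
- by have := @tau_lt j i j0; rewrite ji iN E ltxx => /(_ isT).
Qed.

Let root_of j : R := - tan (angle j) ^+ 2.

Let root_ofE j : (0 < j < N.*2)%N -> root_of j = - (tau j / (2 * N%:R) ^+ 2).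
Proof. by move=> _; rewrite /root_of /tau; field; rewrite pnatr_eq0. Qed.

Let root_of_inj i j : (0 < i < N.*2)%N -> (0 < j < N.*2)%N -> root_of i = root_of j -> i = j.
Proof.
move=> ib jb; rewrite !root_ofE// => /oppr_inj /mulIf H; apply: tau_inj => //; apply: H.
by rewrite invr_eq0 expf_neq0// mulf_neq0// pnatr_eq0.
Qed.

(** The tangents at odd multiples of the basic angle give [N] distinct roots, as many as the degree
    allows; the value at 0 fixes the normalization. *)
Lemma even_prod (x : R) : (even_odd N.*2).1.[(x / (2 * N%:R)) ^+ 2] =
  \prod_(k < N) (1 + x ^+ 2 / tau k.*2.+1).
Proof.
pose rs := [seq root_of k.*2.+1 | k <- iota 0 N].
have kb k : (k < N)%N -> (0 < k.*2.+1 < N.*2)%N.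
  by move=> kN /=; rewrite -doubleS leq_double.
rewrite (@horner_roots _ rs).
- have [-> _] := even_odd_at0 N.*2.
  rewrite mul1r /rs big_map (_ : iota 0 N = index_iota 0 N) ?big_mkord; last by rewrite /index_iota subn0.
  apply: eq_bigr => k _; rewrite /root_of /tau.
  have [t0 _] := tan_angle_gt0 (kb k (ltn_ord k)).
  by field; rewrite pnatr_eq0 gt_eqF.
- by rewrite size_map size_iota; have [] := size_even_odd N.
- by have [-> _] := even_odd_at0 N.*2; rewrite oner_eq0.
- apply/allP => r /mapP[k]; rewrite mem_iota /= add0n => kN ->.
  have [_ c0] := tan_angle_gt0 (kb k kN).
  have [Ec _] := even_odd_tan N.*2 (lt0r_neq0 c0).
  move: Ec; have -> : (N.*2)%:R * angle k.*2.+1 = k%:R * pi + pi / 2.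
    rewrite /angle -(natr1 k.*2) -!muln2 !natrM; field.
    by rewrite pnatr_eq0.
  rewrite cos_natpi_half => /esym/eqP; rewrite mulf_eq0 expf_eq0 (gt_eqF c0) andbF /=.
  by rewrite rootE.
- rewrite map_inj_in_uniq ?iota_uniq// => i j; rewrite !mem_iota /= !add0n => iN jN.
  by move=> /(root_of_inj (kb i iN) (kb j jN)) [] /double_inj.
Qed.

Lemma odd_prod (x : R) : (even_odd N.*2).2.[(x / (2 * N%:R)) ^+ 2] =
  2 * N%:R * \prod_(k < M) (1 + x ^+ 2 / tau k.+1.*2).
Proof.
pose rs := [seq root_of k.+1.*2 | k <- iota 0 M].
have kb k : (k < M)%N -> (0 < k.+1.*2 < N.*2)%N.
  by move=> kN; rewrite ltn_double ltnS.
rewrite (@horner_roots _ rs).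
- have [_ ->] := even_odd_at0 N.*2.
  rewrite -muln2 natrM (mulrC N%:R) /rs big_map (_ : iota 0 M = index_iota 0 M) ?big_mkord; last by rewrite /index_iota subn0.
  congr (_ * _); apply: eq_bigr => k _; rewrite /root_of /tau.
  have [t0 _] := tan_angle_gt0 (kb k (ltn_ord k)).
  by field; rewrite pnatr_eq0 gt_eqF.
- by rewrite size_map size_iota; have [] := size_even_odd N.
- by have [_ ->] := even_odd_at0 N.*2; rewrite pnatr_eq0.
- apply/allP => r /mapP[k]; rewrite mem_iota /= add0n => kN ->.
  have [t0 c0] := tan_angle_gt0 (kb k kN).
  have [_ Es] := even_odd_tan N.*2 (lt0r_neq0 c0).
  move: Es; have -> : (N.*2)%:R * angle k.+1.*2 = k.+1%:R * pi.
    rewrite /angle -!muln2 !natrM; field.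
    by rewrite pnatr_eq0.
  rewrite sin_natpi => /esym/eqP; rewrite mulf_eq0 expf_eq0 (gt_eqF c0) andbF /= mulf_eq0 (gt_eqF t0) /=.
  by rewrite rootE.
- rewrite map_inj_in_uniq ?iota_uniq// => i j; rewrite !mem_iota /= !add0n => iN jN.
  by move=> /(root_of_inj (kb i iN) (kb j jN)) /double_inj [].
Qed.

(** Since [2 * N%:R * angle 1] is [pi / 2], this amounts to [y < tan y], from the mean value
    theorem. The bound holds whatever the degree, and the threshold on [T] comes from it. *)
Lemma tau1_gt : (pi / 2) ^+ 2 < tau 1.
Proof.
have b1 : (0 < 1 < N.*2)%N by rewrite /N doubleS.
have /andP[a0 a1] := angle_bounds b1.
have pg : - (pi / 2) < 0 :> R by rewrite oppr_lt0 divr_gt0// pi_gt0.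
have cp (y : R) : 0 <= y -> y <= angle 1 -> 0 < cos y.
  by move=> y0 ya; apply: cos_gt0_pihalf; rewrite (lt_le_trans pg y0) (le_lt_trans ya a1).
have ta : angle 1 < tan (angle 1).
  have [||c] := @MVT _ (@tan R) (fun y => (cos y)^-2) 0 (angle 1) a0.
  - move=> y; rewrite in_itv/= => /andP[y0 y1].
    by apply: is_derive_tan; rewrite gt_eqF// cp// ltW.
  - apply: continuous_in_subspaceT => y; rewrite inE /= in_itv/= => /andP[y0 y1].
    by apply: continuous_tan; rewrite gt_eqF// cp.
  rewrite in_itv/= tan0 !subr0 => /andP[c0 c1] ->.
  rewrite ltr_pMl// invf_gt1 ?exprn_gt0 ?cp ?(ltW c0) ?(ltW c1)//.
  rewrite exprn_ilt1// ?(ltW (cp _ _ _)) ?(ltW c0) ?(ltW c1)//.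
  rewrite -cos0 ltr_cos ?in_itv/= ?lexx ?pi_ge0 ?(ltW c0)//=.
  rewrite (le_trans (ltW c1))// (le_trans (ltW a1))// ler_pdivrMr// ler_peMr ?pi_ge0//.
  by rewrite ler1n.
have t0 : 0 <= 2 * N%:R * tan (angle 1).
  by rewrite ltW// mulr_gt0 ?(lt_trans a0 ta)// mulr_gt0.
rewrite /tau ltr_pXn2r ?nnegrE// ?divr_ge0 ?pi_ge0//.
have -> : pi / 2 = 2 * N%:R * angle 1 by rewrite /angle; field; rewrite pnatr_eq0.
by rewrite ltr_pM2l// mulr_gt0.
Qed.

End coth_product.

(** * The symbol as a limit of Stieltjes functions *)

Section symbol_positivity.
Context {R : realType}.

(** With [y = x / (2 * n.+1%:R)], raise [expR (y / (1 + y)) <= 1 + y <= expR y] to the power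
    [n.+1.*2]; this needs [0 < 1 + y], true for large [n]. *)
Lemma cvg_expR_pow (x : R) : (1 + x / (2 * n.+1%:R)) ^+ n.+1.*2 @[n --> \oo] --> expR x.
Proof.
have c0 : x / (2 * n.+1%:R) @[n --> \oo] --> (0 : R).
  have -> : (fun n : nat => x / (2 * n.+1%:R)) = (fun n => x / 2 * n.+1%:R^-1).
    by apply/funext => n; rewrite invfM mulrA.
  rewrite -(mulr0 (x / 2)); apply: cvgM; [exact: cvg_cst|exact: cvg_harmonic].
have c1 : 1 + x / (2 * n.+1%:R) @[n --> \oo] --> (1 : R).
  by rewrite -[X in _ --> X]addr0; apply: cvgD => //; exact: cvg_cst.
have m0 n : 0 < 2 * n.+1%:R :> R by rewrite mulr_gt0.
have mE n : 2 * n.+1%:R = (n.+1.*2)%:R :> R by rewrite -muln2 natrM mulrC.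
apply: (@squeeze_cvgr _ _ _ _ (fun n => expR (x / (1 + x / (2 * n.+1%:R)))) (fun=> expR x)).
- near=> n.
  have y0 : 0 < 1 + x / (2 * n.+1%:R).
    by near: n; apply: (cvgr_gt 1 c1); exact: ltr01.
  move: y0; set y := x / _ => y0.
  have xE : x = (n.+1.*2)%:R * y by rewrite /y -mE mulrC divfK// gt_eqF.
  have h1 : 1 + y <= expR y by exact: expR_ge1Dx.
  have h2 : expR (y / (1 + y)) <= 1 + y.
    have h3 : (1 + y)^-1 <= expR (- (y / (1 + y))).
      apply: le_trans (expR_ge1Dx _).
      by rewrite le_eqVlt; apply/orP; left; apply/eqP; field; rewrite gt_eqF.
    by rewrite -[expR _]invrK -expRN -[leRHS]invrK lef_pV2 ?posrE ?invr_gt0 ?expR_gt0.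
  have -> : expR (x / (1 + y)) = expR (y / (1 + y)) ^+ n.+1.*2.
    by rewrite -expRM_natl {1}xE mulrA.
  have -> : expR x = expR y ^+ n.+1.*2 by rewrite -expRM_natl -xE.
  by rewrite !lerXn2r ?nnegrE ?expR_ge0 ?(ltW y0).
- apply: cvg_cont; first exact: continuous_expR.
  rewrite -[X in _ --> X]mulr1; apply: cvgM; first exact: cvg_cst.
  by have := cvgV (oner_neq0 R) c1; rewrite invr1; apply.
- exact: cvg_cst.
Unshelve. all: by end_near. Qed.

Definition coth_approx M (x : R) :=
  (\prod_(k < M.+1) (1 + x ^+ 2 / tau M k.*2.+1)) /
  (\prod_(k < M) (1 + x ^+ 2 / tau M k.+1.*2)).

(** With [z = x / (2 * M.+1%:R)], the sum and the difference of [(1 + z) ^+ M.+1.*2] and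
    [(1 - z) ^+ M.+1.*2] are twice the even part and [2 * z] times the odd part, which the two
    products factor. *)
Lemma coth_approxE M (x : R) : x != 0 ->
  coth_approx M x =
  x * ((1 + x / (2 * M.+1%:R)) ^+ M.+1.*2 + (1 + - x / (2 * M.+1%:R)) ^+ M.+1.*2) /
      ((1 + x / (2 * M.+1%:R)) ^+ M.+1.*2 - (1 + - x / (2 * M.+1%:R)) ^+ M.+1.*2).
Proof.
move=> x0; rewrite /coth_approx -even_prod.
have m0 : 2 * M.+1%:R != 0 :> R by rewrite mulf_neq0// pnatr_eq0.
have Q0 : \prod_(k < M) (1 + x ^+ 2 / tau M k.+1.*2) != 0.
  rewrite gt_eqF// prodr_gt0// => k _.
  rewrite ltr_wpDr// divr_ge0 ?sqr_ge0// ltW// tau_gt0//.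
have := odd_prod M x; set Q := \prod_(k < M) _ in Q0 * => OE.
set z := x / (2 * M.+1%:R) in OE *.
have -> : - x / (2 * M.+1%:R) = - z by rewrite /z mulNr.
rewrite !even_oddE sqrrN OE; set E := _.[_].
have xE : x = 2 * M.+1%:R * z by rewrite /z mulrC divfK.
rewrite xE.
have z0 : z != 0 by apply: contra_neq x0 => z0; rewrite xE z0 mulr0.
field.
rewrite Q0 andbT; set d := (X in X != 0).
have -> : d = 4 * z * ((1 + M%:R) * Q) by rewrite /d; ring.
by rewrite nat1r !mulf_neq0// pnatr_eq0.
Qed.

Lemma coth_approx_cvg (x : R) : x != 0 -> coth_approx M x @[M --> \oo] --> x / tanh x.
Proof.
move=> x0; rewrite (eq_cvg _ _ (fun M => coth_approxE M x0)).
have d0 : expR x - expR (- x) != 0.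
  by rewrite subr_eq0; apply: contra_neq x0 => /expR_inj; lra.
have -> : x / tanh x = x * (expR x + expR (- x)) / (expR x - expR (- x)).
  rewrite /tanh; field; rewrite d0/= gt_eqF// addr_gt0// expR_gt0//.
apply: cvgM.
  by apply: cvgM; [exact: cvg_cst|apply: cvgD; exact: cvg_expR_pow].
by apply: cvgV => //; apply: cvgB; exact: cvg_expR_pow.
Qed.

Variable T : R.
Hypothesis T4 : 4 / pi ^+ 2 <= T.

Lemma pi2_gt0 : 0 < (pi : R) ^+ 2. Proof. by rewrite exprn_gt0// pi_gt0. Qed.

Lemma T_gt0 : 0 < T.
Proof. by apply: lt_le_trans T4; rewrite divr_gt0// pi2_gt0. Qed.

Definition zero_at M k : R := tau M k.*2.+1.
(** The first pole comes from the factor [1 + T * x ^+ 2], the others from the odd part of the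
    binomial. *)
Definition pole_at M k : R := if k is 0 then T^-1 else tau M k.*2.

Lemma pole_at_gt0 M k : (k < M.+1)%N -> 0 < pole_at M k.
Proof.
case: k => [|k] kM /=; first by rewrite invr_gt0 T_gt0.
by rewrite tau_gt0// double_gt0 /= ltn_double.
Qed.

Lemma pole_lt_zero M k : (k < M.+1)%N -> pole_at M k < zero_at M k.
Proof.
case: k => [_|k kM]; last first.
  by rewrite /pole_at /zero_at tau_lt// ltnSn/= -doubleS leq_double.
(* Here the threshold acts: [T^-1 <= pi ^+ 2 / 4 < tau M 1]. *)
rewrite /pole_at /zero_at; apply: le_lt_trans (tau1_gt M).
rewrite -[leRHS]invrK lef_pV2 ?posrE ?T_gt0 ?invr_gt0 ?exprn_gt0 ?divr_gt0 ?pi_gt0//.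
apply: le_trans T4; rewrite le_eqVlt; apply/orP; left; apply/eqP.
move: (pi : R) (pi_gt0 R) => P P0; field.
by rewrite gt_eqF.
Qed.

Lemma zero_le_pole M k : (k.+1 < M.+1)%N -> zero_at M k <= pole_at M k.+1.
Proof.
move=> kM; rewrite /pole_at /zero_at ltW// tau_lt//.
by rewrite ltnSn /= ltn_double.
Qed.

Lemma gfac_prodE M (x : R) :
  \prod_(k < M.+1) gfac (pole_at M k) (zero_at M k) (x ^+ 2) =
  coth_approx M x / (1 + T * x ^+ 2).
Proof.
rewrite /gfac big_split /= /coth_approx -mulrA -invfM; congr (_ * _).
rewrite prodfV; congr (_ ^-1).
by rewrite big_ord_recl /= invrK mulrC (mulrC T).
Qed.

Definition rational_approx M n (x : R) : R :=
  \prod_(k < M.+1) grid_prod (zero_at M k) (pole_at M k) n.+1 x.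

Lemma stieltjes_rational_approx M n : stieltjes (zero_at M M) (rational_approx M n).
Proof.
have H k : (k < M.+1)%N -> stieltjes (zero_at M k)
    (fun x => \prod_(i < k.+1) grid_prod (zero_at M i) (pole_at M i) n.+1 x).
  elim: k => [kM|k IH kM].
    rewrite (_ : (fun x => _) = (fun x => 1 * grid_prod (zero_at M 0) (pole_at M 0) n.+1 x)); last first.
      by apply/funext => x; rewrite big_ord_recl big_ord0 mulr1 mul1r.
    apply: (@stieltjes_grid R (zero_at M 0) (pole_at M 0) _ _ 0 (fun=> 1) n).
    - exact: pole_at_gt0.
    - exact: pole_lt_zero.
    - exact: stieltjes1.
    - by rewrite ltW// pole_at_gt0.
  rewrite (_ : (fun x => _) = (fun x => (\prod_(i < k.+1) grid_prod (zero_at M i) (pole_at M i) n.+1 x) * grid_prod (zero_at M k.+1) (pole_at M k.+1) n.+1 x)); last first.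
    by apply/funext => x; rewrite big_ord_recr.
  apply: (@stieltjes_grid R (zero_at M k.+1) (pole_at M k.+1) _ _ (zero_at M k) _ n).
  - exact: pole_at_gt0.
  - exact: pole_lt_zero.
  - exact: IH (ltnW kM).
  - exact: zero_le_pole.
exact: H.
Qed.

Lemma rational_approx_bounds M n (x : R) : 0 <= x -> 0 <= rational_approx M n x <= 1.
Proof.
move=> x0.
have H (k : 'I_M.+1) : 0 <= grid_prod (zero_at M k) (pole_at M k) n.+1 x <= 1.
  have [a b] := (pole_at_gt0 (ltn_ord k), pole_lt_zero (ltn_ord k)).
  by have /andP[/ltW -> ->] := grid_prod_bounds a b n x0.
apply/andP; split; first by apply: prodr_ge0 => k _; have /andP[] := H k.
by apply: prodr_ile1 => k _; exact: H.
Qed.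

Lemma cvg_prod_ord (N : nat) (F : 'I_N -> nat -> R) (l : 'I_N -> R) :
  (forall k, F k n @[n --> \oo] --> l k) ->
  \prod_(k < N) F k n @[n --> \oo] --> \prod_(k < N) l k.
Proof.
elim: N F l => [|N IH] F l Fl.
  rewrite big_ord0; under eq_cvg do rewrite big_ord0.
  exact: cvg_cst.
rewrite big_ord_recl; under eq_cvg do rewrite big_ord_recl.
by apply: cvgM => //; apply: IH => k; exact: Fl.
Qed.

Lemma rational_approx_cvg M (x : R) :
  rational_approx M n (x ^+ 2) @[n --> \oo] -->
  Num.sqrt (coth_approx M x / (1 + T * x ^+ 2)).
Proof.
rewrite -gfac_prodE.
have -> : Num.sqrt (\prod_(k < M.+1) gfac (pole_at M k) (zero_at M k) (x ^+ 2)) =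
   \prod_(k < M.+1) Num.sqrt (gfac (pole_at M k) (zero_at M k) (x ^+ 2)).
  have H (k : 'I_M.+1) : 0 <= gfac (pole_at M k) (zero_at M k) (x ^+ 2).
    have [a b] := (pole_at_gt0 (ltn_ord k), pole_lt_zero (ltn_ord k)).
    by have /andP[/ltW] := gfac_bounds a (ltW b) (sqr_ge0 x).
  apply/esym; elim/big_rec2: _ => [|k y1 y2 _ ->]; first by rewrite sqrtr1.
  by rewrite [RHS]sqrtrM; [|exact: H].
rewrite /rational_approx; apply: (@cvg_prod_ord M.+1 (fun k n => grid_prod (zero_at M k) (pole_at M k) n.+1 (x ^+ 2))) => k.
have [a b] := (pole_at_gt0 (ltn_ord k), pole_lt_zero (ltn_ord k)).
exact: (grid_prod_cvg a b (sqr_ge0 x)).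
Qed.

Lemma symbol_cvg (x : R) :
  Num.sqrt (coth_approx M x / (1 + T * x ^+ 2)) @[M --> \oo] --> symbol T x.
Proof.
rewrite /symbol; case: (eqVneq x 0) => [->|x0].
  have E M : Num.sqrt (coth_approx M 0 / (1 + T * 0 ^+ 2)) = 1.
    rewrite /coth_approx expr0n /= !big1 => [| k _|k _]; rewrite ?mul0r ?addr0//.
    by rewrite mulr0 addr0 !divr1 sqrtr1.
  by under eq_cvg do rewrite E; exact: cvg_cst.
apply: cvg_cont; first exact: sqrt_continuous.
have -> : x / ((1 + T * x ^+ 2) * tanh x) = x / tanh x / (1 + T * x ^+ 2).
  by rewrite invfM; ring.
by apply: cvgM; [exact: coth_approx_cvg|exact: cvg_cst].
Qed.

Variable psi : R -> R.
Hypothesis npsi : fourier_nice psi.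
Hypothesis psi0 : forall x, x <= 0 -> psi x = 0.
Hypothesis psiL : forall s, 0 < s -> 0 <= integ (fun x => expabs s x * psi x).

Lemma continuous_resolvent (b : R) : 0 < b -> continuous (fun x : R => (x ^+ 2 + b)^-1).
Proof.
move=> b0 x; apply: cvgV; first by rewrite gt_eqF// ltr_wpDl ?sqr_ge0.
by apply: cvgD; [exact: exprn_continuous|exact: cvg_cst].
Qed.

Lemma L1_ct_resolvent (b : R) : 0 < b -> L1 (fun xi => ct psi xi * (xi ^+ 2 + b)^-1).
Proof.
have [_ _ _ Lct] := npsi => b0; apply: (L1_bounded_mul (M := b^-1)) => //.
  by apply: cont_meas; exact: continuous_resolvent.
move=> x; rewrite ger0_norm ?invr_ge0 ?addr_ge0 ?sqr_ge0 ?(ltW b0)//.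
by rewrite lef_pV2 ?posrE ?ltr_wpDl ?sqr_ge0// lerDr sqr_ge0.
Qed.

(** Inversion at 0 turns the constant term into a multiple of [psi 0 = 0]; by [ct_resolvent] each
    fraction contributes a nonnegative multiple of the Laplace transform of [psi] at
    [Num.sqrt p.2]. *)
Lemma stieltjes_pairing_ge0 beta (f : R -> R) : stieltjes beta f ->
  measurable_fun setT (fun xi : R => f (xi ^+ 2)) /\
  0 <= integ (fun xi => ct psi xi * f (xi ^+ 2)).
Proof.
have [cpsi [B bpsi] Lpsi Lct] := npsi.
move=> [[c [s [c0 ps E]]] _].
have fE xi : f (xi ^+ 2) = c + \sum_(p <- s) p.1 / (xi ^+ 2 + p.2).
  by apply: E; left; exact: sqr_ge0.
have -> : (fun xi : R => f (xi ^+ 2)) = (fun xi => c + \sum_(p <- s) p.1 / (xi ^+ 2 + p.2)).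
  by apply/funext.
have -> : (fun xi : R => ct psi xi * f (xi ^+ 2)) = (fun xi => ct psi xi * c + ct psi xi * \sum_(p <- s) p.1 / (xi ^+ 2 + p.2)).
  by apply/funext => xi; rewrite fE mulrDr.
suff [mS LS S0] : [/\ measurable_fun setT (fun xi : R => \sum_(p <- s) p.1 / (xi ^+ 2 + p.2)),
   L1 (fun xi => ct psi xi * \sum_(p <- s) p.1 / (xi ^+ 2 + p.2)) &
   0 <= integ (fun xi => ct psi xi * \sum_(p <- s) p.1 / (xi ^+ 2 + p.2))].
  split; first exact: measurable_funD.
  have Lc : L1 (fun xi => ct psi xi * c) by apply: eq_L1 (L1Zl c Lct) => xi; exact: mulrC.
  rewrite integD//; apply: addr_ge0 => //.
  under eq_integ do rewrite mulrC.
  rewrite integZl// (ct_inversion0 cpsi bpsi Lpsi Lct) psi0// !mulr0.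
  exact: lexx.
elim: s ps {E fE} => [_|p s IH /= /andP[/and3P[p1 p2 _] ps]].
  rewrite (_ : (fun xi : R => \sum_(p <- [::]) _) = fun=> 0); last first.
    by apply/funext => xi; rewrite big_nil.
  rewrite (_ : (fun xi : R => ct psi xi * _) = fun=> 0); last first.
    by apply/funext => xi; rewrite big_nil mulr0.
  split; [exact: measurable_cst|exact: L10|by rewrite integ0].
have [mS LS S0] := IH ps.
rewrite (_ : (fun xi : R => \sum_(p <- p :: s) _) = fun xi => p.1 * (xi ^+ 2 + p.2)^-1 + \sum_(p <- s) p.1 / (xi ^+ 2 + p.2)); last first.
  by apply/funext => xi; rewrite big_cons.
rewrite (_ : (fun xi : R => ct psi xi * _) = fun xi => p.1 * (ct psi xi * (xi ^+ 2 + p.2)^-1) + ct psi xi * \sum_(p <- s) p.1 / (xi ^+ 2 + p.2)); last first.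
  by apply/funext => xi; rewrite big_cons; ring.
have L1r := L1_ct_resolvent p2.
split.
- apply: measurable_funD => //; apply: measurable_funM => //.
  by apply: cont_meas; exact: continuous_resolvent.
- by apply: L1D => //; exact: L1Zl.
- rewrite integD//; last exact: L1Zl.
  rewrite addr_ge0// integZl// mulr_ge0//.
  have s0 : 0 < Num.sqrt p.2 by rewrite sqrtr_gt0.
  have := ct_resolvent npsi s0; rewrite sqr_sqrtr ?(ltW p2)//.
  under eq_integ do rewrite addrC.
  by move=> ->; rewrite mulr_ge0 ?psiL// divr_ge0 ?pi_ge0// ltW.
Qed.

(** Two dominated limits, first in the mesh and then in the degree; every approximant takes values
    in [[0, 1]], so the absolute value of [ct psi] dominates. *)
Lemma symbol_pairing_ge0 :
  L1 (fun xi => ct psi xi * symbol T xi) /\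
  0 <= integ (fun xi => ct psi xi * symbol T xi).
Proof.
have [cpsi [B bpsi] Lpsi Lct] := npsi.
pose g M xi : R := Num.sqrt (coth_approx M xi / (1 + T * xi ^+ 2)).
have st M n := stieltjes_pairing_ge0 (stieltjes_rational_approx M n).
have g01 M xi : 0 <= g M xi <= 1.
  have c := @rational_approx_cvg M xi.
  rewrite sqrtr_ge0 /=.
  have c' : 1 - rational_approx M n (xi ^+ 2) @[n --> \oo] --> 1 - g M xi.
    by apply: cvgB => //; exact: cvg_cst.
  rewrite -subr_ge0; apply: (cvgn_ge0 c') => n.
  by rewrite subr_ge0; have /andP[] := rational_approx_bounds M n (sqr_ge0 xi).
have bound (F : R -> R) xi : (forall xi, 0 <= F xi <= 1) -> `|ct psi xi * F xi| <= `|ct psi xi|.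
  by move=> /(_ xi) /andP[f0 f1]; rewrite normrM (ger0_norm f0) ler_piMr.
have mg M : measurable_fun setT (g M).
  apply: (measurable_fun_cvg (h := fun n (xi : R) => rational_approx M n (xi ^+ 2))).
    by move=> n; have [] := st M n.
  by move=> xi _; exact: rational_approx_cvg.
have G0 M : 0 <= integ (fun xi => ct psi xi * g M xi).
  have [||||_ C] := @integ_dom R (fun n xi => ct psi xi * rational_approx M n (xi ^+ 2)) (fun xi => ct psi xi * g M xi) (fun xi => `|ct psi xi|).
  - by move=> n; apply: measurable_funM; [exact: L1_meas|have [] := st M n].
  - exact: L1_norm.
  - by move=> n xi; apply: (bound (fun xi => rational_approx M n (xi ^+ 2))) => x; apply: rational_approx_bounds; exact: sqr_ge0.
  - by move=> xi; apply: cvgM; [exact: cvg_cst|exact: rational_approx_cvg].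
  by apply: (cvgn_ge0 C) => n; have [] := st M n.
have [||||L C] := @integ_dom R (fun M xi => ct psi xi * g M xi) (fun xi => ct psi xi * symbol T xi) (fun xi => `|ct psi xi|).
- by move=> M; apply: measurable_funM; [exact: L1_meas|exact: mg].
- exact: L1_norm.
- by move=> M xi; exact: bound.
- by move=> xi; apply: cvgM; [exact: cvg_cst|exact: symbol_cvg].
by split => //; apply: (cvgn_ge0 C).
Qed.

End symbol_positivity.

(** * Test functions *)

Section smooth_functions.
Context {R : realType}.
Implicit Types (f g psi : R -> R).

(** Plain [n]-fold differentiability, continuity at the last level being automatic in [smooth]. The
    derivative is an explicit witness, so that closure properties follow by induction on [n]. *)
Fixpoint Ck n f : Prop :=
  if n is m.+1 then exists2 g : R -> R, forall x : R, is_derive x 1 f (g x) & Ck m g else True.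

Definition smooth f := forall n, Ck n f.

Lemma derive1_fun f g : (forall x : R, is_derive x 1 f (g x)) -> derive1 f = g.
Proof.
by move=> H; apply/funext => x; rewrite derive1E; exact: derive_val.
Qed.

Lemma CkS n f : Ck n.+1 f -> Ck n f.
Proof.
elim: n f => // n IH f [g fg gn]; exists g => //; exact: IH.
Qed.

Lemma smooth_derive f : smooth f ->
  (forall x : R, is_derive x 1 f (derive1 f x)) /\ smooth (derive1 f).
Proof.
move=> sf; split.
  by have [g fg _] := sf 1; rewrite (derive1_fun fg).
by move=> n; have [g fg gn] := sf n.+1; rewrite (derive1_fun fg).
Qed.

Lemma smooth_on_setT f : smooth f -> smooth_on setT f.
Proof.
move=> sf n x _; elim: n f sf x => [|n IH] f sf x.
  by have [/(_ x) []] := smooth_derive sf.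
by rewrite derive1Sn; apply: IH; have [] := smooth_derive sf.
Qed.

Lemma smooth_continuous f : smooth f -> continuous f.
Proof.
move=> sf x; have [/(_ x) [fx _] _] := smooth_derive sf.
by apply: differentiable_continuous; apply/derivable1_diffP.
Qed.

Lemma CkD n f g : Ck n f -> Ck n g -> Ck n (fun x => f x + g x).
Proof.
elim: n f g => // n IH f g [f' ff' nf] [g' gg' ng].
by exists (fun x => f' x + g' x) => [x|]; [exact: is_deriveD|exact: IH].
Qed.

Lemma CkM n f g : Ck n f -> Ck n g -> Ck n (fun x => f x * g x).
Proof.
elim: n f g => // n IH f g [f' ff' nf] [g' gg' ng].
exists (fun x => f x * g' x + g x * f' x) => [x|]; first exact: is_deriveM.
apply: CkD; apply: IH => //; apply: CkS; [by exists f'|by exists g'].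
Qed.

Lemma Ck_cst n (c : R) : Ck n (fun=> c).
Proof. by elim: n c => // n IH c; exists (fun=> 0) => // x; exact: is_derive_cst. Qed.

Lemma Ck_affine n f (a b : R) : Ck n f -> Ck n (fun x => f (a * x + b)).
Proof.
elim: n f => // n IH f [f' ff' nf].
exists (fun x => a * f' (a * x + b)) => [x|]; last first.
  by apply: CkM; [exact: Ck_cst|exact: IH].
have da : is_derive x 1 (fun x : R => a * x + b) a.
  by apply: is_derive_eq; rewrite /GRing.scale /= mulr1 addr0.
rewrite mulrC; apply: (@is_derive1_comp _ f (fun x => a * x + b)).
Qed.

Lemma Ck_cos n (c : R) : Ck n (fun x => cos (x * c)) /\ Ck n (fun x => sin (x * c)).
Proof.
elim: n => // n [IHc IHs]; split.
- exists (fun x => - c * sin (x * c)); last by apply: CkM => //; exact: Ck_cst.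
  by move=> x; apply: is_derive_eq; rewrite /GRing.scale /=; ring.
- exists (fun x => c * cos (x * c)); last by apply: CkM => //; exact: Ck_cst.
  by move=> x; apply: is_derive_eq; rewrite /GRing.scale /=; ring.
Qed.

Lemma smoothM f g : smooth f -> smooth g -> smooth (fun x => f x * g x).
Proof. by move=> sf sg n; apply: CkM. Qed.

Lemma smooth_affine f (a b : R) : smooth f -> smooth (fun x => f (a * x + b)).
Proof. by move=> sf n; exact: Ck_affine. Qed.

Lemma smooth_shift f (b : R) : smooth f -> smooth (fun x => f (x + b)).
Proof.
by move=> /(smooth_affine 1 b); under eq_fun do rewrite mul1r.
Qed.

(** * Flat exponentials and bumps *)

Section flat_exponential.
Implicit Types p : {poly R}.

(** Polynomials in [x^-1] are allowed as factors to make the family stable under differentiation. *)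
Definition flat_exp p (x : R) : R := if 0 < x then p.[x^-1] * expR (- x^-1) else 0.

Lemma poly_expRN_bound p : exists C : R, forall y, 0 <= y -> `|p.[y]| * expR (- y) <= C.
Proof.
exists (\sum_(i < size p) `|p`_i| * i`!%:R) => y y0.
rewrite expRN ler_pdivrMr ?expR_gt0// horner_coef (le_trans (ler_norm_sum _ _ _))//.
rewrite mulr_suml; apply: ler_sum => i _; rewrite normrM normrX (ger0_norm y0) -mulrA.
rewrite ler_wpM2l// mulrC -ler_pdivrMr ?ltr0n ?fact_gt0//.
case: (i : nat) => [|k]; first by rewrite expr0 fact0 divr1 -expR0 ler_expR.
by apply: le_trans (expR_ge1Dxn k y0); rewrite lerDr.
Qed.

Lemma is_derive_flat_exp p (x : R) :
  is_derive x 1 (flat_exp p) (flat_exp ('X^2 * (p - p^`()%R)) x).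
Proof.
have [x0|x0|->] := ltgtP x 0.
- have -> : flat_exp ('X^2 * (p - p^`())) x = 0 by rewrite /flat_exp ltNge (ltW x0).
  apply: (@near_eq_is_derive _ _ _ (fun=> 0)).
  near=> y; rewrite /flat_exp ifF//; apply/negbTE; rewrite -leNgt ltW//.
  by near: y; exact: lt_nbhsl.
- rewrite /flat_exp x0.
  apply: (@near_eq_is_derive _ _ _ (fun y : R => p.[y^-1] * expR (- y^-1) : R)).
    near=> y; rewrite ifT//; near: y; exact: lt_nbhsr.
  have dinv : is_derive x 1 (fun y : R => y^-1) (- x ^- 2).
    by apply: is_derive_eq; [apply: is_deriveV; rewrite gt_eqF|rewrite /GRing.scale /= mulr1].
  have dp : is_derive x 1 (fun y : R => p.[y^-1]) (p^`().[x^-1] * (- x ^- 2)).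
    exact: (@is_derive1_comp _ (horner p) (fun y => y^-1)).
  have de : is_derive x 1 (fun y : R => expR (- y^-1)) (expR (- x^-1) * (- - x ^- 2)).
    by apply: (@is_derive1_comp _ expR (fun y => - y^-1)).
  apply: is_derive_eq; rewrite /GRing.scale /= hornerM hornerXn hornerD hornerN.
  by field; rewrite gt_eqF.
- have -> : flat_exp ('X^2 * (p - p^`())) 0 = 0 by rewrite /flat_exp ltxx.
  (* At the origin: bounding with the extra factor ['X^2] leaves the difference quotient at [h > 0]
     at most [h * C]. *)
  have [C HC] := poly_expRN_bound ('X^2 * p).
  have C0 : 0 <= C by apply: le_trans (HC 0 (lexx _)); rewrite mulr_ge0// expR_ge0.
  suff H : h^-1 *: (flat_exp p (h *: 1 + 0) - flat_exp p 0) @[h --> 0^'] --> (0 : R).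
    by apply: DeriveDef; [apply/cvg_ex; exists 0|exact: cvg_lim].
  apply/cvgr0Pnorm_le => e e0.
  exists (e / (C + 1)); first by rewrite /= divr_gt0// ltr_wpDl.
  move=> h /=; rewrite sub0r normrN ltr_pdivlMr ?ltr_wpDl// => he h0.
  rewrite /GRing.scale /= mulr1 addr0 /flat_exp ltxx subr0.
  case: ifPn => hp; last by rewrite mulr0 normr0 ltW.
  rewrite (gtr0_norm hp) in he.
  have hV : 0 <= h^-1 by rewrite invr_ge0 ltW.
  have := HC _ hV; rewrite hornerM hornerXn normrM normrX (ger0_norm hV) => H.
  rewrite !normrM (ger0_norm hV) (ger0_norm (expR_ge0 _)).
  apply: (@le_trans _ _ (h * C)).
    have -> : h^-1 * (`|p.[h^-1]| * expR (- h^-1)) = h * (h^-1 ^+ 2 * `|p.[h^-1]| * expR (- h^-1)).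
      by field; rewrite gt_eqF.
    by rewrite ler_wpM2l// ltW.
  by rewrite (le_trans _ (ltW he))// ler_wpM2l ?ltW// ltrDl.
Unshelve. all: by end_near. Qed.

Lemma smooth_flat_exp p : smooth (flat_exp p).
Proof.
move=> n; elim: n p => // n IH p.
by exists (flat_exp ('X^2 * (p - p^`()))) => // x; exact: is_derive_flat_exp.
Qed.

Definition bumpf (a b x : R) : R := flat_exp 1 (x - a) * flat_exp 1 (b - x).

Lemma flat_exp1_ge0 (x : R) : 0 <= flat_exp 1 x.
Proof. by rewrite /flat_exp; case: ifP => // _; rewrite hornerC mul1r expR_ge0. Qed.

Lemma bump_ge0 (a b x : R) : 0 <= bumpf a b x.
Proof. by rewrite mulr_ge0 ?flat_exp1_ge0. Qed.

Lemma bump_gt0 (a b x : R) : a < x < b -> 0 < bumpf a b x.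
Proof.
move=> /andP[ax xb]; rewrite /bumpf /flat_exp !subr_gt0 ax xb !hornerC !mul1r.
by rewrite mulr_gt0// expR_gt0.
Qed.

Lemma smooth_bump (a b : R) : smooth (bumpf a b).
Proof.
apply: smoothM; first exact: smooth_shift (smooth_flat_exp _).
have := smooth_affine (-1) b (smooth_flat_exp 1).
by under eq_fun do rewrite mulN1r addrC.
Qed.

End flat_exponential.

(** * Smooth functions of compact support *)

Definition test (a b : R) f := smooth f /\ forall x, x < a \/ b < x -> f x = 0.

Lemma test_bump (a b : R) : test a b (bumpf a b).
Proof.
split; first exact: smooth_bump.
by move=> x [xa|bx]; rewrite /bumpf /flat_exp !subr_gt0; [rewrite (ltNge a) (ltW xa) mul0r|rewrite (ltNge x) (ltW bx) mulr0].
Qed.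

Lemma test_derive (a b : R) f : test a b f -> test a b (derive1 f).
Proof.
move=> [sf f0]; have [df sf'] := smooth_derive sf; split => // x xab.
rewrite derive1E (@near_eq_derive _ _ _ _ (fun=> 0)).
  exact: derive_cst.
case: xab => [xa|bx].
  by apply: filterS (lt_nbhsl xa) => y ya; apply: f0; left.
by apply: filterS (lt_nbhsr bx) => y ya; apply: f0; right.
Qed.

Lemma testM (a b : R) f g : test a b f -> smooth g -> test a b (fun x => f x * g x).
Proof.
by move=> [sf f0] sg; split=> [|x /f0 ->]; [exact: smoothM|rewrite mul0r].
Qed.

Lemma test_shift (a b h : R) f : test a b f -> test (a - h) (b - h) (fun x => f (x + h)).
Proof.
move=> [sf f0]; split=> [|x xab]; first exact: smooth_shift.
by apply: f0; case: xab => xab; [left|right]; lra.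
Qed.

Lemma testW (a b a' b' : R) f : a' <= a -> b <= b' -> test a b f -> test a' b' f.
Proof.
move=> aa bb [sf f0]; split=> // x [xa|xb]; apply: f0; [left|right]; lra.
Qed.

Lemma compact_support_bounded (a b : R) f : continuous f ->
  (forall x, x < a \/ b < x -> f x = 0) -> exists M, forall x, `|f x| <= M.
Proof.
move=> cf f0.
have [ba|ab] := ltP b a.
  exists 0 => x; rewrite f0 ?normr0//.
  by have [xa|ax] := ltP x a; [left|right; lra].
have cn : {within `[a, b], continuous (fun x => `|f x|)}.
  by apply: continuous_subspaceT => x; apply: cvg_norm; exact: cf.
have [c _ cM] := EVT_max ab cn.
exists `|f c| => x.
have [xa|ax] := ltP x a; first by rewrite f0 ?normr0//; left.
have [bx|xb] := ltP b x; first by rewrite f0 ?normr0//; right.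
by apply: cM; rewrite in_itv/= ax.
Qed.

Lemma compact_support_L1 (a b : R) f : continuous f ->
  (forall x, x < a \/ b < x -> f x = 0) -> L1 f /\
  integ f = \int[@lebesgue_measure R]_(x in `[a, b]) f x.
Proof.
move=> cf f0.
have fE : f \_ `[a, b] = f.
  apply/funext => x; rewrite patchE; case: ifPn => // xab.
  apply/esym/f0; move: xab; rewrite notin_setE /= in_itv /= => /negP.
  by rewrite negb_and -!ltNge => /orP[]; [left|right].
split; last by rewrite [RHS]Rintegral_mkcond fE.
have := @continuous_compact_integrable R f `[a, b]%classic (@segment_compact _ a b).
move=> /(_ (continuous_subspaceT cf)) H.
rewrite /L1 -fE -restrict_EFin.
by apply/integrable_restrict => //=; rewrite setTI.
Qed.

Lemma test_facts (a b : R) f : test a b f ->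
  [/\ continuous f, exists M, forall x, `|f x| <= M & L1 f].
Proof.
move=> [sf f0]; have cf := smooth_continuous sf; split=> //.
  exact: compact_support_bounded f0.
by have [] := compact_support_L1 cf f0.
Qed.

(** Two integrations by parts at once: [g] is the derivative of the compactly supported [G], so its
    integral vanishes. *)
Lemma ct_derive2 (a b xi : R) f : test a b f ->
  ct (derive1 (derive1 f)) xi = - xi ^+ 2 * ct f xi.
Proof.
move=> tf; have tf1 := test_derive tf; have tf2 := test_derive tf1.
wlog ab : a b tf tf1 tf2 / a < b.
  by move=> H; apply: (H (Num.min a b - 1) (Num.max a b + 1)); try (apply: testW _ _ _; eassumption || idtac); rewrite ?ltrD2 ?lerBlDr ?ler_wpDr ?ge_min ?le_max ?lexx ?orbT//; have := ge_min a a b; have := le_max a a b; rewrite !lexx /= => *; lra.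
have [df sf'] := smooth_derive tf.1; have [df' _] := smooth_derive sf'.
have [cf _ Lf] := test_facts tf; have [cf1 _ Lf1] := test_facts tf1.
have [cf2 _ Lf2] := test_facts tf2.
pose G x := derive1 f x * cos (x * xi) + xi * (f x * sin (x * xi)).
pose g x := derive1 (derive1 f) x * cos (x * xi) + xi ^+ 2 * (f x * cos (x * xi)).
have dG (x : R) : is_derive x 1 G (g x).
  by apply: is_derive_eq; rewrite /GRing.scale /= /g; ring.
have Lc := L1_cos xi Lf; have Lc2 := L1_cos xi Lf2.
have cg : continuous g.
  move=> x; apply: cvgD.
    by apply: cvgM; [exact: cf2|exact: continuous_cosM].
  by apply: cvgM; [exact: cvg_cst|apply: cvgM; [exact: cf|exact: continuous_cosM]].
(* The unit margins put the ends of the integration interval strictly outside [[a, b]], where [G]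
   vanishes. *)
have g0 x : x < a - 1 \/ b + 1 < x -> g x = 0.
  move=> xab; have xab' : x < a \/ b < x by case: xab => xab; [left|right]; lra.
  by rewrite /g tf.2// tf2.2//; ring.
have G0 x : x < a \/ b < x -> G x = 0.
  by move=> xab; rewrite /G tf.2// tf1.2//; ring.
suff Ig : integ g = 0.
  have := Ig; rewrite /g integD//; last exact: L1Zl.
  by rewrite integZl// -/(ct f xi) -/(ct _ xi) => ?; lra.
have [_ ->] := compact_support_L1 cg g0.
rewrite /Rintegral (@continuous_FTC2 _ g G).
- rewrite !G0; [by rewrite subee|left; lra|right; lra].
- lra.
- exact: continuous_subspaceT.
- have cG : continuous G.
    move=> x; apply: differentiable_continuous; apply/derivable1_diffP.
    by have [] := dG x.
  split=> [x _||].
  + by have [] := dG x.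
  + by apply: cvg_at_right_filter; exact: cG.
  + by apply: cvg_at_left_filter; exact: cG.
- by move=> x _; rewrite derive1E; exact: derive_val.
Qed.

(** By [ct_derive2], the absolute value of [(1 + xi ^+ 2) * ct f xi] is at most the sum of the L1
    norms of [f] and of its second derivative. *)
Lemma fourier_nice_test (a b : R) f : test a b f -> fourier_nice f.
Proof.
move=> tf; have [cf bf Lf] := test_facts tf.
have tf2 := test_derive (test_derive tf); have [_ _ Lf2] := test_facts tf2.
split=> //.
set C := integ (fun x => `|f x|) + integ (fun x => `|derive1 (derive1 f) x|).
have [LC _] := @integ_cauchy R.
apply: (le_L1 (g := fun xi => C * (1 + xi ^+ 2)^-1)); [exact: ct_meas| |exact: L1Zl].
move=> xi; rewrite ler_pdivlMr ?ltr_wpDr ?sqr_ge0// mulrDr mulr1 /C lerD ?ct_bound//.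
have -> : `|ct f xi| * xi ^+ 2 = `|ct (derive1 (derive1 f)) xi|.
  by rewrite (ct_derive2 _ tf) normrM normrN (ger0_norm (sqr_ge0 _)) mulrC.
exact: ct_bound.
Qed.

Lemma test_schwartz (a b : R) f : test a b f -> real_schwartz f.
Proof.
move=> tf; split; first exact: smooth_on_setT tf.1.
have tn n : test a b (derive1n n f).
  by elim: n => // n IH; rewrite derive1nS; exact: test_derive.
move=> n k; have [cf _ _] := test_facts (tn n); have [_ f0] := tn n.
have := @compact_support_bounded a b (fun x => x ^+ k * derive1n n f x).
case.
- move=> x; apply: cvgM; last exact: cf; exact: exprn_continuous.
- by move=> x /f0 ->; rewrite mulr0.
by move=> M HM; exists M => x; rewrite -normrX -normrM.
Qed.

Lemma integ_bump_gt0 (a b : R) : a < b -> 0 < integ (bumpf a b).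
Proof.
move=> ab; have [cb _ Lb] := test_facts (test_bump a b).
(* On the middle third the bump has a positive minimum. *)
pose u := a + (b - a) / 3; pose v := a + 2 * (b - a) / 3.
have uv : u <= v by rewrite /u /v; lra.
have [c cuv cmin] := EVT_min uv (continuous_subspaceT cb).
have bc : 0 < bumpf a b c.
  by apply: bump_gt0; move: cuv; rewrite in_itv/= /u /v => ?; lra.
suff H : ((bumpf a b c * (v - u))%:E <= \int[@lebesgue_measure R]_x (bumpf a b x)%:E)%E.
  apply: (@lt_le_trans _ _ (bumpf a b c * (v - u))).
    by rewrite mulr_gt0// /u /v; lra.
  rewrite -lee_fin /integ /Rintegral fineK//; exact: (integrable_fin_num measurableT Lb).
apply: (@le_trans _ _ (\int[@lebesgue_measure R]_(x in `[u, v]) (bumpf a b x)%:E)%E); last first.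
  apply: ge0_subset_integral => //.
    by apply/measurable_EFinP; exact: L1_meas Lb.
  by move=> x _; rewrite lee_fin bump_ge0.
apply: (@le_trans _ _ (\int[@lebesgue_measure R]_(x in `[u, v]) (bumpf a b c)%:E)%E).
  rewrite integral_cst//= lebesgue_measure_itv/= lte_fin.
  by case: ltP => [_|vu]; rewrite ?EFinM ?EFinB// mule0 lee_fin mulr_ge0_le0 ?bump_ge0//; lra.
apply: ge0_le_integral => //.
all: try by move=> x xuv; rewrite lee_fin ?cmin ?bump_ge0.
by apply/measurable_EFinP; apply: measurable_funTS; exact: L1_meas Lb.
Qed.

End smooth_functions.

(** * Pairing with the kernel *)

Section kernel_pairing.
Context {R : realType}.
Implicit Types (f g psi : R -> R).

(** The defining identity of the kernel at the real test function [psi], in real parts: the real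
    part of the inverse transform of [psi] is [(2 * pi)^-1] times [ct psi]. *)
Lemma kernel_pairing (T : R) K (a b : R) psi : is_kernel T K -> test a b psi ->
  L1 (fun x => K x * psi x) /\
  integ (fun x => K x * psi x) = integ (fun xi => (2 * pi)^-1 * (ct psi xi * symbol T xi)).
Proof.
move=> [_ tK eK] tpsi.
pose phi x : R[i] := ((psi x)%:C)%C.
have sphi : schwartz phi.
  split; first exact: test_schwartz tpsi.
  apply: (@test_schwartz _ 0 1); split=> // n; exact: Ck_cst.
have [L _] := tK phi sphi.
have E1 x : complex.Re (((K x)%:C)%C * phi x) = K x * psi x by rewrite /= mul0r subr0.
have {}L : L1 (fun x => K x * psi x) by move: L; under eq_fun do rewrite E1.
split=> //.
have := congr1 (@complex.Re R) (eK phi sphi).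
rewrite /regular_distribution /inv_fourier_distribution /cintegral /=.
rewrite -[X in X = _ -> _]/(integ (fun x => complex.Re (((K x)%:C)%C * phi x))).
rewrite (eq_integ E1) => ->.
rewrite -[LHS]/(integ (fun x => complex.Re (((symbol T x)%:C)%C * inv_fourier phi x))).
apply: eq_integ => x.
rewrite /inv_fourier /cintegral /= !mul0r !subr0 mulrC -mulrA; congr (_ * (_ * _)).
by apply: eq_integ => y /=; rewrite mul0r subr0 (mulrC x).
Qed.

(** On the support of [psi], inside []0, +oo[], [expabs s x] is [expR (- s * x)], so the integrals
    are values of the Laplace transform. *)
Definition laplace_pos psi := exists a b : R,
  [/\ 0 < a, test a b psi & forall s, 0 < s -> 0 <= integ (fun x => expabs s x * psi x)].

Lemma L1_expabs_test (a b s : R) psi : test a b psi -> 0 < s ->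
  L1 (fun x => expabs s x * psi x).
Proof.
move=> tpsi s0; have [cpsi [M bM] _] := test_facts tpsi.
by apply: (L1_bounded_mul (M := M)) => //; [have [] := ct_expabs s0 0|exact: cont_meas].
Qed.

Lemma integ_expabs_shift (a b s h : R) psi : 0 < a -> test a b psi -> 0 < s -> 0 < h ->
  integ (fun x => expabs s x * psi (x - h)) = expR (- s * h) * integ (fun x => expabs s x * psi x).
Proof.
move=> a0 tpsi s0 h0.
have tpsi' := test_shift (- h) tpsi.
have [_ ->] := L1_integ_shift h (L1_expabs_test tpsi' s0).
rewrite -integZl; last exact: L1_expabs_test tpsi s0.
apply: eq_integ => x; rewrite addrK mulrA.
have [xa|ax] := ltP x a; first by rewrite tpsi.2 ?mulr0//; left.
have x0 : 0 < x by lra.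
by rewrite /expabs !gtr0_norm ?addr_gt0// mulrDr expRD (mulrC (expR (- s * x))).
Qed.

Definition transposed_fdiff (h : R) psi x := psi x - psi (x - h).

Lemma test_transposed (a b h : R) psi : 0 < h -> test a b psi ->
  test a (b + h) (transposed_fdiff h psi).
Proof.
move=> h0 tpsi; split=> [|x xab].
  move=> n; have := CkD (tpsi.1 n) (CkM (Ck_cst n (-1)) (smooth_shift (- h) tpsi.1 n)).
  by congr (Ck n _); apply/funext => x; rewrite mulN1r.
rewrite /transposed_fdiff !tpsi.2 ?subr0//; case: xab => xab; [left|right|left|right]; lra.
Qed.

(** Shifting by [h] multiplies the Laplace transform by [expR (- s * h)], and [transposed_fdiff h]
    multiplies it by [1 - expR (- s * h)], which is nonnegative. *)
Lemma laplace_pos_shift (h : R) psi : 0 < h -> laplace_pos psi ->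
  laplace_pos (fun x => psi (x - h)) /\ laplace_pos (transposed_fdiff h psi).
Proof.
move=> h0 [a [b [a0 tpsi Lpsi]]]; split.
  exists (a - - h), (b - - h); split=> [||s s0]; first by rewrite opprK addr_gt0.
    exact: test_shift.
  by rewrite (integ_expabs_shift a0 tpsi)// mulr_ge0 ?expR_ge0// Lpsi.
exists a, (b + h); split=> // [|s s0]; first exact: test_transposed.
have L1a := L1_expabs_test tpsi s0.
have L1b := L1_expabs_test (test_shift (- h) tpsi) s0.
rewrite /transposed_fdiff; under eq_integ do rewrite mulrBr.
rewrite integB// (integ_expabs_shift a0 tpsi)// -{1}(mul1r (integ _)) -mulrBl.
by rewrite mulr_ge0 ?Lpsi// subr_ge0 expR_le1 mulNr oppr_le0 mulr_ge0// ltW.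
Qed.

Definition pairs_nonneg f := forall psi, laplace_pos psi ->
  L1 (fun x => f x * psi x) /\ 0 <= integ (fun x => f x * psi x).

(** A translation moves the difference from [f] onto the test function, which stays in the class. *)
Lemma pairs_nonneg_fdiff f (h : R) : 0 < h -> pairs_nonneg f -> pairs_nonneg (fdiff h f).
Proof.
move=> h0 pf psi lpsi; have [lpsi1 lpsi2] := laplace_pos_shift h0 lpsi.
have [L0 _] := pf _ lpsi; have [L1' _] := pf _ lpsi1; have [L2 P2] := pf _ lpsi2.
have [L3 E3] := L1_integ_shift h L1'.
have E : (fun x => f (x + h) * psi (x + h - h)) = (fun x => f (x + h) * psi x).
  by apply/funext => x; rewrite addrK.
rewrite E in L3 E3.
have EB : (fun x => fdiff h f x * psi x) = (fun x => f x * psi x - f (x + h) * psi x).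
  by apply/funext => x; rewrite /fdiff mulrBl.
rewrite EB; split; first exact: L1B.
rewrite integB// -E3 -integB//.
by move: P2; under eq_integ do rewrite /transposed_fdiff mulrBr.
Qed.

Lemma laplace_pos_bump (a b : R) : 0 < a -> laplace_pos (bumpf a b).
Proof.
move=> a0; exists a, b; split=> // [|s s0]; first exact: test_bump.
by apply: integ_ge0 => x; rewrite mulr_ge0 ?bump_ge0// expR_ge0.
Qed.

(** If [f x0] were negative, [f] would be below [f x0 / 2] on a small ball, and a bump supported
    there would pair negatively. *)
Lemma ge0_of_bumps f (x0 r : R) : 0 < r -> {for x0, continuous f} ->
  (forall a b, x0 - r < a -> b < x0 + r -> a < x0 < b ->
     L1 (fun x => f x * bumpf a b x) /\ 0 <= integ (fun x => f x * bumpf a b x)) ->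
  0 <= f x0.
Proof.
move=> r0 cf H; rewrite leNgt; apply/negP => fx0.
have e0 : 0 < - (f x0 / 2) by lra.
have /cvgrPdist_lt /(_ _ e0) [d /= d0 Hd] := cf.
pose e := Num.min (r / 2) (d / 2).
have ep : 0 < e by rewrite lt_min !divr_gt0.
have [er ed] : e < r /\ e < d.
  have h1 : e <= r / 2 by rewrite ge_min lexx.
  have h2 : e <= d / 2 by rewrite ge_min lexx orbT.
  by split; lra.
have xe : x0 - e < x0 < x0 + e by lra.
have [|||L P] := H (x0 - e) (x0 + e); [lra|lra|exact: xe|].
have [_ _ Lb] := test_facts (test_bump (x0 - e) (x0 + e)).
have ip : 0 < integ (bumpf (x0 - e) (x0 + e)) by apply: integ_bump_gt0; lra.
have : integ (fun x => f x * bumpf (x0 - e) (x0 + e) x) <= integ (fun x => f x0 / 2 * bumpf (x0 - e) (x0 + e) x).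
  apply: le_integ => //; first exact: L1Zl.
  move=> x; have [xin|xout] := boolP ((x0 - e < x) && (x < x0 + e)).
    rewrite ler_wpM2r ?bump_ge0//.
    have /Hd : ball x0 d x by rewrite /ball /= ltr_norml; move: xin => /andP[? ?]; lra.
    rewrite ltr_norml => /andP[? ?]; lra.
  have -> : bumpf (x0 - e) (x0 + e) x = 0; last by rewrite !mulr0.
  rewrite /bumpf /flat_exp !subr_gt0; move: xout; rewrite negb_and => /orP[] /negbTE ->.
    by rewrite mul0r.
  by rewrite mulr0.
rewrite integZl// => H2.
have : f x0 / 2 * integ (bumpf (x0 - e) (x0 + e)) < 0.
  by rewrite nmulr_rlt0//; lra.
lra.
Qed.

Lemma continuous_foldr_fdiff f hs (x : R) : (forall x, 0 < x -> {for x, continuous f}) ->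
  all (fun h => 0 < h) hs -> 0 < x -> {for x, continuous (foldr fdiff f hs)}.
Proof.
move=> cf; elim: hs x => [x _ x0|h hs IH x /= /andP[h0 hs0] x0]; first exact: cf.
apply: cvgB; first exact: IH.
apply: (@continuous_comp _ _ _ (fun x : R => x + h) (foldr fdiff f hs)).
  by apply: cvgD; [exact: cvg_id|exact: cvg_cst].
by apply: IH => //; rewrite addr_gt0.
Qed.

Lemma kernel_completely_monotone (T : R) K : 4 / pi ^+ 2 <= T -> is_kernel T K ->
  completely_monotone K.
Proof.
move=> T4 kK; apply: diff_monotone_completely_monotone => hs hs0 x x0.
have pK : pairs_nonneg K.
  move=> psi [a [b [a0 tpsi Lpsi]]].
  have [L ->] := kernel_pairing kK tpsi; split=> //.
  have [|Ls Ps] := symbol_pairing_ge0 T4 (fourier_nice_test tpsi) _ Lpsi.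
    by move=> y y0; apply: tpsi.2; left; lra.
  by rewrite integZl// mulr_ge0// invr_ge0 mulr_ge0// pi_ge0.
have pF : pairs_nonneg (foldr fdiff K hs).
  elim: hs hs0 => // h hs IH /= /andP[h0 hs0]; apply: pairs_nonneg_fdiff => //; exact: IH.
apply: (@ge0_of_bumps _ _ x) => //.
  apply: continuous_foldr_fdiff => // y y0; have [cK _ _] := kK.
  by apply: cK; rewrite gt_eqF.
(* The radius chosen is [x] itself, so the bumps lie in []0, +oo[]. *)
move=> a b; rewrite subrr => a0 _ _; apply: pF.
exact: laplace_pos_bump.
Qed.

End kernel_pairing.

(** * Values of the symbol from the kernel *)

Section symbol_regularity.
Context {R : realType}.
Variable T : R.
Hypothesis T0 : 0 < T.

Lemma sinh_ge (x : R) : 0 <= x -> x <= expR x - expR (- x).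
Proof.
move=> x0; have := expR_ge1Dx x; have : expR (- x) <= 1 by rewrite expR_le1 oppr_le0.
lra.
Qed.

Lemma tanh_den (x : R) : x != 0 -> expR x - expR (- x) != 0.
Proof. by move=> x0; rewrite subr_eq0; apply: contra_neq x0 => /expR_inj; lra. Qed.

Lemma symbol_even (x : R) : symbol T (- x) = symbol T x.
Proof.
rewrite /symbol oppr_eq0; case: ifP => // _; rewrite sqrrN /tanh opprK.
congr (Num.sqrt _); rewrite -(opprB (expR x)) (addrC (expR (- x)) (expR x)).
by rewrite [X in (1 + _) * X]mulNr mulrN invrN mulrNN.
Qed.

Lemma den_gt0 (x : R) : 0 < 1 + T * x ^+ 2.
Proof. by rewrite ltr_wpDr// mulr_ge0 ?sqr_ge0// ltW. Qed.

(** Cleared of denominators, the relation also holds at 0; this form serves the bounds near 0 and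
    the Taylor expansion. *)
Lemma symbol_sqr (x : R) :
  symbol T x ^+ 2 * (1 + T * x ^+ 2) * (expR x - expR (- x)) = x * (expR x + expR (- x)).
Proof.
wlog x0 : x / 0 <= x.
  move=> H; have [/H//|/ltW] := leP 0 x; rewrite -oppr_ge0 => /H.
  by rewrite symbol_even sqrrN opprK; lra.
rewrite /symbol; have [->|xn0] := eqVneq x 0; first by rewrite oppr0 subrr mulr0 mul0r.
have d0 := tanh_den xn0; have s0 := den_gt0 x.
have c0 : 0 < expR x + expR (- x) by rewrite addr_gt0 ?expR_gt0.
rewrite sqr_sqrtr; first by rewrite /tanh; field; rewrite d0 !gt_eqF.
rewrite divr_ge0// mulr_ge0 ?(ltW s0)// /tanh divr_ge0 ?(ltW c0)//.
by have := sinh_ge x0; lra.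
Qed.

(** For [x > 0] the two bounds reduce to [1 + u <= expR u] at [u = 2 * x] and at [u = - (2 * x)].
    They give continuity at 0 by squeezing, and boundedness. *)
Lemma symbol_sqr_bounds (x : R) :
  1 - `|x| <= symbol T x ^+ 2 * (1 + T * x ^+ 2) <= 1 + `|x|.
Proof.
wlog x0 : x / 0 <= x.
  move=> H; have [/H//|/ltW] := leP 0 x; rewrite -oppr_ge0 => /H.
  by rewrite symbol_even sqrrN normrN.
rewrite ger0_norm//.
have [->|xn0] := eqVneq x 0.
  by rewrite /symbol eqxx expr0n /= mulr0 !addr0 subr0 expr1n mulr1 lexx.
have xp : 0 < x by rewrite lt_neqAle eq_sym xn0.
have S := symbol_sqr x; set A := symbol T x ^+ 2 * _ in S *.
have d0 : 0 < expR x - expR (- x) by rewrite (lt_le_trans xp)// sinh_ge.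
have e1 := expR_ge1Dx (2 * x); have e2 := expR_ge1Dx (- (2 * x)).
have E1 : expR (2 * x) * expR (- x) = expR x by rewrite -expRD; congr expR; ring.
have E2 : expR (- (2 * x)) * expR x = expR (- x) by rewrite -expRD; congr expR; ring.
have p1 := expR_gt0 x; have p2 := expR_gt0 (- x).
have h1 : (1 + 2 * x) * expR (- x) <= expR x by rewrite -E1 ler_pM2r.
have h2 : (1 - 2 * x) * expR x <= expR (- x) by rewrite -E2 ler_pM2r.
by rewrite -(ler_pM2r d0) -[X in _ && X](ler_pM2r d0) S; apply/andP; split; lra.
Qed.

Lemma symbol_ge0 (x : R) : 0 <= symbol T x.
Proof. by rewrite /symbol; case: ifP => // _; exact: sqrtr_ge0. Qed.

Lemma symbol_bound (x : R) : `|symbol T x| <= 3 + T^-1.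
Proof.
have /andP[_ H] := symbol_sqr_bounds x; have s0 := den_gt0 x.
have h1 : symbol T x ^+ 2 <= 2 + T^-1.
  rewrite -(ler_pM2r s0) (le_trans H)//.
  have T1 : 0 < T^-1 by rewrite invr_gt0.
  have -> : (2 + T^-1) * (1 + T * x ^+ 2) = 2 + T^-1 + 2 * T * x ^+ 2 + x ^+ 2.
    by field; rewrite gt_eqF.
  have h : `|x| <= 1 + x ^+ 2.
    rewrite -(real_normK (num_real x)).
    have := normr_ge0 x; have := sqr_ge0 (`|x| - 1); nra.
  have : 0 <= T * x ^+ 2 by rewrite mulr_ge0 ?sqr_ge0// ltW.
  lra.
rewrite ger0_norm ?symbol_ge0//.
have := sqr_ge0 (symbol T x - 1); nra.
Qed.

Lemma symbol_continuous : continuous (symbol T).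
Proof.
move=> x; have [->|x0] := eqVneq x 0.
  have m1 : symbol T y ^+ 2 @[y --> (0 : R)] --> (1 : R).
    have c1 : ((1 - `|y|) / (1 + T * y ^+ 2)) @[y --> (0 : R)] --> (1 : R).
      have h : {for 0, continuous (fun y : R => (1 - `|y|) / (1 + T * y ^+ 2))}.
        apply: cvgM; first by apply: cvgB; [exact: cvg_cst|exact: norm_continuous].
        apply: cvgV; first by rewrite gt_eqF// den_gt0.
        apply: cvgD; first exact: cvg_cst.
        by apply: cvgM; [exact: cvg_cst|exact: exprn_continuous].
      by move: h; rewrite /prop_for /continuous_at normr0 expr0n /= mulr0 subr0 addr0 divr1.
    have c2 : ((1 + `|y|) / (1 + T * y ^+ 2)) @[y --> (0 : R)] --> (1 : R).
      have h : {for 0, continuous (fun y : R => (1 + `|y|) / (1 + T * y ^+ 2))}.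
        apply: cvgM; first by apply: cvgD; [exact: cvg_cst|exact: norm_continuous].
        apply: cvgV; first by rewrite gt_eqF// den_gt0.
        apply: cvgD; first exact: cvg_cst.
        by apply: cvgM; [exact: cvg_cst|exact: exprn_continuous].
      by move: h; rewrite /prop_for /continuous_at normr0 expr0n /= mulr0 !addr0 divr1.
    apply: (squeeze_cvgr _ c1 c2); apply: nearW => y.
    by rewrite ler_pdivrMr ?den_gt0// ler_pdivlMr ?den_gt0// symbol_sqr_bounds.
  have -> : symbol T = fun y => Num.sqrt (symbol T y ^+ 2).
    by apply/funext => y; rewrite sqrtr_sqr ger0_norm// symbol_ge0.
  have e0 : symbol T 0 = 1 by rewrite /symbol eqxx.
  rewrite /continuous_at e0 expr1n.
  by apply: (continuous_cvg _ (@sqrt_continuous R 1)).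
pose g (y : R) := Num.sqrt (y / ((1 + T * y ^+ 2) * tanh y)).
have xg : {near x, g =1 symbol T}.
  near=> y; rewrite /symbol ifF//; apply/negbTE.
  near: y; exact: (open_neq x0).
rewrite /continuous_at; have -> : symbol T x = g x by rewrite /symbol (negbTE x0).
apply: cvg_trans (near_eq_cvg xg) _.
suff H : (y / ((1 + T * y ^+ 2) * tanh y)) @[y --> x] --> x / ((1 + T * x ^+ 2) * tanh x).
  by apply: (continuous_cvg _ _ H); exact: sqrt_continuous.
apply: cvgM; first exact: cvg_id.
have d0 := tanh_den x0.
have c0 : expR x + expR (- x) != 0 by rewrite gt_eqF// addr_gt0 ?expR_gt0.
have eN : expR (- y) @[y --> x] --> expR (- x).
  apply: (@continuous_comp _ _ _ (fun y : R => - y) expR); last exact: continuous_expR.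
  by apply: cvgN; exact: cvg_id.
apply: cvgV.
  apply: mulf_neq0; first by rewrite gt_eqF// den_gt0.
  by apply: mulf_neq0 => //; exact: invr_neq0.
apply: cvgM.
  apply: cvgD; first exact: cvg_cst.
  by apply: cvgM; [exact: cvg_cst|exact: exprn_continuous].
rewrite /tanh; apply: cvgM; first by apply: cvgB => //; exact: continuous_expR.
by apply: cvgV => //; apply: cvgD => //; exact: continuous_expR.
Unshelve. all: by end_near. Qed.

Lemma L1_ct_symbol (a b : R) psi : test a b psi -> L1 (fun xi => ct psi xi * symbol T xi).
Proof.
move=> tpsi; have [_ _ _ Lct] := fourier_nice_test tpsi.
apply: (L1_bounded_mul (M := 3 + T^-1)) => //; last exact: symbol_bound.
by apply: cont_meas; exact: symbol_continuous.
Qed.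

Variable K : R -> R.
Hypothesis kK : is_kernel T K.

Lemma test_scaled (a b : R) eta n : test a b eta ->
  test (n.+1%:R * a) (n.+1%:R * b) (fun x => eta (n.+1%:R^-1 * x)).
Proof.
move=> [se e0]; split=> [|x xab].
  by have := smooth_affine n.+1%:R^-1 0 se; under eq_fun do rewrite addr0.
apply: e0; case: xab => xab; [left|right].
  by rewrite mulrC ltr_pdivrMr// mulrC.
by rewrite mulrC ltr_pdivlMr// mulrC.
Qed.

Lemma ct_scaled f n (xi : R) : L1 f ->
  ct (fun x => f (n.+1%:R^-1 * x)) xi = n.+1%:R * ct f (n.+1%:R * xi).
Proof.
move=> Lf; have n0 : 0 < n.+1%:R^-1 :> R by rewrite invr_gt0.
have [_ E] := L1_integ_affine_pos 0 n0 (L1_cos (n.+1%:R * xi) Lf).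
rewrite [X in _ = _ * X]E mulrA divff ?pnatr_eq0// mul1r; apply: eq_integ => x.
by rewrite addr0; congr (_ * cos _); field; rewrite nat1r pnatr_eq0.
Qed.

Lemma ct_modulated f (x0 xi : R) : L1 f ->
  ct (fun x => f x * cos (x * x0)) xi = 2^-1 * (ct f (xi - x0) + ct f (xi + x0)).
Proof.
move=> Lf; have h1 := L1_cos (xi - x0) Lf; have h2 := L1_cos (xi + x0) Lf.
rewrite /ct -integD// -integZl; last exact: L1D.
apply: eq_integ => x; by rewrite (mulrBr x) (mulrDr x) cosB cosD; field.
Qed.

(** Pairing with a cutoff of width proportional to [n.+1%:R] averages the symbol around [x0] and
    [- x0] against a rescaled [ct eta], of mass [2 * pi * eta 0]. The symbol being bounded,
    continuous and even, the averages converge. *)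
Lemma kernel_transform_cvg (a b x0 : R) eta : test a b eta ->
  integ (fun x => K x * (eta (n.+1%:R^-1 * x) * cos (x * x0))) @[n --> \oo] -->
  eta 0 * symbol T x0.
Proof.
move=> te; have [ce [M bM] Le] := test_facts te.
have nice := fourier_nice_test te; have [_ _ _ Lct] := nice.
have ml : measurable_fun setT (symbol T) by apply: cont_meas; exact: symbol_continuous.
have mlc (c d : R) : measurable_fun setT (fun u => symbol T (c * u + d)).
  apply: cont_meas => u.
  apply: (@continuous_comp _ _ _ (fun u : R => c * u + d) (symbol T)); last exact: symbol_continuous.
  by apply: cvgD; [apply: cvgM; [exact: cvg_cst|exact: cvg_id]|exact: cvg_cst].
have Lu (c d : R) : L1 (fun u => ct eta u * symbol T (c * u + d)).
  by apply: (L1_bounded_mul (M := 3 + T^-1)) => // u; exact: symbol_bound.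
have E n : integ (fun x => K x * (eta (n.+1%:R^-1 * x) * cos (x * x0))) =
    (2 * pi)^-1 * (2^-1 * (integ (fun u => ct eta u * symbol T (n.+1%:R^-1 * u + x0)) +
       integ (fun u => ct eta u * symbol T (n.+1%:R^-1 * u - x0)))).
  have ts := test_scaled n te.
  have [_ _ Ls] := test_facts ts.
  have tm := testM ts (fun k => (Ck_cos k x0).1).
  have [_ ->] := kernel_pairing kK tm.
  rewrite integZl; last exact: L1_ct_symbol tm.
  congr (_ * _).
  have Hs (d : R) : L1 (fun xi => ct (fun x => eta (n.+1%:R^-1 * x)) (xi - d) * symbol T xi) /\
     integ (fun xi => ct (fun x => eta (n.+1%:R^-1 * x)) (xi - d) * symbol T xi) =
     integ (fun u => ct eta u * symbol T (n.+1%:R^-1 * u + d)).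
    have n0 : 0 < n.+1%:R :> R by [].
    have [L2 E2] := L1_integ_affine_pos 0 n0 (Lu n.+1%:R^-1 d).
    have E3 : (fun x => ct eta (n.+1%:R * x + 0) * symbol T (n.+1%:R^-1 * (n.+1%:R * x + 0) + d)) =
       (fun x => ct eta (n.+1%:R * x) * symbol T (x + d)).
      apply/funext => x; rewrite addr0; congr (_ * symbol T (_ + _)).
      by rewrite mulrA mulVf ?mul1r// pnatr_eq0.
    rewrite E3 in L2 E2.
    have [L4 E4] := L1_integ_shift (- d) (L1Zl n.+1%:R L2).
    have E5 x : n.+1%:R * (ct eta (n.+1%:R * (x - d)) * symbol T (x - d + d)) =
        ct (fun x => eta (n.+1%:R^-1 * x)) (x - d) * symbol T x.
      by rewrite (ct_scaled n (x - d) Le) subrK mulrA.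
    split; first exact: eq_L1 E5 L4.
    by rewrite -(eq_integ E5) -E4 integZl// E2.
  have [L5 E5] := Hs x0; have [L6 E6] := Hs (- x0).
  rewrite opprK in L6 E6.
  have := integZl 2^-1 (L1D L5 L6); rewrite (integD L5 L6) E5 E6 => <-.
  by apply: eq_integ => xi; rewrite (ct_modulated x0 xi Ls) -mulrDl -mulrA.
rewrite (eq_cvg _ _ E).
have C (d : R) : integ (fun u => ct eta u * symbol T (n.+1%:R^-1 * u + d)) @[n --> \oo] -->
    2 * pi * eta 0 * symbol T d.
  have -> : 2 * pi * eta 0 * symbol T d = integ (fun u => ct eta u * symbol T d).
    rewrite -(ct_inversion0 ce bM Le Lct) mulrC -integZl//; apply: eq_integ => u; exact: mulrC.
  have [||||_ Cn] := @integ_dom R (fun n u => ct eta u * symbol T (n.+1%:R^-1 * u + d)) (fun u => ct eta u * symbol T d) (fun u => (3 + T^-1) * `|ct eta u|).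
  - by move=> n; exact: L1_meas (Lu _ _).
  - by apply: L1Zl; exact: L1_norm.
  - by move=> n u; rewrite normrM mulrC ler_wpM2r// symbol_bound.
  - move=> u; apply: cvgM; first exact: cvg_cst.
    apply: cvg_cont; first exact: symbol_continuous.
    rewrite -[X in _ --> X]add0r; apply: cvgD; last exact: cvg_cst.
    rewrite -[X in _ --> X](mul0r u); apply: cvgM; last exact: cvg_cst.
    exact: cvg_harmonic.
  exact: Cn.
have -> : eta 0 * symbol T x0 = (2 * pi)^-1 * (2^-1 * (2 * pi * eta 0 * symbol T x0 + 2 * pi * eta 0 * symbol T (- x0))).
  rewrite symbol_even; move: (pi : R) (pi_gt0 R) => P P0; field.
  by rewrite gt_eqF.
apply: cvgM; first exact: cvg_cst.
by apply: cvgM; [exact: cvg_cst|apply: cvgD; exact: C].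
Qed.

End symbol_regularity.

(** * Positive definiteness through differences *)

Section positive_definite.
Context {R : realType}.
Implicit Types (f g : R -> R).

Definition ddiff (h : R) f (x : R) := 2 * f x - f (x + h) - f (x - h).

(* Bochner's positivity condition, tested only against products of second
   differences, whose cosine transform is a power of [2 - 2 cos (h x)]. *)
Definition diff_positive f := forall (h : R) n, 0 <= iter n (ddiff h) f 0.

Lemma iter_ddiff_ext f g (h : R) n : f =1 g -> iter n (ddiff h) f =1 iter n (ddiff h) g.
Proof. by move=> /funext ->. Qed.

Lemma iter_ddiffD f g (h x : R) n :
  iter n (ddiff h) (fun x => f x + g x) x = iter n (ddiff h) f x + iter n (ddiff h) g x.
Proof. by elim: n x => //= n IH x; rewrite {1}/ddiff !IH /ddiff; ring. Qed.

Lemma iter_ddiffZ (c : R) f (h x : R) n :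
  iter n (ddiff h) (fun x => c * f x) x = c * iter n (ddiff h) f x.
Proof. by elim: n x => //= n IH x; rewrite {1}/ddiff !IH /ddiff; ring. Qed.

Lemma iter_ddiff_cos (a h x : R) n :
  iter n (ddiff h) (fun x => cos (a * x)) x = (2 - 2 * cos (a * h)) ^+ n * cos (a * x).
Proof.
elim: n x => [|n IH] x /=; first by rewrite expr0 mul1r.
by rewrite /ddiff !IH exprS mulrDr mulrBr cosD cosB; ring.
Qed.

Lemma diff_positive_cos (a : R) : diff_positive (fun x => cos (a * x)).
Proof.
move=> h n; rewrite iter_ddiff_cos mulr0 cos0 mulr1 exprn_ge0//.
Qed.

Lemma eq_diff_positive f g : f =1 g -> diff_positive f -> diff_positive g.
Proof. by move=> /funext ->. Qed.

Lemma diff_positiveD f g : diff_positive f -> diff_positive g ->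
  diff_positive (fun x => f x + g x).
Proof. by move=> pf pg h n; rewrite iter_ddiffD addr_ge0. Qed.

Lemma diff_positiveZ (c : R) f : 0 <= c -> diff_positive f ->
  diff_positive (fun x => c * f x).
Proof. by move=> c0 pf h n; rewrite iter_ddiffZ mulr_ge0. Qed.

Lemma diff_positive_lim (f_ : nat -> R -> R) f : (forall n, diff_positive (f_ n)) ->
  (forall x, f_ n x @[n --> \oo] --> f x) -> diff_positive f.
Proof.
move=> pf ff h m.
suff H x : iter m (ddiff h) (f_ n) x @[n --> \oo] --> iter m (ddiff h) f x.
  by apply: (cvgn_ge0 (H 0)) => n; exact: pf.
elim: m x => //= m IH x.
apply: cvgB => //; apply: cvgB => //; apply: cvgM => //; exact: cvg_cst.
Qed.

Lemma iter_ddiff_integ (g : R -> R -> R) (h : R) n : (forall y, L1 (fun x => g x y)) ->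
  forall y, L1 (fun x => iter n (ddiff h) (g x) y) /\
  iter n (ddiff h) (fun y => integ (fun x => g x y)) y =
  integ (fun x => iter n (ddiff h) (g x) y).
Proof.
move=> Lg; elim: n => [|n IH] y //=.
have [A1 A2] := IH y; have [B1 B2] := IH (y + h); have [C1 C2] := IH (y - h).
have L2 := L1Zl 2 A1; have L3 := L1B L2 B1.
rewrite /ddiff; split; first exact: L1B.
by rewrite A2 B2 C2 integB// integB// integZl.
Qed.

Lemma diff_positive_integ (g : R -> R -> R) : (forall y, L1 (fun x => g x y)) ->
  (forall x, diff_positive (g x)) -> diff_positive (fun y => integ (fun x => g x y)).
Proof.
move=> Lg pg h n; have [_ ->] := iter_ddiff_integ h n Lg 0.
by apply: integ_ge0 => x; exact: pg.
Qed.

Lemma diff_positive_cosM (a b : R) : diff_positive (fun x => cos (a * x) * cos (b * x)).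
Proof.
have c0 : 0 <= 2^-1 :> R by rewrite invr_ge0.
apply: eq_diff_positive (diff_positiveZ c0 (diff_positiveD (diff_positive_cos (a + b)) (diff_positive_cos (a - b)))) => x.
by rewrite mulrDl mulrBl cosD cosB; field.
Qed.

(* The square of a cosine transform is a double integral of products of
   cosines, so a nonnegative weight gives positivity of the square. *)
Lemma diff_positive_ct_sqr (k : R -> R) : (forall x, 0 <= k x) -> L1 k ->
  diff_positive (fun y => ct k y ^+ 2).
Proof.
move=> k0 Lk.
have Lc y : L1 (fun x => k x * cos (x * y)) by exact: L1_cos.
have H x : diff_positive (fun y => k x * cos (x * y) * ct k y).
  have H2 : diff_positive (fun y => integ (fun z => k x * (k z * (cos (x * y) * cos (z * y))))).
    apply: diff_positive_integ => [y|z].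
      by have := L1Zl (k x * cos (x * y)) (Lc y); apply: eq_L1 => z; ring.
    by apply: diff_positiveZ => //; apply: diff_positiveZ => //; exact: diff_positive_cosM.
  apply: eq_diff_positive H2 => y.
  by rewrite /ct -integZl//; apply: eq_integ => z; ring.
have H3 : diff_positive (fun y => integ (fun x => k x * cos (x * y) * ct k y)).
  apply: diff_positive_integ => [y|x]; last exact: H.
  by have := L1Zl (ct k y) (Lc y); apply: eq_L1 => x; ring.
apply: eq_diff_positive H3 => y.
rewrite expr2 {2}/ct -integZl//; apply: eq_integ => x; exact: mulrC.
Qed.

Lemma iter_ddiff_bound f (h x B : R) n : 0 <= h ->
  (forall y, `|y - x| <= n%:R * h -> `|f y| <= B) -> `|iter n (ddiff h) f x| <= 4 ^+ n * B.
Proof.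
move=> h0; elim: n x => [|n IH] x Hf /=.
  by rewrite expr0 mul1r; apply: Hf; rewrite subrr normr0 mul0r.
have IHx z : `|z - x| <= h -> `|iter n (ddiff h) f z| <= 4 ^+ n * B.
  move=> zx; apply: IH => y yz; apply: Hf.
  by rewrite -natr1 mulrDl mul1r -(subrKA z) (le_trans (ler_normD _ _))// lerD.
have h1 : `|iter n (ddiff h) f x| <= 4 ^+ n * B by apply: IHx; rewrite subrr normr0.
have h2 : `|iter n (ddiff h) f (x + h)| <= 4 ^+ n * B.
  by apply: IHx; rewrite addrAC subrr add0r ger0_norm.
have h3 : `|iter n (ddiff h) f (x - h)| <= 4 ^+ n * B.
  by apply: IHx; rewrite addrAC subrr add0r normrN ger0_norm.
rewrite {1}/ddiff exprS -mulrA (le_trans (ler_normB _ _))//.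
have := ler_normB (2 * iter n (ddiff h) f x) (iter n (ddiff h) f (x + h)).
rewrite normrM (ger0_norm (_ : 0 <= 2))//.
lra.
Qed.

(** The second difference annihilates the Taylor terms of order 0 and 1, so the degree drops by two,
    and only the term of order 2 reaches the new top coefficient. *)
Lemma ddiff_horner (p : {poly R}) (h : R) n : (size p <= (n.+1).*2.+1)%N ->
  exists q : {poly R}, [/\ ddiff h (horner p) =1 horner q, (size q <= n.*2.+1)%N &
    q`_(n.*2) = - (h ^+ 2) * (n.+1.*2 * n.*2.+1)%:R * p`_(n.+1.*2)].
Proof.
move=> sp.
(* The scalar factor is the second difference at 0 of the monomial of degree [i]; it vanishes for
   [i] equal to 0 or 1. *)
pose q : {poly R} := \sum_(i < n.+1.*2.+1) (((i == 0) :> nat)%:R * 2 - h ^+ i - (- h) ^+ i) *: p^`N(i).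
have qk j : q`_j = \sum_(i < n.+1.*2.+1) (((i == 0) :> nat)%:R * 2 - h ^+ i - (- h) ^+ i) * (p`_(i + j) *+ 'C(i + j, i)).
  by rewrite /q coef_sum; apply: eq_bigr => i _; rewrite coefZ coef_nderivn.
have e0 i : i = 0%N -> ((i == 0) :> nat)%:R * 2 - h ^+ i - (- h) ^+ i = 0.
  by move=> ->; rewrite eqxx !expr0 /=; ring.
have e1 : ((1%N == 0%N) :> nat)%:R * 2 - h ^+ 1 - (- h) ^+ 1 = 0.
  by rewrite /= !expr1; ring.
exists q; split.
- move=> x; rewrite /ddiff /q horner_sum.
  have tay y : p.[x + y] = \sum_(i < n.+1.*2.+1) p^`N(i).[x] * y ^+ i.
    by rewrite (@nderiv_taylor_wide _ n.+1.*2.+1)//; exact: mulrC.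
  rewrite !tay.
  have -> : 2 * p.[x] = \sum_(i < n.+1.*2.+1) p^`N(i).[x] * (((i == 0) :> nat)%:R * 2).
    rewrite big_ord_recl /= big1 => [|i _]; last by rewrite /= mul0r mulr0.
    by rewrite nderivn0 addr0; ring.
  rewrite -!sumrB; apply: eq_bigr => i _; rewrite hornerZ; ring.
- apply/leq_sizeP => j nj; rewrite qk big1// => i _.
  case: i => [[|[|i]] ilt].
  + by rewrite e0 ?mul0r.
  + by rewrite e1 mul0r.
  + rewrite [p`_ _]nth_default ?mul0rn ?mulr0//=; apply: (leq_trans sp).
    by rewrite doubleS !addSn !ltnS (leq_trans nj)// leq_addl.
- have B2 : ('C(n.+1.*2, 2))%:R * 2 = (n.+1.*2 * n.*2.+1)%:R :> R.
    by rewrite -natrM -[X in (_ * X)%N]/(2`!) bin_ffact doubleS ffactnS ffactn1.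
  have lt2 : (2 < n.+1.*2.+1)%N by rewrite doubleS.
  rewrite qk (bigD1 (Ordinal lt2))//= big1 => [|i].
    by rewrite -B2 mul0r add0r addr0 -mulr_natr doubleS add2n; ring.
  case: i => [[|[|[|i]]] ilt] //= _.
  + by rewrite (e0 0%N) ?mul0r.
  + by rewrite e1 mul0r.
  + rewrite [p`_ _]nth_default ?mul0rn ?mulr0//=; apply: (leq_trans sp).
    by rewrite doubleS !addSn !ltnS leq_addl.
Qed.

Lemma iter_ddiff_horner (p : {poly R}) (h : R) n : (size p <= n.*2.+1)%N ->
  iter n (ddiff h) (horner p) 0 = (-1) ^+ n * h ^+ n.*2 * (n.*2)`!%:R * p`_(n.*2).
Proof.
elim: n p => [|n IH] p sp; first by rewrite /= !expr0 fact0 !mul1r horner_coef0.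
rewrite iterSr; have [q [qE sq qc]] := ddiff_horner h sp.
rewrite (iter_ddiff_ext h n qE) IH// qc doubleS !factS !natrM !exprS.
by ring.
Qed.

End positive_definite.

(** * Taylor coefficients of the squared symbol *)

Section exponential_taylor.
Context {R : realType}.

(** Since [|x| <= 1] and the factorial of [k + i] is at least that of [i], the tail is at most
    [|x| ^+ k] times the exponential series at 1. *)
Lemma expR_taylor (x : R) k : `|x| <= 1 ->
  `|expR x - \sum_(i < k) x ^+ i / i`!%:R| <= expR 1 * `|x| ^+ k.
Proof.
move=> x1.
have cx := @is_cvg_series_exp_coeff R x.
have E N (y : R) : series (exp_coeff y) N = \sum_(i < N) y ^+ i / i`!%:R.
  by rewrite /series /= big_mkord; apply: eq_bigr => i _; rewrite exp_coeffE mulrC.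
have P1 N : \sum_(i < N) (i`!%:R)^-1 <= expR 1 :> R.
  have nd : nondecreasing_seq (series (exp_coeff (1 : R))).
    apply/nondecreasing_seqP => M; rewrite /series /= big_nat_recr//= lerDl exp_coeffE.
    by rewrite expr1n mulr1 invr_ge0.
  have := nondecreasing_cvgn_le nd (@is_cvg_series_exp_coeff R 1) N.
  rewrite E; under eq_bigr do rewrite expr1n mul1r.
  by [].
have B N : `|\sum_(i < k + N) x ^+ i / i`!%:R - \sum_(i < k) x ^+ i / i`!%:R| <= expR 1 * `|x| ^+ k.
  rewrite big_split_ord /= addrAC subrr add0r.
  apply: le_trans (ler_norm_sum _ _ _) _.
  apply: (@le_trans _ _ (\sum_(i < N) (i`!%:R)^-1 * `|x| ^+ k)); last first.
    by rewrite -mulr_suml ler_wpM2r// exprn_ge0.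
  apply: ler_sum => i _; rewrite normrM normrX exprD normfV (ger0_norm (ler0n _ _)) mulrC.
  apply: ler_pM; rewrite ?invr_ge0 ?mulr_ge0 ?exprn_ge0 ?ler0n//.
    by rewrite lef_pV2 ?posrE ?ltr0n ?fact_gt0// ler_nat leq_fact// leq_addl.
  by rewrite ler_piMr ?exprn_ge0// exprn_ile1.
have C : expR 1 * `|x| ^+ k - `|\sum_(i < k + N) x ^+ i / i`!%:R - \sum_(i < k) x ^+ i / i`!%:R| @[N --> \oo]
    --> expR 1 * `|x| ^+ k - `|expR x - \sum_(i < k) x ^+ i / i`!%:R|.
  apply: cvgB; first exact: cvg_cst.
  apply: cvg_norm; apply: cvgB; last exact: cvg_cst.
  have : series (exp_coeff x) N @[N --> \oo] --> expR x by exact: cx.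
  rewrite -(cvg_shiftn k); apply: cvg_trans.
  by under eq_cvg do rewrite -E addnC; exact: cvg_id.
by rewrite -subr_ge0; apply: (cvgn_ge0 C) => N; rewrite subr_ge0.
Qed.

Lemma exp_sum_even (x : R) n :
  \sum_(i < n.*2) x ^+ i / i`!%:R + \sum_(i < n.*2) (- x) ^+ i / i`!%:R =
  2 * \sum_(j < n) (x ^+ 2) ^+ j / (j.*2)`!%:R.
Proof.
elim: n => [|n IH]; first by rewrite !big_ord0 mulr0 addr0.
rewrite doubleS !big_ord_recr /= mulrDr -IH -exprM mul2n.
rewrite (exprS (- x)) (exprS x) -mul2n !exprM sqrrN.
by field; rewrite !pnatr_eq0 -!lt0n !fact_gt0.
Qed.

Lemma exp_sum_odd (x : R) n :
  \sum_(i < n.*2.+1) x ^+ i / i`!%:R - \sum_(i < n.*2.+1) (- x) ^+ i / i`!%:R =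
  2 * (x * \sum_(j < n) (x ^+ 2) ^+ j / (j.*2.+1)`!%:R).
Proof.
elim: n => [|n IH]; first by rewrite !big_ord_recl !big_ord0 /= !expr0; ring.
rewrite doubleS big_ord_recr [X in _ - X]big_ord_recr /=.
rewrite big_ord_recr [X in _ - (X + _)]big_ord_recr [in RHS]big_ord_recr /=.
rewrite mulrDr mulrDr -IH -exprM mul2n !(exprS _ n.*2.+1) !(exprS _ n.*2) -mul2n !exprM sqrrN.
by field; rewrite !pnatr_eq0 -!lt0n !fact_gt0.
Qed.

Lemma cosh_taylor (x : R) n : `|x| <= 1 ->
  `|(expR x + expR (- x)) / 2 - \sum_(j < n) (x ^+ 2) ^+ j / (j.*2)`!%:R| <=
  expR 1 * `|x| ^+ n.*2.
Proof.
move=> x1; have h1 := @expR_taylor x n.*2 x1.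
have h2 : `|expR (- x) - \sum_(i < n.*2) (- x) ^+ i / i`!%:R| <= expR 1 * `|x| ^+ n.*2.
  by rewrite -[in leRHS](normrN x); apply: expR_taylor; rewrite normrN.
have E := exp_sum_even x n.
move: h1 h2; rewrite !ler_norml => /andP[? ?] /andP[? ?].
by apply/andP; split; lra.
Qed.

Lemma sinh_taylor (x : R) n : `|x| <= 1 ->
  `|(expR x - expR (- x)) / 2 - x * \sum_(j < n) (x ^+ 2) ^+ j / (j.*2.+1)`!%:R| <=
  expR 1 * `|x| ^+ n.*2.+1.
Proof.
move=> x1; have h1 := @expR_taylor x n.*2.+1 x1.
have h2 : `|expR (- x) - \sum_(i < n.*2.+1) (- x) ^+ i / i`!%:R| <= expR 1 * `|x| ^+ n.*2.+1.
  by rewrite -[in leRHS](normrN x); apply: expR_taylor; rewrite normrN.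
have E := exp_sum_odd x n.
move: h1 h2; rewrite !ler_norml => /andP[? ?] /andP[? ?].
by apply/andP; split; lra.
Qed.

End exponential_taylor.

(** * The power series of the squared symbol *)

Section symbol_coefficients.
Context {R : realType}.
Variable T : R.

(** Division of formal power series by one with constant term 1. Each coefficient depends on all
    earlier ones, so they are built as growing finite sequences [ds]. *)
Lemma deconvolution (sg c : nat -> R) : sg 0%N = 1 ->
  exists d : nat -> R, forall n, \sum_(i < n.+1) d i * sg (n - i)%N = c n.
Proof.
move=> s0.
pose fix ds n : seq R := if n is m.+1 then
  rcons (ds m) (c m - \sum_(i < m) (ds m)`_i * sg (m - i)%N) else [::].
have sz n : size (ds n) = n by elim: n => //= n IH; rewrite size_rcons IH.
have pre n m : (n < m)%N -> (ds m)`_n = (ds n.+1)`_n.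
  elim: m => // m IH; rewrite ltnS leq_eqVlt => /predU1P[->//|nm].
  by rewrite [LHS]/= nth_rcons sz nm IH.
exists (fun n => (ds n.+1)`_n) => n.
rewrite big_ord_recr /= subnn s0 mulr1 nth_rcons sz ltnn eqxx.
rewrite addrC -addrA [X in _ + X](_ : _ = 0) ?addr0//.
rewrite addrC; apply/eqP; rewrite subr_eq0; apply/eqP; apply: eq_bigr => i _.
by rewrite (pre i n)//.
Qed.

(** This and the next two definitions are the coefficients in [z] of [cos sqrt z], of
    [sin sqrt z / sqrt z] and of [cos sqrt z / (1 - T * z)]. *)
Definition cos_coef n : R := (-1) ^+ n / (n.*2)`!%:R.
Definition sinc_coef n : R := (-1) ^+ n / (n.*2.+1)`!%:R.
Definition geom_cos_coef n : R := \sum_(i < n.+1) T ^+ i * cos_coef (n - i).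

Lemma geom_cos_coefS n : geom_cos_coef n.+1 = cos_coef n.+1 + T * geom_cos_coef n.
Proof.
rewrite /geom_cos_coef big_ord_recl /= expr0 mul1r subn0; congr (_ + _).
by rewrite mulr_sumr; apply: eq_bigr => i _; rewrite exprS mulrA.
Qed.

Variable d : nat -> R.
Hypothesis dE : forall n, \sum_(i < n.+1) d i * sinc_coef (n - i) = geom_cos_coef n.

Lemma d0E : d 0 = 1.
Proof.
have := dE 0; rewrite /geom_cos_coef !big_ord_recl !big_ord0 /= /sinc_coef /cos_coef.
by rewrite !expr0 !divr1 !addr0 !mulr1.
Qed.

Lemma poly_bounded (p : {poly R}) : exists2 C : R, 0 <= C & forall y, `|y| <= 1 -> `|p.[y]| <= C.
Proof.
exists (\sum_(i < size p) `|p`_i|) => [|y y1]; first by apply: sumr_ge0.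
rewrite horner_coef (le_trans (ler_norm_sum _ _ _))//; apply: ler_sum => i _.
by rewrite normrM normrX ler_piMr// exprn_ile1.
Qed.

Let Dp n : {poly R} := \poly_(i < n.+1) d i.
Let Sp n : {poly R} := \poly_(i < n.+1) sinc_coef i.
Let Cp n : {poly R} := \poly_(i < n.+1) cos_coef i.

(** As formal power series, [dE] makes the left-hand side vanish; truncation after order [n] leaves
    only higher powers. *)
Lemma truncated_product n : exists q : {poly R},
  (1 - T *: 'X) * (Dp n * Sp n) - Cp n = q * 'X^(n.+1).
Proof.
set Q := _ - _; exists (drop_poly n.+1 Q).
rewrite -[LHS](poly_take_drop n.+1) [take_poly _ _](_ : _ = 0) ?add0r//.
apply/polyP => k; rewrite coef_take_poly coef0; case: ifP => // kn.
have P j : (j < n.+1)%N -> (Dp n * Sp n)`_j = geom_cos_coef j.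
  move=> jn; rewrite coefM -dE; apply: eq_bigr => i _.
  rewrite !coef_poly (leq_trans (ltn_ord i) jn) ifT//.
  by rewrite (leq_ltn_trans _ jn)// leq_subr.
rewrite /Q mulrBl mul1r -scalerAl !coefB coefZ coefXM P// coef_poly kn.
case: k kn => [|k] kn /=.
  by rewrite mulr0 subr0 /geom_cos_coef big_ord_recl big_ord0 expr0 mul1r addr0 subrr.
by rewrite P ?(ltnW kn)// geom_cos_coefS; ring.
Qed.

Hypothesis T0 : 0 < T.

(** Multiplying the difference by [1 + T * x ^+ 2] and by [sinh x] gives three errors of order
    [|x| ^+ n.*2.+3]. Dividing by [sinh x], at least [|x| / 2] in absolute value, costs one power
    and accounts for the factor 2 in the constant. *)
Lemma symbol_sqr_taylor n : exists2 C : R, 0 <= C & forall x, `|x| <= 1 ->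
  `|symbol T x ^+ 2 - (Dp n).[- x ^+ 2]| <= C * `|x| ^+ (n.+1).*2.
Proof.
have [q qE] := truncated_product n.
have [Cq Cq0 Hq] := poly_bounded q; have [CD CD0 HD] := poly_bounded (Dp n).
exists (2 * (expR 1 + Cq + (1 + T) * CD * expR 1)) => [|x x1].
  rewrite mulr_ge0// !addr_ge0 ?expR_ge0// !mulr_ge0 ?expR_ge0// addr_ge0// ltW//.
have [->|xn0] := eqVneq x 0.
  rewrite /symbol eqxx expr0n /= oppr0 horner_coef0 coef_poly /= d0E expr1n subrr normr0.
  by rewrite mulr_ge0 ?exprn_ge0// mulr_ge0// !addr_ge0 ?expR_ge0// !mulr_ge0 ?expR_ge0// addr_ge0// ltW.
have x2 : `|- x ^+ 2| <= 1 by rewrite normrN normrX exprn_ile1.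
have hC := cosh_taylor n.+1 x1; have hS := sinh_taylor n.+1 x1.
set c := (expR x + _) / 2 in hC; set s := (expR x - _) / 2 in hS.
have NX j : (- x ^+ 2) ^+ j = (-1) ^+ j * (x ^+ 2) ^+ j by rewrite [LHS]exprNn.
have sgn j : (-1) ^+ j * (-1) ^+ j = 1 :> R by rewrite -exprMn mulrNN mulr1 expr1n.
have CE : \sum_(j < n.+1) (x ^+ 2) ^+ j / (j.*2)`!%:R = (Cp n).[- x ^+ 2].
  rewrite horner_poly; apply: eq_bigr => j _; rewrite /cos_coef NX.
  by rewrite mulrACA mulrA sgn mul1r mulrC.
have SE : \sum_(j < n.+1) (x ^+ 2) ^+ j / (j.*2.+1)`!%:R = (Sp n).[- x ^+ 2].
  rewrite horner_poly; apply: eq_bigr => j _; rewrite /sinc_coef NX.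
  by rewrite mulrACA mulrA sgn mul1r mulrC.
rewrite CE in hC; rewrite SE in hS.
have QE : (1 + T * x ^+ 2) * ((Dp n).[- x ^+ 2] * (Sp n).[- x ^+ 2]) - (Cp n).[- x ^+ 2] =
    q.[- x ^+ 2] * (- x ^+ 2) ^+ n.+1.
  have := congr1 (fun p => p.[- x ^+ 2]) qE.
  by rewrite /= hornerD hornerN !hornerM hornerXn hornerD hornerN hornerC hornerZ hornerX mulrN opprK.
have m2 := symbol_sqr T0 x; set m := symbol T x ^+ 2 in m2 *.
set D := (Dp n).[_] in QE *; set S := (Sp n).[_] in QE hS; set C := (Cp n).[_] in QE hC.
set w := 1 + T * x ^+ 2 in m2 QE.
have hD : `|D| <= CD by exact: HD.
have hq := Hq _ x2; set Y := q.[_] in QE hq.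
have w1 : 1 <= w by rewrite lerDl mulr_ge0 ?sqr_ge0// ltW.
have wT : w <= 1 + T.
  by rewrite lerD2l ler_piMr ?(ltW T0)// -(real_normK (num_real x)) exprn_ile1.
(* The three terms are the remainder of cosh, the high powers left by [truncated_product] and the
   remainder of sinh. *)
have E : (m - D) * w * s = x * (c - C) - x * (Y * (- x ^+ 2) ^+ n.+1) + w * D * (x * S - s).
  by rewrite -QE /c /s; have := m2; lra.
have s1 : `|x| / 2 <= `|s|.
  have [x0|x0] := leP 0 x.
    by have := sinh_ge x0; rewrite (ger0_norm x0) => ?; rewrite ger0_norm /s; lra.
  have nx : 0 <= - x by rewrite oppr_ge0 ltW.
  have := sinh_ge nx; rewrite opprK (ltr0_norm x0) => ?; rewrite ler0_norm /s; lra.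
have ax : 0 < `|x| by rewrite normr_gt0.
set B := `|x| ^+ n.+1.*2 in hC *.
have B0 : 0 <= B by rewrite exprn_ge0.
have hS2 : `|x * S - s| <= expR 1 * (`|x| * B).
  by rewrite distrC; move: hS; rewrite exprS.
have Xn : `|(- x ^+ 2) ^+ n.+1| = B by rewrite normrX normrN normrX -exprM mul2n.
have e1 : `|m - D| * (`|x| / 2) <= `|(m - D) * w * s|.
  rewrite (normrM _ s) (normrM _ w) -(mulrA `|m - D|) ler_wpM2l//.
  apply: (le_trans s1); apply: ler_peMl; first exact: normr_ge0.
  exact: (le_trans w1 (ler_norm w)).
have e2 : `|(m - D) * w * s| <= `|x| * (expR 1 * B) + `|x| * (Cq * B) + (1 + T) * CD * (expR 1 * (`|x| * B)).
  rewrite E (le_trans (ler_normD _ _))// lerD//.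
    rewrite (le_trans (ler_normB _ _))// lerD// !normrM ?Xn; last by rewrite ler_wpM2l// ler_wpM2r.
    by rewrite ler_wpM2l.
  rewrite !normrM ler_pM ?mulr_ge0//.
  by rewrite ler_pM// ger0_norm// (le_trans _ w1).
have e3 := le_trans e1 e2.
rewrite -(ler_pM2r ax); lra.
Qed.

End symbol_coefficients.

(** * Sign of the Taylor coefficients below the threshold *)

Section symbol_not_positive.
Context {R : realType}.
Variables (T : R) (d : nat -> R).
Hypothesis T0 : 0 < T.
Hypothesis dE : forall n, \sum_(i < n.+1) d i * sinc_coef (n - i) = geom_cos_coef T n.

(* For small [h] the [2 n]-th order difference isolates the Taylor coefficient
   of order [2 n], up to positive factors. *)
Lemma symbol_coef_ge0 n : diff_positive (fun x => symbol T x ^+ 2) -> 0 <= d n.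
Proof.
move=> pos; have [C C0 HC] := symbol_sqr_taylor dE T0 n.
(* The Taylor polynomial rewritten in the variable [x], of degree at most [n.*2], so that
   [iter_ddiff_horner] extracts [d n]. *)
pose P : {poly R} := \sum_(i < n.+1) (d i * (-1) ^+ i) *: 'X^(i.*2).
have PE x : P.[x] = (\poly_(i < n.+1) d i).[- x ^+ 2].
  rewrite horner_poly /P horner_sum; apply: eq_bigr => i _.
  by rewrite hornerZ hornerXn (exprNn (x ^+ 2)) -exprM mul2n mulrA.
have sP : (size P <= n.*2.+1)%N.
  apply/leq_sizeP => j nj; rewrite coef_sum big1// => i _.
  rewrite coefZ coefXn gtn_eqF ?mulr0//; apply: leq_trans nj.
  by rewrite ltnS leq_double -ltnS.
have cP : P`_(n.*2) = (-1) ^+ n * d n.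
  rewrite coef_sum big_ord_recr /= big1 => [|i _].
    by rewrite coefZ coefXn eqxx mulr1 add0r mulrC.
  by rewrite coefZ coefXn (inj_eq double_inj) gtn_eqF ?mulr0.
have key (h : R) : 0 < h -> n%:R * h <= 1 ->
    0 <= h ^+ n.*2 * (n.*2)`!%:R * d n + 4 ^+ n * (C * (n%:R * h) ^+ n.+1.*2).
  move=> h0 nh1; have := pos h n.
  rewrite (@iter_ddiff_ext _ _ (fun x => P.[x] + (symbol T x ^+ 2 - P.[x]))); last by move=> x; rewrite addrC subrK.
  rewrite iter_ddiffD (iter_ddiff_horner _ sP) cP.
  have := @iter_ddiff_bound _ (fun x => symbol T x ^+ 2 - P.[x]) h 0 (C * (n%:R * h) ^+ n.+1.*2) n (ltW h0).
  move=> H; have {}H := H _.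
  have : `|iter n (ddiff h) (fun x : R => symbol T x ^+ 2 - P.[x]) 0| <= 4 ^+ n * (C * (n%:R * h) ^+ n.+1.*2).
    apply: H => y; rewrite subr0 => yh; rewrite PE (le_trans (HC y _))//.
      exact: le_trans nh1.
    by rewrite ler_wpM2l// ler_pXn2r// ?nnegrE ?mulr_ge0 ?(ltW h0).
  have -> : (-1) ^+ n * h ^+ n.*2 * (n.*2)`!%:R * ((-1) ^+ n * d n) = h ^+ n.*2 * (n.*2)`!%:R * d n.
    have e : (-1) ^+ n * (-1) ^+ n = 1 :> R by rewrite -exprMn mulrNN mulr1 expr1n.
    transitivity ((-1) ^+ n * (-1) ^+ n * (h ^+ n.*2 * (n.*2)`!%:R * d n)); first by ring.
    by rewrite e mul1r.
  by rewrite ler_norml => /andP[? ?]; lra.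
rewrite leNgt; apply/negP => dn.
pose A := (n.*2)`!%:R * - d n; pose M := 4 ^+ n * C * n%:R ^+ n.+1.*2.
have A0 : 0 < A by rewrite mulr_gt0 ?oppr_gt0// ltr0n fact_gt0.
have M0 : 0 <= M by apply: mulr_ge0; [apply: mulr_ge0 => //; exact: exprn_ge0|exact: exprn_ge0].
have AM : 0 < A + M by lra.
have n0 : 0 < n.+1%:R :> R by [].
have nn : n%:R + 1 = n.+1%:R :> R by rewrite natr1.
have nnn : 0 <= n%:R :> R by [].
(* This choice ensures [n%:R * h <= 1], [h <= 1] and [M * h ^+ 2 < A], which contradicts [key]. *)
pose h := A / (n.+1%:R * (A + M)).
have h0 : 0 < h by apply: divr_gt0 => //; exact: mulr_gt0.
have hE : h * (n.+1%:R * (A + M)) = A by rewrite divfK// gt_eqF// mulr_gt0.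
have h1 : n.+1%:R * h <= 1.
  have : (n.+1%:R * h) * (A + M) <= 1 * (A + M) by lra.
  by rewrite ler_pM2r.
have nh1 : n%:R * h <= 1 by lra.
have hl : h <= 1 by have := mulr_ge0 nnn (ltW h0); lra.
have := key h h0 nh1.
have -> : h ^+ n.*2 * (n.*2)`!%:R * d n + 4 ^+ n * (C * (n%:R * h) ^+ n.+1.*2) =
  h ^+ n.*2 * (M * h ^+ 2 - A).
  by rewrite /M /A (exprMn _ n%:R h) doubleS -(addn2 n.*2) (exprD h); ring.
rewrite pmulr_rge0 ?exprn_gt0// => H.
have h2 : M * h ^+ 2 <= M * h by rewrite ler_wpM2l// expr2 ler_piMl// ltW.
have h3 : h * (A + M) <= A.
  rewrite -[leRHS]hE ler_pM2l// ler_peMl ?(ltW AM)//; lra.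
have : 0 < h * A by rewrite mulr_gt0.
lra.
Qed.

Lemma sum_convolution (u v : nat -> R) N :
  \sum_(n < N.+1) \sum_(i < n.+1) u i * v (n - i)%N =
  \sum_(i < N.+1) u i * \sum_(k < (N - i).+1) v k.
Proof.
elim: N => [|N IH]; first by rewrite !big_ord_recl !big_ord0 /= !addr0.
rewrite big_ord_recr /= IH [in RHS]big_ord_recr [X in _ + X]big_ord_recr /= subnn.
rewrite big_ord1 addrA; congr (_ + _).
rewrite -big_split /=; apply: eq_bigr => i _.
have -> : (N.+1 - i = (N - i).+1)%N by rewrite subSn// -ltnS.
by rewrite [in RHS]big_ord_recr mulrDr.
Qed.

(** For [r <= 4] the terms of this alternating sum decrease in absolute value, so the partial sums
    are at least the sum [1 - r / 6] of the first two. *)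
Lemma sinc_sum_ge (r : R) N : 0 <= r <= 4 -> 3^-1 <= \sum_(k < N.+1) sinc_coef k * r ^+ k.
Proof.
move=> /andP[r0 r4].
pose a k : R := r ^+ k / (k.*2.+1)`!%:R.
have ad k : a k.+1 <= a k.
  rewrite /a exprSr doubleS (factS k.*2.+2) (factS k.*2.+1) mulnA natrM.
  have f0 : 0 < (k.*2.+1)`!%:R :> R by rewrite ltr0n fact_gt0.
  rewrite invfM mulrA ler_pM2r ?invr_gt0// ler_pdivrMr ?ltr0n ?muln_gt0//.
  rewrite ler_wpM2l ?exprn_ge0// (le_trans r4)// ler_nat.
  by rewrite (@leq_trans (2 * 2))// leq_mul.
have a0 k : 0 <= a k by rewrite divr_ge0 ?exprn_ge0.
have E k : sinc_coef k * r ^+ k = (-1) ^+ k * a k by rewrite /sinc_coef /a; ring.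
under eq_bigr do rewrite E.
have b0 : 3^-1 <= a 0 - a 1.
  by rewrite /a expr0 expr1 (_ : (1.*2.+1)`! = 6%N)// (_ : (0.*2.+1)`! = 1%N)//; lra.
have P M : 3^-1 <= \sum_(k < M.*2.+2) (-1) ^+ k * a k.
  elim: M => [|M IH]; first by rewrite !big_ord_recr big_ord0 /= expr0 expr1; lra.
  rewrite doubleS big_ord_recr /= big_ord_recr /= !exprS -mul2n exprM sqrrN !expr1n.
  by have := ad (M.+1.*2); rewrite doubleS -mul2n; rewrite mul2n; lra.
have [m [->|->]] : exists m, N = m.*2 \/ N = m.*2.+1.
  by exists N./2; have := odd_double_half N; case: odd => /= E1; [right|left]; rewrite -{1}E1.
- case: m => [|m].
    by rewrite big_ord_recr big_ord0 /= expr0; have := a0 1; lra.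
  rewrite doubleS big_ord_recr /= !exprS -mul2n exprM sqrrN !expr1n mul2n.
  by have := a0 (m.*2.+2); have := P m; lra.
- exact: P.
Qed.

(** [X N] is a partial sum at [r] of the series of [cos sqrt z / (1 - T * z)]. Nonnegative [d] keep
    it above [1 / 3], while the recursion [XS], with [q < 1] and [B] tending to [cos (pi / 2) = 0],
    brings it below. *)
Lemma symbol_coef_not_ge0 : T < 4 / pi ^+ 2 -> ~ (forall n, 0 <= d n).
Proof.
move=> T4 d0; pose r : R := (pi / 2) ^+ 2.
have p1 := @pihalf_ge1 R; have p2 := @pihalf_lt2 R.
have r0 : 0 < r by rewrite exprn_gt0//; lra.
have r4 : r <= 4 by rewrite /r; nra.
pose q := T * r.
have q0 : 0 < q by rewrite mulr_gt0.
have q1 : q < 1.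
  have -> : 1 = 4 / pi ^+ 2 * r :> R.
    by rewrite /r; move: (pi : R) (pi_gt0 R) => P P0; field; rewrite gt_eqF.
  by rewrite ltr_pM2r.
pose B N := \sum_(k < N.+1) cos_coef k * r ^+ k.
pose X N := \sum_(i < N.+1) q ^+ i * B (N - i)%N.
have XS N : X N.+1 = q * X N + B N.+1.
  rewrite /X big_ord_recl /= expr0 mul1r subn0 addrC mulr_sumr; congr (_ + _).
  by apply: eq_bigr => i _; rewrite exprS mulrA.
have X3 N : 3^-1 <= X N.
  have -> : X N = \sum_(i < N.+1) (d i * r ^+ i) * \sum_(k < (N - i).+1) sinc_coef k * r ^+ k.
    rewrite -(sum_convolution (fun i => d i * r ^+ i) (fun k => sinc_coef k * r ^+ k)).
    rewrite /X /B -(sum_convolution (fun i => q ^+ i) (fun k => cos_coef k * r ^+ k)).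
    apply: eq_bigr => n _.
    have rE (i : 'I_n.+1) : r ^+ n = r ^+ i * r ^+ (n - i) by rewrite -exprD subnKC// -ltnS.
    transitivity (geom_cos_coef T n * r ^+ n).
      rewrite /geom_cos_coef mulr_suml; apply: eq_bigr => i _.
      by rewrite (rE i) /q exprMn; ring.
    rewrite -dE mulr_suml; apply: eq_bigr => i _.
    by rewrite (rE i); ring.
  rewrite big_ord_recl /= (d0E dE) expr0 !mul1r subn0.
  have s3 M : 3^-1 <= \sum_(k < M.+1) sinc_coef k * r ^+ k by apply: sinc_sum_ge; rewrite (ltW r0).
  rewrite (le_trans (s3 N))// lerDl sumr_ge0// => i _.
  by rewrite !mulr_ge0 ?exprn_ge0 ?(ltW r0)//; have := s3 (N - (bump 0 i))%N; lra.
have B0 : B N @[N --> \oo] --> (0 : R).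
  have := @cvg_cos_coeff' R (pi / 2); rewrite cos_pihalf.
  rewrite -(cvg_shiftS) => H; apply: cvg_trans H; apply: near_eq_cvg; apply: nearW => N.
  rewrite /B /series /= big_mkord; apply: eq_bigr => k _.
  by rewrite /cos_coeff' /cos_coef /r -exprM mul2n -exprnP; ring.
(* With this bound on [B], [1 / 6] is the fixed point of the majorizing recursion for [X], so that
   any excess over it decays geometrically. *)
have e0 : 0 < (1 - q) / 6 by rewrite divr_gt0//; lra.
have /cvgrPdist_lt /(_ _ e0) [J _ HJ] := B0.
have XB k : X (J + k)%N - 6^-1 <= q ^+ k * (X J - 6^-1).
  elim: k => [|k IH]; first by rewrite addn0 expr0 mul1r.
  have := HJ (J + k).+1 _; rewrite /= sub0r normrN => /(_ _).
  rewrite addnS XS exprS => /(_ (leq_trans (leq_addr k J) (leqnSn _))).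
  rewrite ltr_norml => /andP[_ hB].
  have h := ler_wpM2l (ltW q0) IH; rewrite -mulrA; lra.
have C : q ^+ k * (X J - 6^-1) @[k --> \oo] --> 0 * (X J - 6^-1).
  by apply: cvgM; [apply: cvg_expr; rewrite ger0_norm// ltW|exact: cvg_cst].
have C2 : q ^+ k * (X J - 6^-1) - 6^-1 @[k --> \oo] --> 0 * (X J - 6^-1) - 6^-1.
  by apply: cvgB; [exact: C|exact: cvg_cst].
have : 0 <= 0 * (X J - 6^-1) - 6^-1.
  by apply: (cvgn_ge0 C2) => k; have := XB k; have := X3 (J + k)%N; lra.
lra.
Qed.

End symbol_not_positive.

Lemma symbol_sqr_not_diff_positive {R : realType} (T : R) : 0 < T -> T < 4 / pi ^+ 2 ->
  ~ diff_positive (fun x => symbol T x ^+ 2).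
Proof.
move=> T0 T4 pos.
have [|d dE] := @deconvolution R sinc_coef (geom_cos_coef T).
  by rewrite /sinc_coef expr0 divr1.
by apply: (symbol_coef_not_ge0 T0 dE) => // n; exact: (symbol_coef_ge0 T0 dE).
Qed.

(** * Monotone kernels *)

Section kernel_sign.
Context {R : realType}.
Variables (T : R) (K : R -> R).
Hypotheses (T0 : 0 < T) (kK : is_kernel T K).

Lemma test_opp (a b : R) f : test a b f -> test (- b) (- a) (fun x => f (- x)).
Proof.
move=> [sf f0]; split=> [|x xab].
  by have := smooth_affine (-1) 0 sf; under eq_fun do rewrite addr0 mulN1r.
by apply: f0; case: xab => xab; [right|left]; lra.
Qed.

Lemma ct_opp f (xi : R) : L1 f -> ct (fun x => f (- x)) xi = ct f xi.
Proof.
move=> Lf; have [_ E] := L1_integ_opp (L1_cos xi Lf).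
by rewrite [RHS]E; apply: eq_integ => x; rewrite mulNr cosN.
Qed.

(** A pairing with [K] depends on the test function only through its cosine transform, which ignores
    reflections; bumps around [x0] therefore give the same values for [K] and its reflection. *)
Lemma kernel_opp_le (x0 : R) : x0 != 0 -> K (- x0) <= K x0.
Proof.
move=> x00; have [cK _ _] := kK; rewrite -subr_ge0.
apply: (@ge0_of_bumps R (fun x => K x - K (- x)) x0 1) => //.
  apply: cvgB; first exact: cK.
  apply: (@continuous_comp _ _ _ (fun x : R => - x) K).
    by apply: cvgN; exact: cvg_id.
  by apply: cK; rewrite oppr_eq0.
move=> a b _ _ _; have tb := test_bump a b; have tn := test_opp tb.
have [L1b E1] := kernel_pairing kK tb; have [L2 E2] := kernel_pairing kK tn.
have [L3 E3] := L1_integ_opp L2.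
have E : (fun x => K (- x) * bumpf a b (- - x)) = (fun x => K (- x) * bumpf a b x).
  by apply/funext => x; rewrite opprK.
rewrite E in L3 E3.
have EB : (fun x => (K x - K (- x)) * bumpf a b x) = (fun x => K x * bumpf a b x - K (- x) * bumpf a b x).
  by apply/funext => x; rewrite mulrBl.
rewrite EB; split; first exact: L1B.
have [_ _ Lb] := test_facts tb.
have E4 : ct (fun x => bumpf a b (- x)) = ct (bumpf a b).
  by apply/funext => xi; exact: ct_opp.
by rewrite (integB L1b L3) -E3 E1 E2 E4 subrr.
Qed.

Lemma kernel_even (x : R) : x != 0 -> K (- x) = K x.
Proof.
move=> x0; apply/eqP; rewrite eq_le kernel_opp_le//=.
by have := @kernel_opp_le (- x); rewrite opprK oppr_eq0 => ->.
Qed.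

Lemma kernel_cutoff_cvg (a b : R) eta : test a b eta ->
  (forall n, L1 (fun x => K x * eta (n.+1%:R^-1 * x))) /\
  integ (fun x => K x * eta (n.+1%:R^-1 * x)) @[n --> \oo] --> eta 0.
Proof.
move=> te; split=> [n|]; first by have [] := kernel_pairing kK (test_scaled n te).
have := kernel_transform_cvg T0 kK (x0 := 0) te.
rewrite /symbol eqxx mulr1; apply: cvg_trans; apply: near_eq_cvg; apply: nearW => n.
by apply: eq_integ => x; rewrite mulr0 cos0 mulr1.
Qed.

(** The value [s = 1] covers decreasing kernels and [s = -1] increasing ones. *)
Variable s : R.
Hypothesis s1 : s ^+ 2 = 1.
Hypothesis sK : forall x y, 0 < x -> x <= y -> s * K y <= s * K x.

(* Otherwise [s * K] stays below a negative constant near infinity, so its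
   integral against ever wider bumps escaping to infinity could not tend to 0. *)
Lemma monotone_kernel_sign (x0 : R) : 0 < x0 -> 0 <= s * K x0.
Proof.
move=> x00; rewrite leNgt; apply/negP => Kn.
have te := test_bump (1 : R) 2; have [Lk Ck] := kernel_cutoff_cvg te.
have [_ _ Le] := test_facts te.
have eta0 : bumpf 1 2 (0 : R) = 0 by apply: te.2; left; lra.
rewrite eta0 in Ck.
pose c := - (s * K x0) * integ (bumpf 1 2).
have c0 : 0 < c by rewrite mulr_gt0 ?oppr_gt0// integ_bump_gt0//; lra.
have H : 0 <= - c - s * 0.
  have : - c - s * integ (fun x => K x * bumpf 1 2 (n.+1%:R^-1 * x)) @[n --> \oo] --> - c - s * 0.
    apply: cvgB; first exact: cvg_cst.
    by apply: cvgM; [exact: cvg_cst|exact: Ck].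
  (* Discarding the first [N] cutoffs puts the supports of the remaining bumps to the right of
     [x0]. *)
  pose N := Num.truncn x0.
  rewrite -(cvg_shiftn N) => CN; apply: (cvgn_ge0 CN) => n.
  have n1 : x0 <= (n + N).+1%:R.
    rewrite (le_trans (ltW (truncnS_gt x0)))// ler_nat ltnS leq_addl//.
  set m := (n + N)%N in n1 *.
  have n0 : 0 < m.+1%:R^-1 :> R by rewrite invr_gt0.
  have [Lm Em] := L1_integ_affine_pos 0 n0 Le.
  have E : (fun x => bumpf 1 2 (m.+1%:R^-1 * x + 0 : R)) = (fun x => bumpf 1 2 (m.+1%:R^-1 * x)).
    by apply/funext => x; rewrite addr0.
  rewrite E in Lm Em.
  have I0 : 0 < integ (fun x : R => bumpf 1 2 (m.+1%:R^-1 * x)).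
    by have := @integ_bump_gt0 R 1 2; rewrite Em pmulr_rgt0//; apply; lra.
  have I1 : integ (bumpf 1 2) <= integ (fun x : R => bumpf 1 2 (m.+1%:R^-1 * x)).
    by rewrite Em ler_piMl ?(ltW I0)// invf_le1// ler1n.
  have : integ (fun x => s * (K x * bumpf 1 2 (m.+1%:R^-1 * x))) <=
         integ (fun x => s * K x0 * bumpf 1 2 (m.+1%:R^-1 * x)).
    apply: le_integ; [exact: L1Zl|exact: L1Zl|] => x; rewrite mulrA.
    have [x1|x1] := ltP (m.+1%:R^-1 * x) 1; first by rewrite te.2 ?mulr0//; left.
    rewrite ler_wpM2r ?bump_ge0// sK// (le_trans n1)//.
    by move: x1; rewrite mulrC ler_pdivlMr// mul1r.
  rewrite !integZl// /c subr_ge0 => h1; rewrite (le_trans h1)// mulNr opprK.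
  by rewrite ler_nM2l.
lra.
Qed.

Lemma monotone_kernel_abs (x : R) : x != 0 -> `|K x| = s * K x.
Proof.
move=> x0; have h : 0 <= s * K x.
  have [xp|xn|xe] := ltgtP x 0; last by rewrite xe eqxx in x0.
    by rewrite -kernel_even// monotone_kernel_sign// oppr_gt0.
  exact: monotone_kernel_sign.
rewrite -(ger0_norm h) normrM.
have -> : `|s| = 1; last by rewrite mul1r.
by apply/eqP; rewrite -(@eqrXn2 _ 2)// real_normK ?num_real// s1 expr1n.
Qed.

(** By constant sign and evenness [s * K] is [|K|] off 0, so the cutoffs [k n] are nonnegative and
    integrable, and their cosine transforms tend to [s * (eta 0 * symbol T y)]. Squaring removes
    [s], and [eta 0] is positive. *)
Lemma monotone_symbol_positive : diff_positive (fun x => symbol T x ^+ 2).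
Proof.
have te := test_bump (-1 : R) 1; set eta := bumpf (-1) 1 in te.
have e0 : 0 < eta 0 by apply: bump_gt0; lra.
pose k n x := `|K x| * eta (n.+1%:R^-1 * x).
have kE (n : nat) (x : R) : x != 0 -> s * (K x * eta (n.+1%:R^-1 * x)) = k n x.
  by move=> x0; rewrite mulrA /k monotone_kernel_abs.
have [LK _] := kernel_cutoff_cvg te.
have Lk n : L1 (k n) by have [] := eq_integ_ae (L1Zl s (LK n)) (kE n).
have pk n : diff_positive (fun y => ct (k n) y ^+ 2).
  by apply: diff_positive_ct_sqr => // x; rewrite mulr_ge0// bump_ge0.
have Cy y : ct (k n) y @[n --> \oo] --> s * (eta 0 * symbol T y).
  have : s * integ (fun x => K x * (eta (n.+1%:R^-1 * x) * cos (x * y))) @[n --> \oo] --> s * (eta 0 * symbol T y).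
    by apply: cvgM; [exact: cvg_cst|exact: (kernel_transform_cvg T0 kK (x0 := y) te)].
  apply: cvg_trans; apply: near_eq_cvg; apply: nearW => n.
  have LL : L1 (fun x => K x * (eta (n.+1%:R^-1 * x) * cos (x * y))).
    by have := L1_cos y (LK n); apply: eq_L1 => x; rewrite mulrA.
  have E (x : R) : x != 0 -> s * (K x * (eta (n.+1%:R^-1 * x) * cos (x * y))) = k n x * cos (x * y).
    by move=> x0; rewrite -kE//; ring.
  by have [_] := eq_integ_ae (L1Zl s LL) E; rewrite integZl.
have P : diff_positive (fun y => (s * (eta 0 * symbol T y)) ^+ 2).
  apply: (diff_positive_lim pk) => y.
  by apply: cvgM; exact: Cy.
have e2 : 0 <= (eta 0 ^+ 2)^-1 by rewrite invr_ge0 sqr_ge0.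
apply: eq_diff_positive (diff_positiveZ e2 P) => y.
by rewrite (exprMn _ s) s1 mul1r (exprMn _ (eta 0)) mulKf// sqrf_eq0 gt_eqF.
Qed.

End kernel_sign.

Theorem theorem2p6 (R : realType) :
  (forall (T : R) (K : R -> R),
     4 / pi ^+ 2 <= T -> is_kernel T K -> completely_monotone K) /\
  (forall (T : R) (K : R -> R),
     0 < T -> T < 4 / pi ^+ 2 -> is_kernel T K ->
     ~ monotone_on `]0, +oo[ K).
Proof.
split=> [T K|T K T0 T4 kK mK]; first exact: kernel_completely_monotone.
apply: (symbol_sqr_not_diff_positive T0 T4).
have pos (x : R) : 0 < x -> x \in [set` `]0, +oo[ : interval R].
  by move=> x0; rewrite inE /= in_itv /= x0.
case: mK => mK; [apply: (monotone_symbol_positive T0 kK (s := -1))|apply: (monotone_symbol_positive T0 kK (s := 1))].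
- by rewrite sqrrN expr1n.
- move=> x y x0 xy; rewrite !mulN1r lerN2; apply: mK => //; apply: pos => //; exact: lt_le_trans xy.
- by rewrite expr1n.
- move=> x y x0 xy; rewrite !mul1r; apply: mK => //; apply: pos => //; exact: lt_le_trans xy.
Qed.
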